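(* Let $\xi:\mathbb S^1\to\mathbb R$ be a non-degenerated $\mathcal C^2$ function, let $a\in[0,1)$ and $c\in(0,1)$. For $\alpha,\varepsilon>0$ consider the random dynamical system $f_\omega^n$ on $\mathbb S^1$ generated by $f_{\omega_0}(x)=\alpha\,\xi(x+\omega_0)+a\ (\mathrm{mod}\ 1)$, $\omega_0\in[-\varepsilon,\varepsilon]$. Then for $\alpha$ sufficiently large and for $\varepsilon>\alpha^{c-1}$ there exists an invariant measure $\mu(\mathrm d\omega,\mathrm dx)=\mu_\omega(\mathrm dx)\,\mathbb P(\mathrm d\omega)$ for the skew product $\Theta$, where $\mu_\omega$ is absolutely continuous with respect to Lebesgue measure on $\mathbb S^1$ for $\mathbb P$-almost every $\omega\in\Omega$. Moreover, there exist $C\in L^2(\Omega,\mathbb P)$ and $\gamma>0$ such that for $\mathbb P$-almost every $\omega\in\Omega$, every $n\in\mathbb N$, every bounded measurable function $\varphi:\mathbb S^1\to\mathbb R$ and every Lipschitz function $\psi:\mathbb S^1\to\mathbb R$, $$\left|\int_{\mathbb S^1}\varphi\circ f_\omega^n(x)\,\psi(x)\,\mathrm dx-\int_{\mathbb S^1}\varphi(x)\,\mu_{\theta^n\omega}(\mathrm dx)\int_{\mathbb S^1}\psi(x)\,\mathrm dx\right|\le C(\omega)e^{-\gamma n}\|\varphi\|_\infty\|\psi\|_{\mathrm{Lip}}$$ and $$\left|\int_{\mathbb S^1}\varphi\circ f_{\theta^{-n}\omega}^n(x)\,\psi(x)\,\mathrm dx-\int_{\mathbb S^1}\varphi(x)\,\mu_{\omega}(\mathrm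 dx)\int_{\mathbb S^1}\psi(x)\,\mathrm dx\right|\le C(\omega)e^{-\gamma n}\|\varphi\|_\infty\|\psi\|_{\mathrm{Lip}}.$$
   Context: $\mathbb S^1=\mathbb R/\mathbb Z$ with arclength distance $|x-y|$ and Lebesgue measure $m$ (written $\mathrm dx$). A $\mathcal C^2$ function $\xi:\mathbb S^1\to\mathbb R$ is non-degenerated if its critical set $\mathscr C=\{x:\xi'(x)=0\}$ is finite and $\xi''(x)\ne0$ for all $x\in\mathscr C$. Put $f=\alpha\xi+a\ (\mathrm{mod}\ 1)$ and $f_{\omega_0}(x)=f(x+\omega_0)$. Let $\Omega=[-\varepsilon,\varepsilon]^{\mathbb Z}$ with the product Borel $\sigma$-algebra and $\mathbb P=(\nu^\varepsilon)^{\otimes\mathbb Z}$, where $\nu^\varepsilon$ is the uniform probability on $[-\varepsilon,\varepsilon]$; $\theta:\Omega\to\Omega$ is the left shift $(\theta\omega)_i=\omega_{i+1}$. For $\omega\in\Omega$ write $f_\omega=f_{\omega_0}$ and $f^n_\omega=f_{\omega_{n-1}}\circ\cdots\circ f_{\omega_0}$. The skew product is $\Theta:\Omega\times\mathbb S^1\to\Omega\times\mathbb S^1$, $\Theta(\omega,x)=(\theta\omega,f_\omega(x))$. The notation $\mu(\mathrm d\omega,\mathrm dx)=\mu_\omega(\mathrm dx)\mathbb P(\mathrm d\omega)$ means: $\{\mu_\omega\}$ is a family of probability measures on $\mathbb S^1$ with $\omega\mapsto\mu_\omega(B)$ measurable for every Borel $B$, and $\mu(A\times B)=\int_A\mu_\omega(B)\,\mathbb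 P(\mathrm d\omega)$. $\|\varphi\|_\infty$ is the $m$-essential supremum norm and $\|\psi\|_{\mathrm{Lip}}=\|\psi\|_\infty+\sup_{x\ne y}\frac{|\psi(x)-\psi(y)|}{|x-y|}$. *)

(* Defs.v *)
From HB Require Import structures.
From mathcomp Require Import all_boot all_order all_algebra finmap.
From mathcomp Require Import generic_quotient ring_quotient.
From mathcomp Require Import all_classical all_reals all_analysis.
From mathcomp Require Import measurable_realfun.

Set Implicit Arguments.
Unset Strict Implicit.
Unset Printing Implicit Defensive.

Import Order.TTheory GRing.Theory Num.Theory.
Import numFieldNormedType.Exports.

Local Open Scope classical_set_scope.
Local Open Scope ring_scope.
Local Open Scope quotient_scope.

(* The circle R/Z, as the quotient of the additive group R by its subgroup     *)
(* Num.int: the sum on circle R is addition mod 1.  It carries the quotient    *)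
(* topology and the corresponding Borel sigma-algebra.                         *)
Definition circle (R : realType) : Type :=
  Quotient.quot (GRing.ZmodClosed.clone R (@Num.int_num_subdef R) _).

Section circle_structures.
Variable R : realType.

HB.instance Definition _ := Quotient.on (circle R).
HB.instance Definition _ := GRing.Zmodule.on (circle R).

Let circle_open (U : set (circle R)) := open (\pi_(circle R) @^-1` U).

Let circle_openT : circle_open setT.
Proof. exact: openT. Qed.

Let circle_openI (U V : set (circle R)) :
  circle_open U -> circle_open V -> circle_open (U `&` V).
Proof. exact: openI. Qed.

Let circle_open_bigcup (I : Type) (F : I -> set (circle R)) :
  (forall i, circle_open (F i)) -> circle_open (\bigcup_i F i).
Proof. by move=> oF; apply: bigcup_open => i _; exact: oF. Qed.

HB.instance Definition _ := isOpenTopological.Build (circle R)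
  circle_openT circle_openI circle_open_bigcup.
HB.instance Definition _ := isPointed.Build (circle R) 0.
HB.instance Definition _ := Measurable.copy (circle R)
  (g_sigma_algebraType (@open (circle R))).

End circle_structures.

Section circle.
Variable R : realType.

Definition circle_pi (t : R) : circle R := \pi_(circle R) t.

Lemma measurable_circle_pi : measurable_fun [set: R] circle_pi.
Proof.
apply: (@measurability _ _ _ _ _ _ (@open (circle R))) => //.
by move=> _ [U oU <-]; rewrite setTI; apply: open_measurable; exact: oU.
Qed.

(* The image of Lebesgue measure on a fundamental domain.                      *)
Definition circle_lebesgue (B : set (circle R)) : \bar R :=
  lebesgue_measure (circle_pi @^-1` B `&` `[0, 1[).

Let circle_lebesgue0 : circle_lebesgue set0 = 0%E.
Proof. by rewrite /circle_lebesgue preimage_set0 set0I measure0. Qed.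

Let circle_lebesgue_ge0 B : (0 <= circle_lebesgue B)%E.
Proof. exact: measure_ge0. Qed.

Let circle_lebesgue_sigma_additive : semi_sigma_additive circle_lebesgue.
Proof.
exact: (@measure_semi_sigma_additive _ _ _
  (measure_function_pushforward__canonical__measure_function_Measure
    (mrestr (@lebesgue_measure R) (measurable_itv `[0%R, 1%R[))
    measurable_circle_pi)).
Qed.

HB.instance Definition _ := isMeasure.Build _ _ _ circle_lebesgue
  circle_lebesgue0 circle_lebesgue_ge0 circle_lebesgue_sigma_additive.

End circle.

Arguments circle_lebesgue {R} B.

Section circle_functions.
Variable R : realType.

(* Arclength distance: distance to 0 in R/Z of the difference.                 *)
Definition circle_dist (x y : circle R) : R :=
  inf [set `|t| | t in [set t : R | circle_pi t = x - y]].

(* The derivative of a function on the circle, along the flow x + t mod 1.     *)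
Definition circle_derivable (g : circle R -> R) :=
  forall x, derivable (fun t : R => g (x + circle_pi t)) 0 1.

Definition circle_derive (g : circle R -> R) (x : circle R) : R :=
  derive1 (fun t : R => g (x + circle_pi t)) 0.

Definition circle_C2 (g : circle R -> R) :=
  [/\ circle_derivable g, circle_derivable (circle_derive g) &
      continuous (circle_derive (circle_derive g))].

Definition critical_set (g : circle R -> R) : set (circle R) :=
  [set x | circle_derive g x = 0].

Definition nondegenerated (g : circle R -> R) :=
  finite_set (critical_set g) /\
  forall x, critical_set g x -> circle_derive (circle_derive g) x <> 0.

Definition circle_lipschitz (psi : circle R -> R) :=
  exists K : R, forall x y, `|psi x - psi y| <= K * circle_dist x y.

Definition norm_infty (phi : circle R -> R) : \bar R :=
  'N[circle_lebesgue]_+oo[EFin \o phi].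

Definition norm_Lip (psi : circle R -> R) : \bar R :=
  (norm_infty psi +
   ereal_sup [set (`|psi z.1 - psi z.2| / circle_dist z.1 z.2)%:E |
              z in [set z : circle R * circle R | z.1 <> z.2]])%E.

End circle_functions.

Definition noise (R : realType) (eps : {posnum R}) : Type :=
  {t : R | t \in `[- eps%:num, eps%:num]}.

Definition Omega (R : realType) (eps : {posnum R}) : Type := int -> noise eps.

Section noise.
Variables (R : realType) (eps : {posnum R}).

Definition noise_at (i : int) (omega : Omega eps) : R := sval (omega i).

Lemma noise0_subproof : 0 \in `[- eps%:num, eps%:num].
Proof. by rewrite in_itv/= oppr_le0 ge0. Qed.

HB.instance Definition _ := gen_eqMixin (Omega eps).
HB.instance Definition _ := gen_choiceMixin (Omega eps).
HB.instance Definition _ := isPointed.Build (Omega eps)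
  (fun=> exist _ 0 noise0_subproof).

(* The product Borel sigma-algebra, generated by the coordinates.              *)
HB.instance Definition _ := Measurable.copy (Omega eps)
  (g_sigma_algebraType [set A : set (Omega eps) |
    exists i, exists2 B : set R, measurable B & A = noise_at i @^-1` B]).

Lemma noise_lt : - eps%:num < eps%:num.
Proof. by rewrite gtrN. Qed.

(* P is the product of the uniform laws on [-eps, eps]; by Dynkin's lemma this *)
(* determines P.                                                               *)
Definition is_product_uniform (P : probability (Omega eps) R) :=
  forall (J : {fset int}) (B : int -> set R), (forall j, measurable (B j)) ->
  P (\bigcap_(j in [set` J]) noise_at j @^-1` B j) =
  (\prod_(j <- J) uniform_prob noise_lt (B j))%E.

Definition theta (omega : Omega eps) : Omega eps := fun i => omega (i + 1).

Definition theta_inv (omega : Omega eps) : Omega eps := fun i => omega (i - 1).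

End noise.

Section random_dynamical_system.
Variables (R : realType) (xi : circle R -> R) (a alpha : R) (eps : {posnum R}).

Definition fmap (w : R) (x : circle R) : circle R :=
  circle_pi (alpha * xi (x + circle_pi w) + a).

(* f_omega^n = f_(omega_(n-1)) o ... o f_(omega_0): the last map applied has    *)
(* index n - 1.                                                                *)
Fixpoint fiter (n : nat) (omega : Omega eps) (x : circle R) : circle R :=
  if n is k.+1 then fmap (noise_at k omega) (fiter k omega x) else x.

Definition skew_product (z : Omega eps * circle R) : Omega eps * circle R :=
  (theta z.1, fmap (noise_at 0 z.1) z.2).

End random_dynamical_system.

Arguments skew_product {R} xi a alpha {eps} z.

Definition invariant_measure d (T : measurableType d) (R : realType)
    (S : T -> T) (mu : probability T R) :=
  forall E, measurable E -> mu (S @^-1` E) = mu E.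

(* mu(dx, dy) = k_x(dy) P(dx)                                                  *)
Definition disintegrates d d' (X : measurableType d) (Y : measurableType d')
    (R : realType) (P : probability X R) (k : R.-pker X ~> Y)
    (mu : probability (X * Y)%type R) :=
  forall (A : set X) (B : set Y), measurable A -> measurable B ->
  mu (A `*` B) = (\int[P]_(x in A) k x B)%E.

(* Main.v *)
(* Work with the lift to R, and represent absolutely continuous measures on the
   circle by positive functionals on continuous 1-periodic functions, whose
   densities are controlled by their total variation V.  Split the image of a
   measure under f_w into shells according to the size del / 16^i of xi'.  On shell
   i the map expands by alpha * del / 16^i, so a Lasota-Yorke inequality holds; and
   since xi is nondegenerate, the noise average of the mass of shell i is
   O(16^-i), the constant being under control because eps > alpha^(c-1).
   Consequently u * m + V / u^3, suitably optimised in u, contracts in mean.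

   When this quantity is small compared to the mass m, the density is bounded below
   on an arc; the expansion enlarges the arc until it covers the circle, in a number
   of steps that does not depend on the measure, and then a fixed proportion of
   the mass can be subtracted from two such measures as a common multiple of
   Lebesgue measure.  This gives exponential decay, in mean over the noise, of the
   total variation distance between the images of two measures of equal mass.

   Applied to Lebesgue measure and its one-step image, the decay shows that the
   images of Lebesgue measure under f^n_(theta^-n omega) converge to some
   mu_omega; the maps being nonsingular, mu_omega is absolutely continuous.  Applied to
   arcs of length exp(-g n / 2), on which a Lipschitz psi is almost constant, it
   bounds the mean of the error in both correlation formulas by exp(-g n / 2) up
   to a constant.  Capping the error at 2 to get Z_n, the sum over n of
   exp(g n / 4) Z_n^2 is integrable, and C is its square root. *)

From HB Require Import structures.
Require Import Defs.
From mathcomp Require Import all_boot all_order all_algebra finmap.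
From mathcomp Require Import generic_quotient ring_quotient.
From mathcomp Require Import all_classical all_reals all_analysis.
From mathcomp Require Import interval_inference measurable_realfun ess_sup_inf ring lra zify.
Import Order.TTheory GRing.Theory Num.Theory.
Import numFieldNormedType.Exports.
Local Open Scope classical_set_scope.
Local Open Scope ring_scope.

Set Implicit Arguments.
Unset Strict Implicit.
Unset Printing Implicit Defensive.

(** * Primitives and periodic functions *)

(** Near a critical point the image of a smooth density blows up like an inverse square root, so its
    variation is infinite; it is finite only shell by shell, and the bound for shell [i] grows like
    [16^i] (inverse slope) and [256^i] (distortion). The shells are therefore kept as separate
    measures, each with its own [u] of order [8^i]. Three series then converge together: the mean
    mass gives [8^i / 16^i], the inverse slope [16^i / 8^(3i)], the distortion [256^i / 8^(3i)].
    This is the origin of 16, 8 and the cube in [u * m + V / u^3]. Two measures are compared by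
    pairing every shell of one with every shell of the other, with product weights, so that both
    members of a pair have equal mass. The bounds proved by induction have the form
    [c * cost + d * mass]: a step halves [c] but adds to [d] a multiple of [c], and only coupling
    can lower [d]. Coupling works when the cost is not much larger than the mass; otherwise halving
    the cost is enough. The cut-off [del] is a small multiple of [min (eps, 1)]: then [del / eps] is
    bounded, so the noise spreads mass across the critical zone, while [alpha * del], at least a
    multiple of [alpha^c], is large. *)

Section calculus.
Variable R : realType.
Implicit Types (f g F G : R -> R).
Notation leb := (@lebesgue_measure R).

(** Integrals of continuous functions are handled as increments of everywhere differentiable
    primitives, so that comparing them needs only the mean value theorem. *)
Definition primitive_of F f := forall t : R, is_derive t (1 : R) F (f t).

Definition cper f := continuous f /\ forall t, f (t + 1) = f t.

Lemma primitive_continuous F f : primitive_of F f -> continuous F.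
Proof.
move=> dF t; apply: differentiable_continuous; apply/derivable1_diffP.
exact: ex_derive.
Qed.

Lemma continuous_within (A : set R) f : continuous f -> {within A, continuous f}.
Proof. by move=> cf; apply: continuous_subspaceT. Qed.

Lemma primitive_MVT F f (a b : R) : primitive_of F f -> a <= b ->
  exists2 c, a <= c <= b & F b - F a = f c * (b - a).
Proof.
move=> dF ab; have [|c] := MVT_segment ab (fun x _ => dF x).
  by apply: continuous_within; exact: primitive_continuous dF.
by rewrite in_itv/= => cab ->; exists c.
Qed.

Lemma primitive_le F f G g (a b : R) : primitive_of F f -> primitive_of G g ->
  a <= b -> (forall t, a <= t <= b -> f t <= g t) -> F b - F a <= G b - G a.
Proof.
move=> dF dG ab fg.
have dH : primitive_of (G - F) (g - f) by move=> t; apply: is_deriveB.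
have [c cab] := primitive_MVT dH ab; rewrite !fctE => e.
suff : 0 <= (g c - f c) * (b - a) by rewrite -e; lra.
by rewrite mulr_ge0 ?subr_ge0 ?fg.
Qed.

Lemma primitive_mono F f (a b : R) : primitive_of F f -> a <= b ->
  (forall t, a <= t <= b -> 0 <= f t) -> F a <= F b.
Proof.
move=> dF ab f0; have [c cab] := primitive_MVT dF ab => e.
by rewrite -subr_ge0 e mulr_ge0 ?subr_ge0 ?f0.
Qed.

Lemma primitive_integral F f (a b : R) : primitive_of F f -> continuous f ->
  a <= b -> (\int[leb]_(x in `[a, b]) (f x)%:E = (F b - F a)%:E)%E.
Proof.
move=> dF cf; rewrite le_eqVlt => /predU1P[<-|ab].
  by rewrite set_itv1 integral_set1 subrr.
have cF := primitive_continuous dF.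
rewrite (@continuous_FTC2 _ f F)// ?EFinB//.
- exact: continuous_within.
- split; first by move=> x _; exact: ex_derive.
  + by apply: cvg_at_right_filter; exact: cF.
  + by apply: cvg_at_left_filter; exact: cF.
- by move=> x _; rewrite derive1E; apply: derive_val.
Qed.

Lemma continuous_integrable f (a b : R) : continuous f ->
  leb.-integrable `[a, b] (EFin \o f).
Proof.
move=> cf; apply: continuous_compact_integrable; first exact: segment_compact.
exact: continuous_within.
Qed.

(** The fundamental theorem of calculus differentiates the integral from [a] to [x] only for
    [x > a]. The base point therefore recedes with [x]; subtracting the integral from [a] to 0 makes
    the value independent of [a], so the pieces glue into one primitive on the line. *)
Lemma primitive_exists f : continuous f -> exists F, primitive_of F f.
Proof.
move=> cf.
pose G (a x : R) : R := (\int[leb]_(t in `[a, x]) f t)%R - (\int[leb]_(t in `[a, 0]) f t)%R.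
have dG (a t : R) : a < t -> is_derive t (1:R) (G a) (f t).
  move=> atx; have tu : t < t + 1 by rewrite ltrDl.
  have [d1 d2] := @continuous_FTC1_closed _ f a t _ tu (continuous_integrable _ _ cf) atx (cf t).
  have D1 : is_derive t (1:R) (fun x => \int[leb]_(t in `[a, x]) f t)%R (f t).
    by apply: DeriveDef; [exact: d1|rewrite -derive1E; exact: d2].
  have := is_deriveB D1 (is_derive_cst (\int[leb]_(t in `[a, 0]) f t)%R t 1).
  by rewrite subr0.
have Gind (a b x : R) : a <= b -> b < 0 -> b < x -> G a x = G b x.
  move=> ab b0 bx; rewrite /G.
  have e y : b < y -> (\int[leb]_(t in `[a, y]) f t)%R =
      (\int[leb]_(t in `[a, b]) f t)%R + (\int[leb]_(t in `[b, y]) f t)%R.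
    move=> bY; have := @Rintegral_itvB R f (BLeft a) (BRight y) b
       (continuous_integrable _ _ cf).
    rewrite !bnd_simp => /(_ ab (ltW bY)) e'.
    rewrite -(@Rintegral_itv_obnd_cbnd _ b (BRight y) f) -?e'; first by ring.
    apply: integrableS (continuous_integrable b y cf) => //.
    by apply: subset_itv; rewrite bnd_simp.
  rewrite (e x)// (e 0)//; ring.
pose N (x : R) := (Num.truncn `|x|).+2.
have NP (x : R) : `|x| + 1 < (N x)%:R.
  rewrite /N -[(_.+2)]addn1 natrD ltrD2r.
  by have /andP[] := truncn_itv (normr_ge0 x).
pose F x := G (- (N x)%:R) x.
exists F => t.
apply: (@near_eq_is_derive _ _ _ (G (- (N t)%:R)) F); last first.
  by apply: dG; have := NP t; have := ler_norm (- t); rewrite normrN; lra.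
have : \forall x \near t, `|t - x| < 1.
  have := @cvgr_dist_lt _ _ _ (nbhs t) _ id t; apply => //.
apply: filterS => x tx.
have H1 := NP x; have H2 := NP t.
have H3 := ler_norm (- x); have H4 := ler_norm (- t); rewrite !normrN in H3 H4.
have H5 : `|x| <= `|t| + 1.
  have -> : x = t - (t - x) by ring.
  by rewrite (le_trans (ler_normB _ _))// lerD2l ltW.
rewrite /F; have [le|le] := leP (N x) (N t).
  apply: Gind; [by rewrite lerN2 ler_nat| | ].
    by rewrite oppr_lt0 ltr0n.
  lra.
symmetry; apply: Gind; [by rewrite lerN2 ler_nat ltnW| | ].
  by rewrite oppr_lt0 ltr0n.
lra.
Qed.

Lemma cper_cst (c : R) : cper (fun=> c).
Proof. by split => //; exact: cst_continuous. Qed.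

Lemma cperD f g : cper f -> cper g -> cper (fun t => f t + g t).
Proof.
move=> [cf pf] [cg pg]; split => [t|t]; last by rewrite pf pg.
by apply: cvgD; [exact: cf|exact: cg].
Qed.

Lemma cperB f g : cper f -> cper g -> cper (fun t => f t - g t).
Proof.
move=> [cf pf] [cg pg]; split => [t|t]; last by rewrite pf pg.
by apply: cvgB; [exact: cf|exact: cg].
Qed.

Lemma cperM f g : cper f -> cper g -> cper (fun t => f t * g t).
Proof.
move=> [cf pf] [cg pg]; split => [t|t]; last by rewrite pf pg.
by apply: cvgM; [exact: cf|exact: cg].
Qed.

Lemma cperZ (c : R) f : cper f -> cper (fun t => c * f t).
Proof. by move=> cf; apply: cperM => //; exact: cper_cst. Qed.

Lemma cper_shift f w : cper f -> cper (fun t => f (t + w)).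
Proof.
move=> [cf pf]; split => [t|t]; last by rewrite addrAC pf.
by apply: continuous_comp; [apply: cvgD; [exact: cvg_id|exact: cvg_cst]|exact: cf].
Qed.

Lemma cper_sum (I : Type) (r : seq I) (h : I -> R -> R) :
  (forall i, cper (h i)) -> cper (fun t => \sum_(i <- r) h i t).
Proof.
move=> ch; elim: r => [|i r ih].
  by under eq_fun do rewrite big_nil; exact: cper_cst.
by under eq_fun do rewrite big_cons; exact: cperD.
Qed.

Lemma periodic_nat f (n : nat) t : (forall t, f (t + 1) = f t) -> f (t + n%:R) = f t.
Proof.
by move=> pf; elim: n => [|n ih]; rewrite ?addr0// -natr1 addrA pf.
Qed.

Lemma periodic_int f (n : int) t : (forall t, f (t + 1) = f t) -> f (t + n%:~R) = f t.
Proof.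
move=> pf; case: n => n; first exact: periodic_nat.
by rewrite NegzE mulrNz -(@periodic_nat f n.+1 (t - _))// subrK.
Qed.

Lemma periodic_frac f t : (forall t, f (t + 1) = f t) ->
  exists s, [/\ 0 <= s < 1, f s = f t & exists n : int, s = t + n%:~R].
Proof.
move=> pf; exists (t + (- Num.floor t)%:~R); split; last by eexists.
  rewrite mulrNz subr_ge0 floor_le//= ltrBlDl.
  by rewrite -[X in _ + X](mulr1z 1) -intrD floorD1_gt.
exact: periodic_int.
Qed.

Lemma cper_bounded f : cper f -> exists B, 0 < B /\ forall t, `|f t| <= B.
Proof.
move=> [cf pf]; have [c _ H] := @EVT_max R (fun t => `|f t|) 0 1 ler01
  (continuous_within (fun x => continuous_comp (cf x) (@norm_continuous _ _ _))).
exists (`|f c| + 1); split; first by rewrite ltr_wpDl.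
move=> t; have [s [s01 <- _]] := periodic_frac t pf.
rewrite (le_trans (H s _)) ?lerDl// in_itv/=.
by case/andP: s01 => -> /ltW ->.
Qed.

Lemma primitive_period G g s : primitive_of G g -> (forall t, g (t + 1) = g t) ->
  G (s + 1) - G s = G 1 - G 0.
Proof.
move=> dG pg.
have dH t : is_derive t (1:R) (fun t => G (t + 1) - G t) 0.
  rewrite -[0](subrr (g t)); apply: is_deriveB.
  have D1 : is_derive t (1:R) (fun t : R => t + 1) 1.
    by have := is_deriveD (is_derive_id t (1:R)) (is_derive_cst (1:R) t 1); rewrite addr0.
  have := @is_derive1_comp R G (fun t => t + 1) t _ _ (dG (t + 1)) D1.
  by rewrite mulr1 pg.
  exact: dG.
by have /= := @is_derive_0_is_cst R _ s 0 dH; rewrite add0r.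
Qed.

End calculus.

(** * Measures as positive functionals on periodic functions *)

Section states.
Variables (R : realType) (eps : {posnum R}).
Implicit Types (f g F G phi psi : R -> R) (J : (R -> R) -> R).
Notation leb := (@lebesgue_measure R).
Notation nu := (uniform_prob (noise_lt eps)).

(* [J] stands for integration over a period against a finite positive measure;
   the two closure conditions are Fubini's theorem for parameters in a measurable
   space and for the noise. *)
Record state J : Prop := State {
  st_lin : forall a b phi psi, cper phi -> cper psi ->
    J (fun t => a * phi t + b * psi t) = a * J phi + b * J psi;
  st_pos : forall phi, cper phi -> (forall t, 0 <= phi t) -> 0 <= J phi;
  st_meas : forall d (X : measurableType d) (Phi : X -> R -> R),
    measurable_fun [set: X * R] (fun z => Phi z.1 z.2) ->
    (forall x, cper (Phi x)) -> measurable_fun [set: X] (fun x => J (Phi x));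
  st_fub : forall (Phi : R -> R -> R) b,
    measurable_fun [set: R * R] (fun z => Phi z.1 z.2) ->
    (forall w, cper (Phi w)) -> (forall w t, 0 <= Phi w t <= 1) -> cper b ->
    (forall t, \int[nu]_w (Phi w t)%:E = (b t)%:E)%E ->
    (\int[nu]_w (J (Phi w))%:E = (J b)%:E)%E }.

Definition mass J := J (fun=> 1).

(* The total variation of the density of [J] is at most [V], by duality. *)
Definition var_le J V := forall Phi phi, primitive_of Phi phi -> cper phi ->
  (forall t, Phi (t + 1) = Phi t) -> (forall t, `|Phi t| <= 1) -> J phi <= V.

(* The density of [J] is at least [c] on the arc [s, s + l]; [g] plays the role of
   a test function and [G] is its primitive, so that no density is needed. *)
Definition density_ge J c s l := forall G g, primitive_of G g -> cper g ->
  (forall t, 0 <= g t) -> c * (G (s + l) - G s) <= J g.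

Definition junif (a b : R) phi : R := (\int[leb]_(t in `[a, b]) phi t)%R.

(** The image under [F] of the measure with density [chi] with respect to [J]. *)
Definition jpush (F chi : R -> R) J phi := J (fun t => phi (F t) * chi t).

Section state_lemmas.
Variable J : (R -> R) -> R.
Hypothesis sJ : state J.

Lemma stD phi psi : cper phi -> cper psi ->
  J (fun t => phi t + psi t) = J phi + J psi.
Proof.
move=> cf cg; have := st_lin sJ 1 1 cf cg; rewrite !mul1r => <-.
by congr J; apply/funext => t; rewrite !mul1r.
Qed.

Lemma stB phi psi : cper phi -> cper psi ->
  J (fun t => phi t - psi t) = J phi - J psi.
Proof.
move=> cf cg; have := st_lin sJ 1 (-1) cf cg; rewrite mul1r mulN1r => <-.
by congr J; apply/funext => t; rewrite mul1r mulN1r.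
Qed.

Lemma stZ c phi : cper phi -> J (fun t => c * phi t) = c * J phi.
Proof.
move=> cf; have := st_lin sJ c 0 cf cf; rewrite mul0r addr0 => <-.
by congr J; apply/funext => t; rewrite mul0r addr0.
Qed.

Lemma st0 : J (fun=> 0) = 0.
Proof.
transitivity (J (fun=> 0 * 1)); first by congr J; apply/funext => t; rewrite mul0r.
by rewrite (stZ _ (cper_cst 1)) mul0r.
Qed.

Lemma st_sum (I : Type) (r : seq I) (h : I -> R -> R) : (forall i, cper (h i)) ->
  J (fun t => \sum_(i <- r) h i t) = \sum_(i <- r) J (h i).
Proof.
move=> ch; elim: r => [|i r ih].
  by rewrite big_nil -[RHS]st0; congr J; apply/funext => t; rewrite big_nil.
rewrite big_cons -ih -stD//; last exact: cper_sum.
by congr J; apply/funext => t; rewrite big_cons.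
Qed.

Lemma st_mono phi psi : cper phi -> cper psi -> (forall t, phi t <= psi t) ->
  J phi <= J psi.
Proof.
move=> cf cg fg; rewrite -subr_ge0 -stB//; apply: st_pos => //.
  exact: cperB.
by move=> t; rewrite subr_ge0.
Qed.

Lemma stc c : J (fun=> c) = c * mass J.
Proof.
by rewrite -stZ; [congr J; apply/funext => t; rewrite mulr1|exact: cper_cst].
Qed.

Lemma st_le phi c : cper phi -> (forall t, phi t <= c) -> J phi <= c * mass J.
Proof. by move=> cf fc; rewrite -stc; apply: st_mono => //; exact: cper_cst. Qed.

Lemma st_norm phi c : cper phi -> (forall t, `|phi t| <= c) -> `|J phi| <= c * mass J.
Proof.
move=> cf fc; rewrite ler_norml; apply/andP; split; last first.
  by apply: st_le => // t; rewrite (le_trans (ler_norm _)).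
rewrite -mulNr -stc; apply: st_mono => //; first exact: cper_cst.
by move=> t; have := fc t; rewrite ler_norml => /andP[].
Qed.

Lemma mass_ge0 : 0 <= mass J.
Proof. by apply: st_pos => //; exact: cper_cst. Qed.

Lemma var_le_ge0 V : var_le J V -> 0 <= V.
Proof.
move=> /(_ (fun=> 0) (fun=> 0)); rewrite st0; apply => //.
- by move=> t; exact: is_derive_cst.
- exact: cper_cst.
- by move=> t; rewrite normr0.
Qed.

Lemma var_le_scaled V Phi phi (c : R) : 0 < c -> var_le J V -> primitive_of Phi phi ->
  cper phi -> (forall t, Phi (t + 1) = Phi t) -> (forall t, `|Phi t| <= c) ->
  J phi <= c * V.
Proof.
move=> c0 vb dP cp pP Pc.
rewrite mulrC -ler_pdivrMr// mulrC -stZ//; apply: (vb (fun t => c^-1 * Phi t)).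
- by move=> t; have := is_deriveZ c^-1 (dP t).
- exact: cperZ.
- by move=> t; rewrite pP.
- by move=> t; rewrite normrM gtr0_norm ?invr_gt0// ler_pdivrMl// mulr1.
Qed.

Lemma state_push F chi : cper F -> cper chi -> (forall t, 0 <= chi t <= 1) ->
  state (jpush F chi J).
Proof.
move=> cF cchi chi01.
have cc phi : cper phi -> cper (fun t => phi (F t) * chi t).
  move=> [cp pp]; apply: cperM => //; case: cF => cF pF; split => t.
    by apply: (@continuous_comp _ _ _ F phi); [exact: cF|exact: cp].
  by rewrite pF.
have mm d (X : measurableType d) (Phi : X -> R -> R) :
    measurable_fun [set: X * R] (fun z => Phi z.1 z.2) ->
    measurable_fun [set: X * R] (fun z => Phi z.1 (F z.2) * chi z.2).
  move=> mP; apply: measurable_funM; last first.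
    by apply: measurableT_comp => //; apply: continuous_measurable_fun; exact: cchi.1.
  apply: (measurableT_comp mP (g := fun z : X * R => (z.1, F z.2))).
  apply: measurable_fun_pair => //; apply: measurableT_comp => //.
  by apply: continuous_measurable_fun; exact: cF.1.
split.
- move=> a b phi psi cp cq; rewrite /jpush -st_lin//; try exact: cc.
  by congr J; apply/funext => t; rewrite mulrDl !mulrA.
- move=> phi cp p0; apply: (st_pos sJ); first exact: cc.
  by move=> t; rewrite mulr_ge0//; have /andP[] := chi01 t.
- move=> d X Phi mP cP; apply: (st_meas sJ (Phi := fun x t => Phi x (F t) * chi t)).
    exact: mm.
  by move=> x; exact: cc.
- move=> Phi b mP cP P01 cb H; apply: (st_fub sJ (Phi := fun x t => Phi x (F t) * chi t)).
  + exact: mm.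
  + by move=> x; exact: cc.
  + move=> w t; have /andP[a1 a2] := P01 w (F t); have /andP[b1 b2] := chi01 t.
    by rewrite mulr_ge0//= mulr_ile1.
  + exact: cc.
  + move=> t; rewrite EFinM -H -ge0_integralZr//.
    * apply/measurable_EFinP; apply: (measurableT_comp mP (g := fun w : R => (w, F t))).
      exact: measurable_fun_pair.
    * by move=> w _; rewrite lee_fin; have /andP[] := P01 w (F t).
    * by rewrite lee_fin; have /andP[] := chi01 t.
Qed.

Lemma state_scale c : 0 <= c -> state (fun phi => c * J phi).
Proof.
move=> c0; split.
- by move=> a b phi psi cp cq; rewrite st_lin//; ring.
- by move=> phi cp p0; rewrite mulr_ge0// st_pos.
- move=> d X Phi mP cP; apply: measurable_funM => //.
  exact: (st_meas sJ mP cP).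
- move=> Phi b mP cP P01 cb H; rewrite EFinM -(st_fub sJ mP cP P01 cb H).
  rewrite -ge0_integralZl//.
  + by apply/measurable_EFinP; exact: (st_meas sJ mP cP).
  + move=> w _; rewrite lee_fin; apply: st_pos => // t.
    by have /andP[] := P01 w t.
Qed.

End state_lemmas.

(** Domination gives positivity. For the noise condition two integrals are subtracted, which is
    legitimate because both integrands are bounded; the bound [0 <= Phi <= 1] in [st_fub] supplies
    this. *)
Lemma state_sub J J' : state J -> state J' ->
  (forall phi, cper phi -> (forall t, 0 <= phi t) -> J' phi <= J phi) ->
  state (fun phi => J phi - J' phi).
Proof.
move=> sJ sJ' le; split.
- by move=> a b phi psi cp cq; rewrite !st_lin//; ring.
- by move=> phi cp p0; rewrite subr_ge0 le.
- move=> d X Phi mP cP; apply: measurable_funB.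
    exact: (st_meas sJ mP cP).
  exact: (st_meas sJ' mP cP).
- move=> Phi b mP cP P01 cb H.
  rewrite EFinB -(st_fub sJ mP cP P01 cb H) -(st_fub sJ' mP cP P01 cb H).
  have key K : state K -> nu.-integrable setT (fun w => (K (Phi w))%:E).
    move=> sK; apply: (@le_integrable _ _ _ _ _ _ _ (cst (mass K)%:E)) => //.
    + by apply/measurable_EFinP; exact: (st_meas sK mP cP).
    + move=> w _; rewrite !abse_EFin lee_fin ger0_norm; last first.
        by apply: st_pos => // t; have /andP[] := P01 w t.
      rewrite (le_trans _ (ler_norm _))// -[leRHS]mul1r; apply: st_le => // t.
      by have /andP[] := P01 w t.
    + exact: finite_measure_integrable_cst.
  rewrite -(integralB measurableT (key _ sJ) (key _ sJ')).
  by apply: eq_integral => w _; rewrite EFinB.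
Qed.

Lemma junifE a b F f : a <= b -> primitive_of F f -> continuous f ->
  junif a b f = F b - F a.
Proof.
by move=> ab dF cf; rewrite /junif /Rintegral (primitive_integral dF cf ab).
Qed.

(** Tonelli's theorem applies to the positive and negative parts separately; [fine] of their
    difference is measurable in any case. *)
Lemma measurable_junif a b d (X : measurableType d) (Phi : X -> R -> R) :
  measurable_fun [set: X * R] (fun z => Phi z.1 z.2) ->
  measurable_fun [set: X] (fun x => junif a b (Phi x)).
Proof.
move=> mP; rewrite /junif /Rintegral.
have H (f : X * measurableTypeR R -> \bar R) : measurable_fun setT f -> (forall z, 0 <= f z)%E ->
    measurable_fun [set: X] (fun x => \int[leb]_(t in `[a, b]) f (x, t))%E.
  move=> mf f0; under eq_fun do rewrite integral_mkcond.
  have -> : (fun x => \int[leb]_t ((fun t => f (x, t)) \_ `[a, b]) t)%E =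
     fubini_F leb (f \_ (setT `*` `[a, b])).
    apply/funext => x; apply: eq_integral => t _; rewrite !patchE.
    by congr (if _ then _ else _); apply/idP/idP; rewrite !inE//=; case.
  apply: measurable_fun_fubini_tonelli_F.
    apply/(measurable_restrict _ _ _).1 => //; first exact: measurableX.
    exact: measurable_funTS.
  by move=> z; rewrite patchE; case: ifP.
apply: (measurableT_comp (f := @fine R)) => //.
under eq_fun do rewrite integralE.
have mE : measurable_fun [set: X * measurableTypeR R] (fun z => (Phi z.1 z.2)%:E).
  exact/measurable_EFinP.
apply: emeasurable_funB.
  have := H _ (measurable_funepos mE) (fun z => funepos_ge0 _ z).
  congr (measurable_fun _ _); apply/funext => x; apply: eq_integral => t _.
  by rewrite !funeposE.
have := H _ (measurable_funeneg mE) (fun z => funeneg_ge0 _ z).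
congr (measurable_fun _ _); apply/funext => x; apply: eq_integral => t _.
by rewrite !funenegE.
Qed.

Lemma state_junif a b : a <= b -> state (junif a b).
Proof.
move=> ab; split.
- move=> x y phi psi [cp _] [cq _].
  have [P dP] := primitive_exists cp; have [Q dQ] := primitive_exists cq.
  rewrite (junifE ab dP cp) (junifE ab dQ cq).
  rewrite (@junifE _ _ (fun t => x * P t + y * Q t))//; first by ring.
    by move=> t; apply: is_deriveD; [have := is_deriveZ x (dP t)|have := is_deriveZ y (dQ t)].
  by move=> t; apply: cvgD; apply: cvgM => //; try exact: cvg_cst; [exact: cp|exact: cq].
- by move=> phi cp p0; apply: Rintegral_ge0 => t _.
- by move=> d X Phi mP cP; exact: measurable_junif.
- move=> Phi b' mP cP P01 cb H.
  have ei f : cper f -> (junif a b f)%:E = (\int[leb]_(t in `[a, b]) (f t)%:E)%E.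
    move=> [cf _]; have [F dF] := primitive_exists cf.
    by rewrite (primitive_integral dF cf ab) (junifE ab dF cf).
  rewrite ei//; under eq_integral do rewrite ei//.
  pose f : R * measurableTypeR R -> \bar R :=
    (fun z => (Phi z.1 z.2)%:E) \_ (setT `*` `[a, b]).
  have f0 z : (0 <= f z)%E.
    rewrite /f patchE; case: ifP => // _; rewrite lee_fin.
    by have /andP[] := P01 z.1 z.2.
  have mf : measurable_fun setT f.
    apply/(measurable_restrict _ _ _).1 => //; first exact: measurableX.
    exact/measurable_funTS/measurable_EFinP.
  have fE w t : f (w, t) = (((EFin \o Phi w) \_ `[a, b]) t)%E.
    rewrite /f !patchE; congr (if _ then _ else _).
    by apply/idP/idP; rewrite !inE//=; case.
  have fub := @fubini_tonelli _ _ _ _ R nu leb f mf f0.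
  transitivity (\int[nu]_x \int[leb]_y f (x, y))%E.
    apply: eq_integral => w _; rewrite integral_mkcond; apply: eq_integral => t _.
    by rewrite fE.
  rewrite [RHS]integral_mkcond [LHS]fub; apply: eq_integral => t _.
  rewrite patchE; case: ifPn => tab.
    rewrite -H; apply: eq_integral => w _; by rewrite fE patchE tab.
  by rewrite (eq_integral (fun=> 0%E)) ?integral0// => w _; rewrite fE patchE (negbTE tab).
Qed.

End states.

(** * Non-degeneracy, and cut-offs near the critical points *)

Section geometry.
Variable R : realType.
Implicit Types (f g F G L phi psi : R -> R) (J : (R -> R) -> R) (e x t : R).
Notation leb := (@lebesgue_measure R).

(** Compactness of [[0, 1]] gives a uniform [h]; the integer translation that brings [x] there is
    applied to [y] as well, which keeps their distance. *)
Lemma cper_unif_cont f (e : R) : cper f -> 0 < e ->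
  exists2 h : R, 0 < h & forall x y, `|x - y| <= h -> `|f x - f y| < e.
Proof.
move=> [cf pf] e0.
have /compact_near_coveringP cov := @segment_compact R 0 1.
have := cov R (0^'+) (fun h x => forall y, `|x - y| <= h -> `|f x - f y| < e) _ _.
case.
  move=> x _; have e2 : 0 < e / 2 by rewrite divr_gt0.
  have /cvgrPdist_lt /(_ _ e2) := cf x.
  move=> /nbhs_ballP[d /= d0 H].
  have d20 : 0 < d / 2 by rewrite divr_gt0.
  exists (ball x (d / 2), [set h | 0 < h < d / 2]).
    split; first exact: nbhsx_ballx.
    have A1 := @nbhs_right_gt R 0; have A2 := nbhs_right_lt d20.
    by apply: filterS (filterI A1 A2) => h [/= h1 h2]; exact/andP.
  move=> [x' h] [/= xx' /andP[h0 hd]] y yx'.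
  have A1 : `|x - x'| < d / 2 by [].
  have H1 : `|f x - f x'| < e / 2.
    by apply: H; rewrite /ball/=; apply: (lt_trans A1); lra.
  have H2 : `|f x - f y| < e / 2.
    apply: H; rewrite /ball/=.
    have -> : x - y = (x - x') + (x' - y) by ring.
    by rewrite (le_lt_trans (ler_normD _ _))//; lra.
  have -> : f x' - f y = (f x - f y) - (f x - f x') by ring.
  by rewrite (le_lt_trans (ler_normB _ _))//; lra.
move=> d /= d0 H; exists (d / 2); first by rewrite divr_gt0.
move=> x y xy; have [s [s01 <- [n sE]]] := periodic_frac x pf.
rewrite -[f y](@periodic_int _ f n)//.
apply: (H (d / 2)) => /=.
- by rewrite sub0r normrN gtr0_norm ?divr_gt0//; lra.
- by rewrite divr_gt0.
- by rewrite in_itv/=; case/andP: s01 => -> /ltW ->.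
- by rewrite sE opprD addrACA subrr addr0.
Qed.

Variables d1 d2 : R -> R.

(** Splitting the bound on [|d2|] by sign makes [d1] monotone on the window; both the change of
    variable in [lor_cell] and the search for arcs of constant sign in [monotone_third] rely on
    this. *)
Definition cells (k h : R) := forall x0 : R,
  [\/ forall t, x0 <= t <= x0 + h -> k <= `|d1 t|,
      forall t, x0 <= t <= x0 + h -> k <= d2 t |
      forall t, x0 <= t <= x0 + h -> d2 t <= - k].

(** By compactness [|d1| + |d2| >= 4 k] everywhere. If [h] is so small that both oscillate by less
    than [k] on a window, then either [|d1| >= 2 k] at its left end or [|d2| > 2 k] there, and at
    least [k] survives on the whole window. *)
Lemma cells_exist : cper d1 -> cper d2 -> (forall t, d1 t = 0 -> d2 t <> 0) ->
  exists (k : R) (M : nat), [/\ 0 < k, (0 < M)%N & cells k M%:R^-1].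
Proof.
move=> c1 c2 nd.
have cn : continuous (fun t => `|d1 t| + `|d2 t|).
  move=> t; apply: cvgD.
    exact: (continuous_comp (c1.1 t) (@norm_continuous _ _ _)).
  exact: (continuous_comp (c2.1 t) (@norm_continuous _ _ _)).
have [c _ Hc] := EVT_min ler01 (continuous_within cn).
pose k := (`|d1 c| + `|d2 c|) / 4.
have k0 : 0 < k.
  rewrite divr_gt0// lt_neqAle addr_ge0// andbT eq_sym paddr_eq0//.
  rewrite !normr_eq0; apply/negP => /andP[/eqP /nd ne /eqP]; exact: ne.
have H t : 4 * k <= `|d1 t| + `|d2 t|.
  have [s [s01 e1 [n sE]]] := periodic_frac t c1.2.
  rewrite -e1; have <- : d2 s = d2 t by rewrite sE periodic_int//; exact: c2.2.
  rewrite /k mulrC divfK//; apply: Hc.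
  by rewrite in_itv/=; case/andP: s01 => -> /ltW ->.
clearbody k; have [h1 h10 H1] := cper_unif_cont c1 k0.
have [h2 h20 H2] := cper_unif_cont c2 k0.
pose h := Num.min h1 h2.
have h0 : 0 < h by rewrite lt_min h10.
pose M := (Num.truncn h^-1).+1.
have Mh : M%:R^-1 <= h.
  rewrite -[leRHS]invrK lef_pV2 ?posrE ?invr_gt0 ?ltr0n//.
  have /truncn_itv /andP[_ /ltW //] : 0 <= h^-1 by rewrite invr_ge0 ltW.
exists k, M; split => // x0.
have C1 t : x0 <= t <= x0 + M%:R^-1 -> `|d1 x0 - d1 t| < k.
  move=> tx; apply: H1; rewrite ler_norml.
  have : h <= h1 by rewrite ge_min lexx.
  lra.
have C2 t : x0 <= t <= x0 + M%:R^-1 -> `|d2 x0 - d2 t| < k.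
  move=> tx; apply: H2; rewrite ler_norml.
  have : h <= h2 by rewrite ge_min lexx orbT.
  lra.
have [le|lt] := leP (2 * k) `|d1 x0|.
  apply: Or31 => t /C1; have := lerB_dist (d1 x0) (d1 t); lra.
have := H x0; have [d2p|d2n] := ger0P (d2 x0) => Hx.
  by apply: Or32 => t /C2; rewrite ltr_norml; lra.
by apply: Or33 => t /C2; rewrite ltr_norml; lra.
Qed.

(* [lor e] is a smooth cut-off of the region where [|d1| <= e] and [lorC e] its
   complement [d1 * reg_inv e], where [reg_inv e] regularises [1 / d1]. *)
Definition lor (e : R) t := e ^+ 2 / (d1 t ^+ 2 + e ^+ 2).
Definition lorC (e : R) t := d1 t ^+ 2 / (d1 t ^+ 2 + e ^+ 2).
Definition reg_inv (e : R) t := d1 t / (d1 t ^+ 2 + e ^+ 2).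
Definition dreg_inv (e : R) t := d2 t * (e ^+ 2 - d1 t ^+ 2) / (d1 t ^+ 2 + e ^+ 2) ^+ 2.

Lemma den_gt0 e t : 0 < e -> 0 < d1 t ^+ 2 + e ^+ 2.
Proof. by move=> e0; rewrite ltr_wpDl ?sqr_ge0// exprn_gt0. Qed.

Lemma lorE e t : 0 < e -> lor e t = 1 - lorC e t.
Proof.
by move=> e0; rewrite /lor /lorC; field; rewrite gt_eqF// den_gt0.
Qed.

Lemma lor01 e t : 0 < e -> 0 <= lor e t <= 1.
Proof.
move=> e0; have D := den_gt0 t e0; rewrite /lor divr_ge0 ?sqr_ge0 ?(ltW D)//=.
by rewrite ler_pdivrMr// mul1r lerDr sqr_ge0.
Qed.

Lemma lorC01 e t : 0 < e -> 0 <= lorC e t <= 1.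
Proof. by move=> e0; have := lor01 t e0; rewrite lorE//; lra. Qed.

Lemma lor_mono e e' t : 0 < e -> e <= e' -> lor e t <= lor e' t.
Proof.
move=> e0 ee'; have e'0 := lt_le_trans e0 ee'.
rewrite /lor ler_pdivrMr ?den_gt0// mulrAC ler_pdivlMr ?den_gt0//.
have H : e ^+ 2 <= e' ^+ 2 by rewrite lerXn2r// nnegrE ltW.
have := ler_wpM2r (sqr_ge0 (d1 t)) H; lra.
Qed.

Lemma lorC_half e t : 0 < e -> e <= `|d1 t| -> 2^-1 <= lorC e t.
Proof.
move=> e0 le; rewrite /lorC ler_pdivlMr ?den_gt0//.
have : e ^+ 2 <= d1 t ^+ 2 by rewrite -(real_normK (num_real (d1 t))) lerXn2r// nnegrE ltW.
lra.
Qed.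

Hypotheses (c1 : cper d1) (c2 : cper d2) (dd1 : primitive_of d1 d2).

Lemma cper_den e : cper (fun t => d1 t ^+ 2 + e ^+ 2).
Proof.
apply: cperD; last exact: cper_cst.
by under eq_fun do rewrite expr2; exact: cperM.
Qed.

Lemma cper_inv f : cper f -> (forall t, f t != 0) -> cper (fun t => (f t)^-1).
Proof. by move=> [cf pf] f0; split => t; [exact: (continuousV (f0 t) (cf t))|rewrite pf]. Qed.

Lemma cper_lor e : 0 < e -> cper (lor e).
Proof.
move=> e0; apply: cperM; first exact: cper_cst.
by apply: cper_inv (cper_den e) _ => t; rewrite gt_eqF ?den_gt0.
Qed.

Lemma cper_lorC e : 0 < e -> cper (lorC e).
Proof.
move=> e0; rewrite (_ : lorC e = fun t => 1 - lor e t).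
  by apply: cperB; [exact: cper_cst|exact: cper_lor].
by apply/funext => t; rewrite lorE// subKr.
Qed.

Lemma cper_reg_inv e : 0 < e -> cper (reg_inv e).
Proof.
move=> e0; apply: cperM => //.
by apply: cper_inv (cper_den e) _ => t; rewrite gt_eqF ?den_gt0.
Qed.

Lemma cper_dreg_inv e : 0 < e -> cper (dreg_inv e).
Proof.
move=> e0; apply: cperM; last first.
  apply: cper_inv => [|t]; last by rewrite expf_neq0// gt_eqF ?den_gt0.
  by under eq_fun do rewrite expr2; apply: cperM; exact: cper_den.
apply: cperM => //; apply: cperB; first exact: cper_cst.
by under eq_fun do rewrite expr2; exact: cperM.
Qed.

Lemma primitive_reg_inv e : 0 < e -> primitive_of (reg_inv e) (dreg_inv e).
Proof.
move=> e0 t; have D := den_gt0 t e0.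
have h1 := dd1 t.
have h2 : is_derive t (1:R) (fun t => d1 t ^+ 2 + e ^+ 2) (2 * d1 t * d2 t).
  have := is_deriveD (is_deriveX 2 h1) (is_derive_cst (e ^+ 2) t (1:R)).
  by rewrite addr0 /= expr1 -mulrA -[_ *: _]/(_ * _) mulrA.
have h3 := @is_deriveV _ (fun t => d1 t ^+ 2 + e ^+ 2) t _ 1 (lt0r_neq0 D) h2.
have := is_deriveM h1 h3.
congr is_derive; rewrite /dreg_inv -![_ *: _]/(_ * _); field.
by rewrite gt_eqF.
Qed.

(** This is [2 e |d1| <= d1^2 + e^2]. *)
Lemma reg_inv_le e t : 0 < e -> `|reg_inv e t| <= (2 * e)^-1.
Proof.
move=> e0; have D := den_gt0 t e0.
rewrite /reg_inv normrM normfV (gtr0_norm D) ler_pdivrMr// ler_pdivlMl ?mulr_gt0//.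
rewrite -(real_normK (num_real (d1 t))).
have := sqr_ge0 (`|d1 t| - e); rewrite sqrrB; lra.
Qed.

Lemma dreg_inv_le B e t : 0 < e -> (forall t, `|d2 t| <= B) -> `|dreg_inv e t| <= B / e ^+ 2.
Proof.
move=> e0 HB; have D := den_gt0 t e0; have B0 := le_trans (normr_ge0 _) (HB t).
rewrite /dreg_inv normrM normfV normrX (gtr0_norm D) normrM -mulrA.
apply: ler_pM => //; first by rewrite divr_ge0// exprn_ge0// ltW.
rewrite ler_pdivrMr ?exprn_gt0// ler_pdivlMl ?exprn_gt0//.
have H : `|e ^+ 2 - d1 t ^+ 2| <= d1 t ^+ 2 + e ^+ 2.
  have := sqr_ge0 (d1 t); have := sqr_ge0 e; rewrite ler_norml; lra.
rewrite [leRHS]expr2; apply: ler_pM => //; first exact: sqr_ge0.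
by rewrite lerDr sqr_ge0.
Qed.

Section lorentz_integral.
Variables (k h : R) (k0 : 0 < k) (h0 : 0 < h) (ck : cells k h).

(** Where [|d1| >= k] the integrand is at most [e^2 / k^2 <= e / k^2]. Where [d1] is monotone with
    slope at least [k], the derivative of [(e / k) atan (d1 / e)], up to sign, dominates [lor e],
    and [atan] varies by at most [pi]. Both bounds are linear in [e], which is the source of the
    factor [16^-i] for shell [i]. *)
Lemma lor_cell e L x : 0 < e <= 1 -> primitive_of L (lor e) ->
  L (x + h) - L x <= e * (pi / k + h / k ^+ 2).
Proof.
move=> /andP[e0 e1] dL.
have xh : x <= x + h by rewrite lerDl ltW.
have pk : 0 <= e * (pi / k) by rewrite mulr_ge0 ?divr_ge0 ?(ltW e0) ?pi_ge0 ?ltW.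
have hk : 0 <= e * (h / k ^+ 2) by rewrite mulr_ge0 ?divr_ge0 ?exprn_ge0 ?(ltW e0) ?ltW.
have atanP (s : R) : s ^+ 2 = 1 -> (forall t, x <= t <= x + h -> k <= s * d2 t) ->
    L (x + h) - L x <= e * (pi / k).
  move=> s1 Hs; pose A t := s * (e / k) * atan (d1 t / e).
  have dA : primitive_of A (fun t => s * (e / k) * (d2 t / e * (1 + (d1 t / e) ^+ 2)^-1)).
    move=> t.
    have D1 : is_derive t (1:R) (fun t => d1 t / e) (d2 t / e).
      have := is_deriveM (dd1 t) (is_derive_cst e^-1 t (1:R)).
      by congr is_derive; rewrite scaler0 add0r; exact: mulrC.
    have D2 := @is_derive1_comp R atan _ t _ _ (is_derive1_atan _) D1.
    have := is_deriveZ (s * (e / k)) D2.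
    by congr is_derive; rewrite -[_ *: _]/(_ * _) [X in _ * X]mulrC.
  apply: (le_trans (primitive_le dL dA xh _)).
    move=> t /Hs Hk; have D := den_gt0 t e0.
    have -> : s * (e / k) * (d2 t / e * (1 + (d1 t / e) ^+ 2)^-1) = (s * d2 t / k) * lor e t.
      by rewrite /lor; field; rewrite !gt_eqF// addrC.
    rewrite ler_peMl//; first by have /andP[] := lor01 t e0.
    by rewrite ler_pdivlMr// mul1r.
  rewrite /A -mulrBr; have a1 := atan_ltpi2 (d1 (x + h) / e); have a2 := atan_gtNpi2 (d1 (x + h) / e).
  have a3 := atan_ltpi2 (d1 x / e); have a4 := atan_gtNpi2 (d1 x / e).
  have ns : `|s| = 1.
    by apply/eqP; rewrite -sqrp_eq1// real_normK ?num_real// s1.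
  rewrite (le_trans (ler_norm _))// normrM normrM ns mul1r [ `|e / k|]ger0_norm; last by rewrite divr_ge0// ltW.
  rewrite [leRHS](_ : _ = e / k * pi); last by rewrite mulrA mulrAC.
  apply: ler_wpM2l; first by rewrite divr_ge0// ltW.
  by rewrite ler_norml; lra.
case: (ck x) => Hx.
- rewrite mulrDr ler_wpDl//.
  have dlin : primitive_of (fun t => e / k ^+ 2 * t) (fun=> e / k ^+ 2).
    move=> t; have := is_deriveZ (e / k ^+ 2) (is_derive_id t (1:R)).
    by rewrite -[_ *: 1]/(_ * 1) mulr1.
  apply: (le_trans (primitive_le dL dlin xh _)) => [t /Hx Hk|]; last by rewrite -mulrBr; lra.
  rewrite /lor ler_pdivrMr ?den_gt0//.
  have k2 : 0 < k ^+ 2 by rewrite exprn_gt0.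
  rewrite mulrAC ler_pdivlMr//.
  have H1 : k ^+ 2 <= d1 t ^+ 2.
    by rewrite -(real_normK (num_real (d1 t))) lerXn2r// nnegrE ltW.
  have H2 : e ^+ 2 <= e by rewrite expr2 ler_piMl// ltW.
  apply: ler_pM; rewrite ?sqr_ge0//.
  by rewrite (le_trans H1)// lerDl sqr_ge0.
- rewrite mulrDr ler_wpDr//; apply: (atanP 1); first by rewrite expr1n.
  by move=> t; rewrite mul1r; exact: Hx.
- rewrite mulrDr ler_wpDr//; apply: (atanP (-1)); first by rewrite sqrrN expr1n.
  by move=> t /Hx; rewrite mulN1r; lra.
Qed.

Definition C0 := pi / k + h / k ^+ 2.

Lemma C0_ge0 : 0 <= C0.
Proof. by rewrite addr_ge0// divr_ge0 ?pi_ge0 ?exprn_ge0// ltW. Qed.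

Lemma lor_cells e L x n : 0 < e <= 1 -> primitive_of L (lor e) ->
  L (x + n%:R * h) - L x <= n%:R * (e * C0).
Proof.
move=> e01 dL; elim: n => [|n ih]; first by rewrite !mul0r addr0 subrr.
have := @lor_cell e L (x + n%:R * h) e01 dL; rewrite -/C0.
rewrite -natr1 !mulrDl !mul1r addrA; lra.
Qed.

Lemma lor_interval e L x l : 0 < e <= 1 -> primitive_of L (lor e) -> 0 <= l ->
  L (x + l) - L x <= (l / h + 1) * (e * C0).
Proof.
move=> e01 dL l0; pose n := (Num.truncn (l / h)).+1.
have lh : 0 <= l / h by rewrite divr_ge0// ltW.
have /andP[n1 n2] := truncn_itv lh.
have /andP[e0 _] := e01.
apply: (@le_trans _ _ (L (x + n%:R * h) - L x)).
  rewrite lerD2r; apply: (primitive_mono dL).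
    by rewrite lerD2l -ler_pdivrMr// ltW.
  by move=> t _; have /andP[] := lor01 t e0.
apply: (le_trans (lor_cells _ _ e01 dL)); apply: ler_wpM2r.
  by rewrite mulr_ge0 ?C0_ge0// ltW.
by rewrite /n -natr1 lerD2r.
Qed.

End lorentz_integral.
End geometry.

(** * Averaging over one noise variable *)

Section averaging.
Variables (R : realType) (eps : {posnum R}).
Implicit Types (f g F G L phi psi : R -> R) (J : (R -> R) -> R) (e x t : R).
Notation nu := (uniform_prob (noise_lt eps)).
Notation ep := (eps%:num).

(** For [G] a primitive of [g], the mean of [g (t + w)] over [w] in [[-eps, eps]]. *)
Definition wavg G t := (ep - - ep)^-1 * (G (t + ep) - G (t - ep)).

Lemma cper_wavg G g : primitive_of G g -> cper g -> cper (wavg G).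
Proof.
move=> dG [cg pg]; have cG := primitive_continuous dG; split => t.
  apply: cvgM; first exact: cvg_cst.
  apply: cvgB; apply: (continuous_comp (f := fun t => t + _) _ (cG _));
  by apply: cvgD; [exact: cvg_id|exact: cvg_cst].
rewrite /wavg; congr (_ * _).
have := primitive_period (t + ep) dG pg; have := primitive_period (t - ep) dG pg.
rewrite ![t + 1 + _]addrAC; lra.
Qed.

Lemma shift_primitive G g x : primitive_of G g ->
  primitive_of (fun t => G (t + x)) (fun t => g (t + x)).
Proof.
move=> dG t; have D1 : is_derive t (1:R) (fun t : R => t + x) 1.
  by have := is_deriveD (is_derive_id t (1:R)) (is_derive_cst x t 1); rewrite addr0.
have := @is_derive1_comp R G (fun t => t + x) t _ _ (dG (t + x)) D1.
by rewrite mulr1.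
Qed.

(** Fubini's theorem moves the noise average onto the test function. The average can then be bounded
    pointwise, with no regularity of [J]: this is the smoothing effect of the noise. *)
Lemma state_wavg J G g : state eps J -> primitive_of G g -> cper g ->
  (forall t, 0 <= g t <= 1) ->
  (\int[nu]_w (J (fun t => g (t + w)))%:E = (J (wavg G))%:E)%E.
Proof.
move=> sJ dG cg g01; apply: (st_fub sJ (Phi := fun w t => g (t + w))).
- apply: (measurableT_comp (f := g)).
    by apply: continuous_measurable_fun; exact: cg.1.
  by apply: measurable_funD.
- by move=> w; exact: cper_shift.
- by move=> w t; exact: g01.
- exact: cper_wavg cg.
- move=> t; rewrite integral_uniform//.
  + have dGt : primitive_of (fun w => G (t + w)) (fun w => g (t + w)).
      have := shift_primitive t dG.
      by under eq_fun do rewrite addrC; under [X in primitive_of _ X]eq_fun do rewrite addrC.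
    rewrite (primitive_integral dGt) -?EFinM//; last by rewrite ltW// noise_lt.
    move=> w; apply: (continuous_comp (f := fun w => t + w) _ (cg.1 _)).
    by apply: cvgD; [exact: cvg_cst|exact: cvg_id].
  + apply/measurable_EFinP; apply: (measurableT_comp (f := g)).
      by apply: continuous_measurable_fun; exact: cg.1.
    by apply: measurable_funD.
  + by move=> w; rewrite lee_fin; have /andP[] := g01 (t + w).
Qed.

End averaging.

(** * Periodic bump functions *)

Section tent.
Variable R : realType.
Implicit Types (f g F G L phi psi : R -> R) (J : (R -> R) -> R) (e x t w a b n : R).

(** Each sine changes sign under [t + 1], so the product is 1-periodic; for [0 <= a <= b <= 1] it is
    positive inside the arc from [a] to [b] and nonpositive on the rest of [[0, 1]]. *)
Definition chord a b t : R := sin (pi * (t - a)) * sin (pi * (b - t)).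
Definition tent a b n t : R := Num.min 1 (n * Num.max 0 (chord a b t)).

Lemma cper_chord a b : cper (chord a b).
Proof.
split=> t.
  apply: cvgM.
    apply: (continuous_comp (f := fun t => pi * (t - a)) _ (@continuous_sin R _)).
    by apply: cvgM; [exact: cvg_cst|apply: cvgB; [exact: cvg_id|exact: cvg_cst]].
  apply: (continuous_comp (f := fun t => pi * (b - t)) _ (@continuous_sin R _)).
  by apply: cvgM; [exact: cvg_cst|apply: cvgB; [exact: cvg_cst|exact: cvg_id]].
rewrite /chord.
have -> : pi * (t + 1 - a) = pi * (t - a) + pi by ring.
have -> : pi * (b - (t + 1)) = - (- (pi * (b - t)) + pi) by ring.
by rewrite sinN !sinDpi sinN !opprK mulNr mulrN opprK.
Qed.

Lemma cper_tent a b n : cper (tent a b n).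
Proof.
have [ca pa] := cper_chord a b; split => [t|t]; last by rewrite /tent pa.
apply: (@continuous_min R R (fun=> 1) (fun t => n * Num.max 0 (chord a b t)) t).
  exact: cvg_cst.
apply: cvgM; first exact: cvg_cst.
apply: (@continuous_max R R (fun=> 0) (chord a b) t); first exact: cvg_cst.
exact: ca.
Qed.

Lemma tent01 a b n t : 0 <= n -> 0 <= tent a b n t <= 1.
Proof.
move=> n0; rewrite /tent ge_min lexx/= le_min ler01/=.
by rewrite mulr_ge0// le_max lexx.
Qed.

Lemma chord_le0 a b t : 0 <= a <= b -> b <= 1 -> 0 <= t <= 1 -> t <= a \/ b <= t ->
  chord a b t <= 0.
Proof.
move=> ab b1 t01; have p0 := pi_gt0 R.
have S x : 0 <= x <= 1 -> 0 <= sin (pi * x).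
  by move=> x01; apply: sin_ge0_pi; rewrite mulr_ge0 ?(ltW p0)//= ?ler_piMr ?(ltW p0)//; lra.
have Sn x : -1 <= x <= 0 -> sin (pi * x) <= 0.
  move=> x01; have -> : pi * x = - (pi * - x) by ring.
  by rewrite sinN oppr_le0 S//; lra.
by move=> [ta|bt]; rewrite /chord; [apply: mulr_le0_ge0|apply: mulr_ge0_le0];
  [apply: Sn|apply: S|apply: S|apply: Sn]; lra.
Qed.

Lemma chord_gt0 a b t : 0 <= a <= b -> b <= 1 -> a < t < b -> 0 < chord a b t.
Proof.
move=> ab b1 t01; have p0 := pi_gt0 R.
have S x : 0 < x < 1 -> 0 < sin (pi * x).
  by move=> x01; apply: sin_gt0_pi; rewrite mulr_gt0//= ?gtr_pMr//; lra.
by rewrite mulr_gt0// S//; lra.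
Qed.

Lemma tent_out a b n t : 0 <= a <= b -> b <= 1 -> 0 <= t <= 1 -> t <= a \/ b <= t ->
  tent a b n t = 0.
Proof.
move=> ab b1 t01 tab; have := chord_le0 ab b1 t01 tab => le0.
by rewrite /tent (max_idPl le0) mulr0 (min_idPr ler01).
Qed.

Lemma tent_in a b a' b' : 0 <= a -> a < a' -> a' <= b' -> b' < b -> b <= 1 ->
  exists2 n, 0 <= n & forall t, a' <= t <= b' -> tent a b n t = 1.
Proof.
move=> a0 aa' ab' bb' b1; have ab : 0 <= a <= b by lra.
have [c cab Hc] := EVT_min ab' (continuous_within (cper_chord a b).1).
have m0 : 0 < chord a b c.
  by apply: chord_gt0 => //; move: cab; rewrite in_itv/=; lra.
exists (chord a b c)^-1; first by rewrite invr_ge0 ltW.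
move=> t tab; rewrite /tent.
have H : chord a b c <= chord a b t by apply: Hc; rewrite in_itv.
rewrite (max_idPr _); last by rewrite (le_trans (ltW m0)).
by apply/min_idPl; rewrite ler_pdivlMl// mulr1.
Qed.

End tent.

(** * Bounds on densities of bounded variation *)

Section lower_bounds.
Variables (R : realType) (eps : {posnum R}).
Implicit Types (f g F G L phi psi : R -> R) (J : (R -> R) -> R) (e x t w l s c : R).

Lemma primitive_scale c G g : primitive_of G g -> primitive_of (fun t => c * G t) (fun t => c * g t).
Proof. by move=> dG t; have := is_deriveZ c (dG t). Qed.

Lemma primitive_lin c : primitive_of (fun t : R => c * t) (fun=> c).
Proof.
move=> t; have := is_deriveZ c (is_derive_id t (1:R)).
by rewrite -[_ *: 1]/(_ * 1) mulr1.
Qed.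

Lemma primitive_id : primitive_of (fun t : R => t) (fun=> 1).
Proof. by move=> t; exact: is_derive_id. Qed.

Lemma primitiveB F f G g : primitive_of F f -> primitive_of G g ->
  primitive_of (fun t => F t - G t) (fun t => f t - g t).
Proof. by move=> dF dG t; apply: is_deriveB; [exact: dF|exact: dG]. Qed.

Lemma primitive_sum (I : Type) (r : seq I) (H h : I -> R -> R) :
  (forall i, primitive_of (H i) (h i)) ->
  primitive_of (fun t => \sum_(i <- r) H i t) (fun t => \sum_(i <- r) h i t).
Proof.
move=> dH; elim: r => [|i r ih].
  have E (k : I -> R -> R) : (fun t => \sum_(i <- [::]) k i t) = cst 0.
    by apply/funext => t; rewrite big_nil.
  by rewrite !E => t; exact: is_derive_cst.
have E (k : I -> R -> R) : (fun t => \sum_(j <- i :: r) k j t) =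
    (k i \+ (fun t => \sum_(j <- r) k j t)).
  by apply/funext => t; rewrite big_cons.
by rewrite !E => t; apply: is_deriveD; [exact: dH|exact: ih].
Qed.

(** If the density dipped below half its mean [m] on the middle half of every one of the [K] cells,
    it would fluctuate enough to have variation above [K m / 2]. The dips are witnessed by test
    functions localised to their cells; subtracting their normalised sum from the constant [K] gives
    a derivative [phi] whose primitive stays in [[-1, 1]]. *)
Lemma density_ge_of_var_le J V (K : nat) : state eps J -> var_le J V -> (0 < K)%N ->
  V <= K%:R * mass J / 2 -> exists s, density_ge J (mass J / 2) s (2 * K%:R)^-1.
Proof.
move=> sJ vb K0 VK; apply: contrapT => noLB.
have m0 := mass_ge0 sJ.
have K0' : 0 < K%:R :> R by rewrite ltr0n.
pose lo (j : nat) : R := j%:R / K%:R.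
pose hi (j : nat) : R := j.+1%:R / K%:R.
(* Left end of the middle half of cell [j]; a quarter of a cell on each side leaves room for the
   cut-off. *)
pose s (j : nat) : R := (j%:R + 4^-1) / K%:R.
have /choice[gG HgG] : forall j : nat, exists p : (R -> R) * (R -> R),
    [/\ primitive_of p.2 p.1, cper p.1, forall t, 0 <= p.1 t &
     J p.1 < mass J / 2 * (p.2 (s j + (2 * K%:R)^-1) - p.2 (s j))].
  move=> j; apply: contrapT => H; apply: noLB; exists (s j) => G g dG cg g0.
  by rewrite leNgt; apply/negP => lt; apply: H; exists (g, G).
have sE j : [/\ lo j < s j, s j <= s j + (2 * K%:R)^-1 & s j + (2 * K%:R)^-1 < hi j].
  have -> : s j + (2 * K%:R)^-1 = (j%:R + 3 / 4) / K%:R.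
    by rewrite /s; field; rewrite gt_eqF.
  by split; rewrite /lo /hi /s -?[j.+1%:R]natr1 ?ltr_pM2r ?ler_pM2r ?invr_gt0//; lra.
have hi1 (j : 'I_K) : hi j <= 1 by rewrite /hi ler_pdivrMr// mul1r ler_nat.
have lo0 j : 0 <= lo j by rewrite divr_ge0.
have lohi j : lo j <= hi j by have [] := sE j; lra.
have /choice[nn Hnn] : forall j : 'I_K, exists n : R, 0 <= n /\
    forall t, s j <= t <= s j + (2 * K%:R)^-1 -> tent (lo j) (hi j) n t = 1.
  move=> j; have [a1 a2 a3] := sE j.
  by have [n n0 Hn] := tent_in (lo0 j) a1 a2 a3 (hi1 j); exists n.
pose h (j : 'I_K) t := (gG j).1 t * tent (lo j) (hi j) (nn j) t.
have ch j : cper (h j) by apply: cperM; [have [] := HgG j|exact: cper_tent].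
have h0 j t : 0 <= h j t.
  rewrite mulr_ge0//; first by have [_ _ +] := HgG j; exact.
  by have /andP[] := tent01 (lo j) (hi j) t (Hnn j).1.
have /choice[H dH] : forall j, exists H, primitive_of H (h j).
  by move=> j; exact: primitive_exists (ch j).1.
pose I j := H j 1 - H j 0.
have Hmono j x y : x <= y -> H j x <= H j y.
  by move=> xy; apply: (primitive_mono (dH j) xy) => t _.
have mid (j : 'I_K) : (gG j).2 (s j + (2 * K%:R)^-1) - (gG j).2 (s j) <= I j.
  have [dG cg g0 _] := HgG j; have [b1 b2 b3] := sE j.
  apply: (@le_trans _ _ (H j (s j + (2 * K%:R)^-1) - H j (s j))).
    apply: (primitive_le dG (dH j) b2) => t tm.
    by rewrite /h (Hnn j).2// mulr1.
  have := Hmono j _ _ (le_trans (lo0 j) (ltW b1)).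
  have := Hmono j _ _ (le_trans (ltW b3) (hi1 j)).
  by rewrite /I; lra.
have Jh (j : 'I_K) : J (h j) < mass J / 2 * I j.
  have [dG cg g0 lt] := HgG j.
  apply: (@le_lt_trans _ _ (J (gG j).1)).
    apply: (st_mono sJ) => // t; rewrite ler_piMr//.
    by have /andP[] := tent01 (lo j) (hi j) t (Hnn j).1.
  by apply: (lt_le_trans lt); rewrite ler_wpM2l// divr_ge0.
have I0 (j : 'I_K) : 0 < I j.
  rewrite ltNge; apply/negP => Ile; have := Jh j; apply/negP; rewrite -leNgt.
  apply: (@le_trans _ _ 0); last exact: (st_pos sJ).
  by rewrite mulr_ge0_le0// divr_ge0.
(* [K t] climbs by one across each cell, and so does the primitive of [h j / I j] in its own cell;
   the difference is periodic and never leaves [[-1, 1]], while [J phi > K m / 2]. *)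
pose Phi t := K%:R * t - \sum_(j < K) (I j)^-1 * (H j t - H j 0).
pose phi t := K%:R - \sum_(j < K) (I j)^-1 * h j t.
have dPhi : primitive_of Phi phi.
  move=> t; apply: is_deriveB; first exact: primitive_lin.
  have := @primitive_sum _ (index_enum 'I_K) (fun j t => (I j)^-1 * (H j t - H j 0)) (fun j t => (I j)^-1 * h j t).
  apply => j; apply: primitive_scale => u.
  by have := is_deriveB (dH j u) (is_derive_cst (H j 0) u 1); rewrite subr0.
have cphi : cper phi.
  apply: cperB; first exact: cper_cst.
  by apply: cper_sum => j; exact: cperZ.
have pPhi t : Phi (t + 1) = Phi t.
  rewrite /Phi mulrDr mulr1.
  rewrite [X in _ - X](_ : _ = \sum_(j < K) (I j)^-1 * (H j t - H j 0) + K%:R); first by ring.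
  have KE : (K%:R : R) = \sum_(j < K) 1 by rewrite sumr_const card_ord.
  transitivity (\sum_(j < K) ((I j)^-1 * (H j t - H j 0) + 1)); last by rewrite big_split/= -KE.
  apply: eq_bigr => j _.
  have := primitive_period t (dH j) (ch j).2; rewrite -/(I j) => e.
  have -> : H j (t + 1) = H j t + I j by lra.
  by field; rewrite gt_eqF.
have Phi1 t : `|Phi t| <= 1.
  have [u [u01 <- _]] := periodic_frac t pPhi.
  pose G j := (I j)^-1 * (H j u - H j 0).
  have uK : 0 <= K%:R * u by rewrite mulr_ge0//; lra.
  have /andP[j1 j2] := truncn_itv uK; set j0 := Num.truncn _ in j1 j2.
  have j0K : (j0 < K)%N.
    rewrite -(ltr_nat R); apply: (le_lt_trans j1).
    by rewrite gtr_pMr//; lra.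
  have G01 (j : 'I_K) : 0 <= G j <= 1.
    rewrite /G mulrC divr_ge0 ?(ltW (I0 j))// ?subr_ge0 ?Hmono//=; try lra.
    rewrite ler_pdivrMr// mul1r lerD2r Hmono//; lra.
  have G1 (j : 'I_K) : (j < j0)%N -> G j = 1.
    move=> jj; have hu : hi j <= u.
      by rewrite /hi ler_pdivrMr// mulrC (le_trans _ j1)// ler_nat.
    have [u1 /andP[uu u2]] := primitive_MVT (dH j) (ltW (proj2 (andP u01))).
    rewrite {1}/h tent_out ?mulr0 ?mul0r//; [|by rewrite lo0 lohi|lra|lra].
    move=> e; rewrite /G (_ : H j u - H j 0 = I j) ?mulVf ?gt_eqF//.
    by rewrite /I; lra.
  have G0 (j : 'I_K) : (j0 < j)%N -> G j = 0.
    move=> jj; have hu : u <= lo j.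
      by rewrite /lo ler_pdivlMr// mulrC (le_trans (ltW j2))// ler_nat.
    have [u1 /andP[uu u2]] := primitive_MVT (dH j) (proj1 (andP u01)).
    rewrite {1}/h tent_out ?mulr0 ?mul0r//; [|by rewrite lo0 lohi|lra|lra].
    by move=> e; rewrite /G e mulr0.
  have S : \sum_(j < K) G j = j0%:R + G (Ordinal j0K).
    rewrite (bigD1 (Ordinal j0K))//= addrC; congr (_ + _).
    rewrite (eq_bigr (fun j : 'I_K => if (j < j0)%N then 1 else 0)).
      rewrite -big_mkcondr/=.
      rewrite (eq_bigl (fun j : 'I_K => (j < j0)%N)).
        by rewrite -(@big_ord_widen _ _ _ j0 K (fun=> 1)) ?(ltnW j0K)// sumr_const card_ord.
      by move=> j; rewrite -val_eqE/=; case: ltngtP.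
    move=> j; rewrite -val_eqE/= => ne; case: ltngtP ne => // [/G1|/G0] -> //.
  rewrite /Phi -/(G _) S; have := G01 (Ordinal j0K).
  by rewrite ler_norml; move: j2; rewrite -natr1; lra.
have := vb _ _ dPhi cphi pPhi Phi1.
rewrite leNgt => /negP; apply; apply: (le_lt_trans VK).
rewrite /phi (stB sJ) ?(stc sJ); [|exact: cper_cst|by apply: cper_sum => j; exact: cperZ].
rewrite (st_sum sJ); last by move=> j; exact: cperZ.
have : \sum_(j < K) J (fun t => (I j)^-1 * h j t) < \sum_(j < K) mass J / 2.
  apply: ltr_sum; first by apply/hasP; exists (Ordinal K0); rewrite ?mem_index_enum.
  by move=> j _; rewrite (stZ sJ _ (ch j)) ltr_pdivrMl// mulrC.
by rewrite sumr_const card_ord -[_ *+ K]mulr_natl; lra.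
Qed.

(** For [g] normalised to integral 1, [g - 1] has a periodic primitive with values in [[-1, 1]], so
    [J (g - 1) <= V]. The summand [eta] keeps the integral positive and is sent to 0. *)
Lemma UB_of_var_le J V G g : state eps J -> var_le J V -> primitive_of G g -> cper g ->
  (forall t, 0 <= g t) -> J g <= (mass J + V) * (G 1 - G 0).
Proof.
move=> sJ vb dG cg g0; have m0 := mass_ge0 sJ; have V0 := var_le_ge0 sJ vb.
have mono x y : x <= y -> G x <= G y by move=> xy; apply: (primitive_mono dG xy) => t _.
have I0 : 0 <= G 1 - G 0 by rewrite subr_ge0 mono.
have key (eta : R) : 0 < eta -> J g <= (mass J + V) * (G 1 - G 0 + eta).
  move=> eta0; set I := G 1 - G 0 + eta; have Ip : 0 < I by rewrite /I; lra.
  pose ge t := g t + eta; pose Ge t := G t + eta * t.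
  have dGe : primitive_of Ge ge by move=> t; apply: is_deriveD; [exact: dG|exact: primitive_lin].
  have cge : cper ge by apply: cperD => //; exact: cper_cst.
  have Gem x y : x <= y -> Ge x <= Ge y.
    by move=> xy; rewrite /Ge lerD ?mono// ler_pM2l.
  pose Phi t := I^-1 * (Ge t - Ge 0) - t; pose phi t := I^-1 * ge t - 1.
  have dPhi : primitive_of Phi phi.
    apply: primitiveB primitive_id; apply: (@primitive_scale I^-1 (fun t => Ge t - Ge 0)) => u.
    by have := is_deriveB (dGe u) (is_derive_cst (Ge 0) u 1); rewrite subr0.
  have cphi : cper phi by apply: cperB; [exact: cperZ|exact: cper_cst].
  have pPhi t : Phi (t + 1) = Phi t.
    have := primitive_period t dGe cge.2; rewrite /Phi => e.
    have -> : Ge (t + 1) = Ge t + I by rewrite /I; move: e; rewrite /Ge; lra.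
    by field; rewrite gt_eqF.
  have Phi1 t : `|Phi t| <= 1.
    have [u [u01 <- _]] := periodic_frac t pPhi.
    have : 0 <= I^-1 * (Ge u - Ge 0) <= 1.
      rewrite mulrC divr_ge0 ?(ltW Ip) ?subr_ge0 ?Gem//=; try lra.
      rewrite ler_pdivrMr// mul1r.
      have : Ge u <= Ge 1 by apply: Gem; lra.
      by rewrite /I /Ge; lra.
    by rewrite /Phi ler_norml; lra.
  have := vb _ _ dPhi cphi pPhi Phi1.
  have cZ : cper (fun t => I^-1 * ge t) by exact: cperZ.
  rewrite /phi (stB sJ cZ (cper_cst 1)) (stZ sJ _ cge) lerBlDr ler_pdivrMl// => H.
  apply: (@le_trans _ _ (J ge)); last by rewrite mulrC [mass J + V]addrC.
  by apply: (st_mono sJ) => // t; rewrite /ge lerDl ltW.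
apply/ler_addgt0Pr => e e0.
have d0 : 0 < mass J + V + 1 by lra.
have := key (e / (mass J + V + 1)) (divr_gt0 e0 d0).
rewrite mulrDr => /le_trans; apply; rewrite lerD2l mulrA ler_pdivrMr//.
by rewrite mulrC ler_pM2l//; lra.
Qed.

Lemma density_ge_full J c s : density_ge J c s 1 -> forall g, cper g -> (forall t, 0 <= g t) ->
  c * junif 0 1 g <= J g.
Proof.
move=> lb g cg g0; have [G dG] := primitive_exists cg.1.
rewrite (junifE ler01 dG cg.1) -(primitive_period s dG cg.2).
exact: lb.
Qed.

Lemma density_ge_weaken J c s l l' : 0 <= c -> 0 <= l' <= l -> density_ge J c s l -> density_ge J c s l'.
Proof.
move=> c0 ll lb G g dG cg g0; apply: le_trans (lb _ _ dG cg g0).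
apply: ler_wpM2l => //; rewrite lerD2r.
by apply: (primitive_mono dG) => // ; lra.
Qed.

Lemma density_ge_scale J c s l (b : R) : 0 <= b -> density_ge J c s l -> density_ge (fun phi => b * J phi) (b * c) s l.
Proof.
by move=> b0 lb G g dG cg g0; rewrite -mulrA ler_wpM2l//; apply: lb.
Qed.

End lower_bounds.

(** * Arcs on which the slope keeps its sign *)

Section growth.
Variables (R : realType).
Implicit Types (f g F G L phi psi : R -> R) (J : (R -> R) -> R) (e x t w l s c : R).
Variables (d1 d2 : R -> R) (k h : R).
Hypotheses (c1 : cper d1) (dd1 : primitive_of d1 d2) (k0 : 0 < k) (h0 : 0 < h) (h1 : h <= 1).
Hypothesis ck : cells d1 d2 k h.

(** Either [|d1| >= k] throughout, and by the intermediate value theorem the sign is constant; or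
    [sg * d1] increases with slope at least [k], and its sign at the midpoint of the arc decides
    between the last and the first third, whose points are at distance at least [l / 6] from the
    midpoint. *)
Lemma monotone_third x l : 0 < l <= h -> exists v (sg : R),
  [/\ x <= v, v + l / 3 <= x + l, sg = 1 \/ sg = - 1 &
   forall t, v <= t <= v + l / 3 -> k * l / 6 <= sg * d1 t].
Proof.
move=> /andP[l0 lh]; have K0 := k0; have H0 := h0; have H1 := h1.
have kl : k * l / 6 <= k.
  have : k * (l / 6) <= k * 1 by rewrite ler_pM2l//; lra.
  by lra.
have slope (sg : R) : sg = 1 \/ sg = -1 -> (forall t, x <= t <= x + h -> k <= sg * d2 t) ->
    exists v (sg : R), [/\ x <= v, v + l / 3 <= x + l, sg = 1 \/ sg = - 1 &
     forall t, v <= t <= v + l / 3 -> k * l / 6 <= sg * d1 t].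
  move=> sg1 Hs.
  have inc y z : x <= y -> y <= z -> z <= x + h -> k * (z - y) <= sg * d1 z - sg * d1 y.
    move=> xy yz zx; rewrite mulrBr.
    apply: (primitive_le (primitive_lin k) (primitive_scale sg dd1) yz) => t tt.
    by apply: Hs; lra.
  have [p0|p0] := leP 0 (sg * d1 (x + l / 2)).
    exists (x + 2 * l / 3), sg; split => //; try lra.
    move=> t tt; have := inc (x + l / 2) t; move=> /(_ _ _ _)/le_trans.
    have : k * (l / 6) <= k * (t - (x + l / 2)) by rewrite ler_pM2l//; lra.
    have := inc (x + l / 2) t; lra.
  exists x, (- sg); split; try lra.
  move=> t tt.
  have : k * (l / 6) <= k * (x + l / 2 - t) by rewrite ler_pM2l//; lra.
  have := inc t (x + l / 2); lra.
case: (ck x) => Hx; last 2 first.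
- by apply: (slope 1); [left|move=> t /Hx; rewrite mul1r].
- by apply: (slope (-1)); [right|move=> t /Hx; lra].
have xin t : x <= t <= x + l / 3 -> x <= t <= x + h by lra.
have nz t : x <= t <= x + h -> d1 t != 0.
  by move=> /Hx; case: eqP => // ->; rewrite normr0; lra.
have xx : x <= x <= x + h by lra.
have [p0|p0] := ltP 0 (d1 x).
  exists x, 1; split => //; try lra.
  move=> t tt; rewrite mul1r; apply: (le_trans kl); rewrite -(gtr0_norm (_ : 0 < d1 t)).
    by apply: Hx; exact: xin.
  rewrite ltNge; apply/negP => le0.
  have xt : x <= t by lra.
  have mm : Num.min (d1 x) (d1 t) <= 0 <= Num.max (d1 x) (d1 t).
    by apply/andP; split; [rewrite ge_min le0 orbT|rewrite le_max (ltW p0)].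
  have [c ci e] := @IVT R d1 x t 0 xt (continuous_within c1.1) mm.
  move: ci; rewrite in_itv/= => ci; have := nz c; rewrite e eqxx; move=> H; suff: false by []; apply: H; lra.
exists x, (-1); split => //; try lra.
move=> t tt; rewrite mulN1r; apply: (le_trans kl); rewrite -(ltr0_norm (_ : d1 t < 0)).
  by apply: Hx; exact: xin.
rewrite ltNge; apply/negP => le0.
have xt : x <= t by lra.
have mm : Num.min (d1 x) (d1 t) <= 0 <= Num.max (d1 x) (d1 t).
  by apply/andP; split; [rewrite ge_min p0|rewrite le_max le0 orbT].
have [c ci e] := @IVT R d1 x t 0 xt (continuous_within c1.1) mm.
move: ci; rewrite in_itv/= => ci; have := nz c; rewrite e eqxx; move=> H; suff: false by []; apply: H; lra.
Qed.

End growth.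

(** * Contraction of the random dynamics *)

Section dynamics.
Variables (R : realType) (eps : {posnum R}).
Implicit Types (f g F G L phi psi : R -> R) (J : (R -> R) -> R) (e x t w c d cc tau theta l : R).
Variables (Xi d1 d2 : R -> R) (B alpha a : R).
Hypotheses (cX : cper Xi) (c1 : cper d1) (c2 : cper d2).
Hypotheses (dX : primitive_of Xi d1) (dd1 : primitive_of d1 d2).
Hypotheses (B0 : 0 < B) (B1 : forall t, `|d1 t| <= B) (B2 : forall t, `|d2 t| <= B).
Hypothesis alpha0 : 0 < alpha.

(** The lift of [f_w]. Since [xi] is real valued the map has degree 0, so the lift is itself
    1-periodic and composition with it preserves periodic test functions. *)
Definition Fw w t := alpha * Xi (t + w) + a.

Lemma cper_Fw w : cper (Fw w).
Proof.
by apply: cperD; [apply: cperZ; exact: cper_shift|exact: cper_cst].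
Qed.

Lemma primitive_Fw w : primitive_of (Fw w) (fun t => alpha * d1 (t + w)).
Proof.
move=> t; have := is_deriveD (is_deriveZ alpha (shift_primitive w dX t)) (is_derive_cst a t (1:R)).
by rewrite addr0.
Qed.

(* Lasota-Yorke inequality: a test function for the image of [chi * J] is pulled back
   to [Phi o Fw], whose derivative is divided by [Fw'] through [chi = d1 * H]. *)
Lemma var_le_push J V w chi H dH (cH cdH : R) : state eps J -> var_le J V ->
  cper chi -> cper H -> cper dH -> primitive_of H dH -> (forall t, chi t = d1 t * H t) ->
  0 < cH -> (forall t, `|H t| <= cH) -> (forall t, `|dH t| <= cdH) ->
  var_le (jpush (Fw w) (fun t => chi (t + w)) J) (cH / alpha * V + cdH / alpha * mass J).
Proof.
move=> sJ vb cchi cH' cdH' dHH chiE cH0 Hle dHle Phi phi dP cp pP P1.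
have cF := cper_Fw w.
have cP : cper Phi by split => //; exact: primitive_continuous dP.
have comp f : cper f -> cper (fun t => f (Fw w t)).
  move=> [cf pf]; split => t; last by rewrite cF.2.
  by apply: (@continuous_comp _ _ _ (Fw w) f); [exact: cF.1|exact: cf].
pose Psi t := alpha^-1 * (Phi (Fw w t) * H (t + w)).
pose r t := alpha^-1 * (Phi (Fw w t) * dH (t + w)).
have cr : cper r by apply: cperZ; apply: cperM; [exact: comp|exact: cper_shift].
have cm : cper (fun t => phi (Fw w t) * chi (t + w)).
  by apply: cperM; [exact: comp|exact: cper_shift].
(* Product rule: the derivative of [Phi o Fw] meets [H] through [d1 * H = chi], and the remaining
   term [r], with the derivative of [H], is controlled by the mass. *)
have dPsi : primitive_of Psi (fun t => phi (Fw w t) * chi (t + w) + r t).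
  move=> t; have D1 := @is_derive1_comp R Phi (Fw w) t _ _ (dP _) (primitive_Fw w t).
  have D2 := shift_primitive w dHH t.
  have := is_deriveZ alpha^-1 (is_deriveM D1 D2).
  congr is_derive; rewrite /r chiE -![_ *: _]/(_ * _) /=.
  by field; rewrite gt_eqF.
have HPsi : J (fun t => phi (Fw w t) * chi (t + w) + r t) <= cH / alpha * V.
  apply: (var_le_scaled sJ _ vb dPsi).
  - by rewrite divr_gt0.
  - exact: cperD.
  - by move=> t; rewrite /Psi cF.2 addrAC cH'.2.
  - move=> t; rewrite /Psi !normrM normfV (gtr0_norm alpha0) mulrC ler_pM2r ?invr_gt0//.
    by rewrite -[leRHS]mul1r; apply: ler_pM.
have Hr : `|J r| <= cdH / alpha * mass J.
  apply: (st_norm sJ cr) => t.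
  rewrite /r !normrM normfV (gtr0_norm alpha0) mulrC ler_pM2r ?invr_gt0//.
  by rewrite -[leRHS]mul1r; apply: ler_pM.
rewrite /jpush; move: HPsi; rewrite (stD sJ cm cr) => HPsi.
move: Hr; rewrite ler_norml => /andP[Hr _]; lra.
Qed.

(* [chi_ i] localises to the shell where [|d1|] is of order [scale_ i]; the shells
   telescope. *)
Variable del : R.
Hypothesis del0 : 0 < del.

Definition scale_ (i : nat) : R := del / 16 ^+ i.
Definition chi_ (i : nat) t : R :=
  if i is j.+1 then lorC d1 (scale_ i) t - lorC d1 (scale_ j) t else lorC d1 (scale_ 0) t.
Definition H_ (i : nat) t : R :=
  if i is j.+1 then reg_inv d1 (scale_ i) t - reg_inv d1 (scale_ j) t else reg_inv d1 (scale_ 0) t.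
Definition dH_ (i : nat) t : R :=
  if i is j.+1 then dreg_inv d1 d2 (scale_ i) t - dreg_inv d1 d2 (scale_ j) t else dreg_inv d1 d2 (scale_ 0) t.

Lemma scale_gt0 i : 0 < scale_ i.
Proof. by rewrite divr_gt0// exprn_gt0. Qed.

Lemma scale_S i : scale_ i.+1 = scale_ i / 16.
Proof. by rewrite /scale_ exprS; field; rewrite gt_eqF// exprn_gt0. Qed.

Lemma scale_S_le i : scale_ i.+1 <= scale_ i.
Proof. by rewrite scale_S; have := scale_gt0 i; lra. Qed.

Lemma cper_chi_ i : cper (chi_ i).
Proof.
by case: i => [|i]; [|apply: cperB]; apply: cper_lorC => //; exact: scale_gt0.
Qed.

Lemma cper_H_ i : cper (H_ i).
Proof.
by case: i => [|i]; [|apply: cperB]; apply: cper_reg_inv => //; exact: scale_gt0.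
Qed.

Lemma cper_dH_ i : cper (dH_ i).
Proof.
by case: i => [|i]; [|apply: cperB]; apply: cper_dreg_inv => //; exact: scale_gt0.
Qed.

Lemma primitive_H_ i : primitive_of (H_ i) (dH_ i).
Proof.
case: i => [|i]; first by apply: primitive_reg_inv => //; exact: scale_gt0.
by move=> t; apply: is_deriveB; apply: primitive_reg_inv => //; exact: scale_gt0.
Qed.

Lemma chi_E i t : chi_ i t = d1 t * H_ i t.
Proof.
by case: i => [|i]; rewrite /chi_ /H_ /lorC /reg_inv ?mulrBr !mulrA -!expr2.
Qed.

Lemma chi_le_lor i t : chi_ i.+1 t <= lor d1 (scale_ i) t.
Proof.
rewrite lorE ?scale_gt0//= lerB//.
by have /andP[] := lorC01 d1 t (scale_gt0 i.+1).
Qed.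

Lemma chi_ge0 i t : 0 <= chi_ i t.
Proof.
case: i => [|i] /=; first by have /andP[] := lorC01 d1 t (scale_gt0 0).
have := lor_mono d1 t (scale_gt0 i.+1) (scale_S_le i).
by rewrite !lorE ?scale_gt0//; lra.
Qed.

Lemma chi01 i t : 0 <= chi_ i t <= 1.
Proof.
rewrite chi_ge0; case: i => [|i] /=; first by have /andP[] := lorC01 d1 t (scale_gt0 0).
have /andP[_ +] := lorC01 d1 t (scale_gt0 i.+1).
have /andP[+ _] := lorC01 d1 t (scale_gt0 i); lra.
Qed.

Lemma sum_chi I t : \sum_(i < I.+1) chi_ i t = 1 - lor d1 (scale_ I) t.
Proof.
elim: I => [|I ih]; first by rewrite big_ord1 lorE ?scale_gt0//= subKr.
by rewrite big_ord_recr/= ih !lorE ?scale_gt0//; ring.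
Qed.

Lemma H_le i t : `|H_ i t| <= (scale_ i)^-1.
Proof.
have Q j : `|reg_inv d1 (scale_ j) t| <= (2 * scale_ j)^-1 by apply: reg_inv_le; exact: scale_gt0.
have I j : (2 * scale_ j)^-1 = (scale_ j)^-1 / 2 by rewrite invfM mulrC.
have P j : 0 < (scale_ j)^-1 by rewrite invr_gt0 scale_gt0.
case: i => [|i] /=; first by have := Q 0; rewrite I; have := P 0%N; lra.
rewrite (le_trans (ler_normB _ _))//.
have := Q i; have := Q i.+1; rewrite !I.
have : (scale_ i)^-1 <= (scale_ i.+1)^-1 by rewrite lef_pV2 ?posrE ?scale_gt0// scale_S_le.
lra.
Qed.

Lemma dH_le i t : `|dH_ i t| <= 2 * B / scale_ i ^+ 2.
Proof.
have Q j : `|dreg_inv d1 d2 (scale_ j) t| <= B / scale_ j ^+ 2 by apply: dreg_inv_le => //; exact: scale_gt0.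
have P j : 0 < B / scale_ j ^+ 2 by rewrite divr_gt0// exprn_gt0// scale_gt0.
case: i => [|i] /=; first by have := Q 0; have := P 0%N; lra.
rewrite (le_trans (ler_normB _ _))//.
have := Q i; have := Q i.+1.
have : B / scale_ i ^+ 2 <= B / scale_ i.+1 ^+ 2.
  rewrite ler_pM2l// lef_pV2 ?posrE ?exprn_gt0 ?scale_gt0//.
  by rewrite lerXn2r ?nnegrE ?(ltW (scale_gt0 _))// scale_S_le.
lra.
Qed.

Definition shell w i J := jpush (Fw w) (fun t => chi_ i (t + w)) J.
Definition resid w i J := jpush (Fw w) (fun t => lor d1 (scale_ i) (t + w)) J.
Definition push w J phi := J (fun t => phi (Fw w t)).

Lemma cper_comp_Fw w f : cper f -> cper (fun t => f (Fw w t)).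
Proof.
move=> [cf pf]; have cF := cper_Fw w; split => t; last by rewrite cF.2.
by apply: (@continuous_comp _ _ _ (Fw w) f); [exact: cF.1|exact: cf].
Qed.

Section state_push.
Variables (J : (R -> R) -> R) (sJ : state eps J).

Lemma state_shell w i : state eps (shell w i J).
Proof.
apply: state_push => //; first exact: cper_Fw.
  by apply: cper_shift; exact: cper_chi_.
by move=> t; exact: chi01.
Qed.

Lemma state_resid w i : state eps (resid w i J).
Proof.
apply: state_push => //; first exact: cper_Fw.
  by apply: cper_shift; apply: cper_lor => //; exact: scale_gt0.
by move=> t; apply: lor01; exact: scale_gt0.
Qed.

Lemma push_split w I phi : cper phi ->
  push w J phi = \sum_(i < I.+1) shell w i J phi + resid w I J phi.
Proof.
move=> cp; have cc := cper_comp_Fw w cp.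
rewrite -(st_sum sJ); last first.
  by move=> i; apply: cperM => //; apply: cper_shift; exact: cper_chi_.
rewrite -(stD sJ).
- congr J; apply/funext => t; rewrite -mulr_sumr sum_chi -mulrDr subrK mulr1//.
- apply: cper_sum => i; apply: cperM => //; apply: cper_shift; exact: cper_chi_.
- by apply: cperM => //; apply: cper_shift; apply: cper_lor => //; exact: scale_gt0.
Qed.

Lemma state_push_w w : state eps (push w J).
Proof.
rewrite (_ : push w J = jpush (Fw w) (fun=> 1) J).
  by apply: state_push => //; [exact: cper_Fw|exact: cper_cst|move=> _; rewrite ler01 lexx].
by apply/funext => phi; congr J; apply/funext => t; rewrite mulr1.
Qed.

(** The first term carries the inverse of the expansion rate of the shell, the second the
    distortion, a bound on the second derivative over the slope squared. *)
Lemma var_le_shell V w i : var_le J V -> var_le (shell w i J)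
  (V / (alpha * scale_ i) + 2 * B / (alpha * scale_ i ^+ 2) * mass J).
Proof.
move=> vb.
have := @var_le_push J V w (chi_ i) (H_ i) (dH_ i) (scale_ i)^-1 (2 * B / scale_ i ^+ 2) sJ vb
  (cper_chi_ i) (cper_H_ i) (cper_dH_ i) (primitive_H_ i) (chi_E i) _ (H_le i) (dH_le i).
rewrite invr_gt0 scale_gt0 => /(_ isT).
have s0 := lt0r_neq0 (scale_gt0 i); have a0 := lt0r_neq0 alpha0.
by congr var_le; field; rewrite s0 a0.
Qed.

Lemma mass_shell_le w i : mass (shell w i.+1 J) <= mass (resid w i J).
Proof.
apply: (st_mono sJ).
- by apply: cperM; [exact: cper_cst|apply: cper_shift; exact: cper_chi_].
- by apply: cperM; [exact: cper_cst|apply: cper_shift; apply: cper_lor => //; exact: scale_gt0].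
- by move=> t; rewrite !mul1r chi_le_lor.
Qed.

Lemma mass_split w I : mass J = \sum_(i < I.+1) mass (shell w i J) + mass (resid w I J).
Proof. by rewrite {1}/mass -(push_split w I (cper_cst 1)). Qed.

End state_push.
Variables (k : R) (M : nat).
Hypotheses (k0 : 0 < k) (M0 : (0 < M)%N) (ck : cells d1 d2 k M%:R^-1).
Local Notation h := (M%:R^-1 : R).

Lemma h_gt0 : 0 < h.
Proof. by rewrite invr_gt0 ltr0n. Qed.

Lemma h_le1 : h <= 1.
Proof. by rewrite invf_le1 ?ltr0n// ler1n. Qed.

(** A third of the arc has slope of constant sign and size at least [k l / 6 >= del]. There the
    cut-off is at least one half, whence the mass [c l / 6]. The image of this third is an arc of
    length at least [alpha] times [k l / 6] times [l / 3], and the density is divided by at most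
    [alpha * B], and by 2 for the cut-off. *)
Lemma density_ge_shell J c s l w : state eps J -> 0 <= c -> density_ge J c s l ->
  6 * del / k <= l <= h ->
  (forall l', 0 <= l' <= alpha * k * l ^+ 2 / 18 ->
    exists s', density_ge (shell w 0 J) (c / (2 * alpha * B)) s' l') /\
  c * l / 6 <= mass (shell w 0 J).
Proof.
move=> sJ c0 lb /andP[ll lh].
have D0 := del0; have A0 := alpha0; have BB := B0; have K0 := k0.
have l0 : 0 < l by apply: lt_le_trans ll; rewrite divr_gt0// mulr_gt0.
have dl : del <= k * l / 6.
  by move: ll; rewrite ler_pdivrMr//; lra.
have [|v [sg [v1 v2 sg1 Hv]]] := @monotone_third R d1 d2 k h c1 dd1 k0 h_gt0 h_le1 ck (s + w) l.
  by rewrite l0.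
have sc0 : scale_ 0 = del by rewrite /scale_ expr0 divr1.
have sgn t : `|sg * d1 t| = `|d1 t| by case: sg1 => ->; rewrite ?mul1r// mulN1r normrN.
have half t : v - w <= t <= v - w + l / 3 -> 2^-1 <= chi_ 0 (t + w).
  move=> tt; apply: lorC_half; first exact: scale_gt0.
  rewrite sc0 -sgn (le_trans dl)// (le_trans _ (ler_norm _))//; apply: Hv; lra.
split; last first.
  have cq : cper (fun t => 1 * chi_ 0 (t + w)).
    by apply: cperM; [exact: cper_cst|apply: cper_shift; exact: cper_chi_].
  have [Q dQ] := primitive_exists cq.1.
  have q0 t : 0 <= 1 * chi_ 0 (t + w) by rewrite mul1r chi_ge0.
  apply: le_trans (lb Q _ dQ cq q0).
  rewrite -mulrA ler_wpM2l//.
  have m1 : Q s <= Q (v - w) by apply: (primitive_mono dQ) => //; lra.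
  have m2 : Q (v - w + l / 3) <= Q (s + l) by apply: (primitive_mono dQ) => //; lra.
  have m3 : v - w <= v - w + l / 3 by lra.
  have := primitive_le (primitive_lin 2^-1) dQ m3 => H.
  have {}H : 2^-1 * (v - w + l / 3) - 2^-1 * (v - w) <= Q (v - w + l / 3) - Q (v - w).
    by apply: H => t /half; rewrite mul1r.
  lra.
move=> l' l'b.
pose F := Fw w; have dF := primitive_Fw w.
(* The left end of the image arc; it comes from one end of the third or the other according to
   orientation. *)
pose s' := if sg == 1 then F (v - w) else F (v - w + l / 3).
exists s' => G g dG cg g0.
have cq : cper (fun t => g (F t) * chi_ 0 (t + w)).
  by apply: cperM; [exact: cper_comp_Fw|apply: cper_shift; exact: cper_chi_].
have [Q dQ] := primitive_exists cq.1.
have q0 t : 0 <= g (F t) * chi_ 0 (t + w) by rewrite mulr_ge0// chi_ge0.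
apply: le_trans (lb Q _ dQ cq q0).
rewrite -[c / _ * _]mulrA; apply: ler_wpM2l => //.
have m1 : Q s <= Q (v - w) by apply: (primitive_mono dQ) => //; lra.
have m2 : Q (v - w + l / 3) <= Q (s + l) by apply: (primitive_mono dQ) => //; lra.
have m3 : v - w <= v - w + l / 3 by lra.
(* With this constant the derivative of [C * G (F t)] is [g (F t)] times [sg * d1 / (2 B) <= 1/2],
   hence lies below [g (F t)] times the cut-off. *)
pose C := sg / (2 * alpha * B).
have dGF : primitive_of (fun t => C * G (F t)) (fun t => C * (g (F t) * (alpha * d1 (t + w)))).
  apply: primitive_scale => t; exact: (@is_derive1_comp R G F t _ _ (dG _) (dF t)).
have H : C * G (F (v - w + l / 3)) - C * G (F (v - w)) <= Q (v - w + l / 3) - Q (v - w).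
  apply: (primitive_le dGF dQ m3) => t tt.
  have -> : C * (g (F t) * (alpha * d1 (t + w))) = g (F t) * (sg * d1 (t + w) / (2 * B)).
    by rewrite /C; field; rewrite !gt_eqF.
  apply: ler_wpM2l => //; apply: le_trans (half _ tt).
  rewrite ler_pdivrMr ?mulr_gt0//.
  have := B1 (t + w); have := ler_norm (sg * d1 (t + w)); rewrite sgn; lra.
have Fle : alpha * k * l ^+ 2 / 18 <= sg * F (v - w + l / 3) - sg * F (v - w).
  have := primitive_le (primitive_lin (alpha * (k * l / 6))) (primitive_scale sg dF) m3.
  move=> H2; apply: (le_trans _ (H2 _)); first by rewrite expr2; lra.
  move=> t tt; have -> : sg * (alpha * d1 (t + w)) = alpha * (sg * d1 (t + w)) by ring.
  by rewrite ler_pM2l//; apply: Hv; lra.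
have Gm x y : x <= y -> G x <= G y by move=> xy; apply: (primitive_mono dG xy) => t _.
have i0 : 0 < (2 * alpha * B)^-1 by rewrite invr_gt0 !mulr_gt0.
apply: (@le_trans _ _ (C * G (F (v - w + l / 3)) - C * G (F (v - w)))); last lra.
rewrite -mulrBr /C [sg / _]mulrC -(mulrA _ sg); apply: ler_wpM2l; first exact: ltW.
rewrite /s'; case: sg1 => sgE; rewrite sgE in Fle *.
  rewrite eqxx mul1r lerD2r; apply: Gm; lra.
have -> : ((-1 : R) == 1) = false by apply/eqP; lra.
rewrite mulN1r opprB lerD2r; apply: Gm; lra.
Qed.

(* [phi_ n] is the countable family of test functions detecting the total variation. *)
Variables (phi_ : nat -> R -> R) (P : probability (Omega eps) R).
Variable cons : R -> Omega eps -> Omega eps.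
Hypotheses (cphi : forall n, cper (phi_ n)) (phi1 : forall n t, `|phi_ n t| <= 1).
Notation nu := (uniform_prob (noise_lt eps)).
Notation ep := (eps%:num).
Hypothesis cons0 : forall w om, - ep <= w <= ep -> noise_at 0 (cons w om) = w.
Hypothesis consS : forall w om (n : nat), noise_at n.+1 (cons w om) = noise_at n om.
Hypothesis cons_law : forall f : Omega eps -> \bar R, measurable_fun setT f ->
  (forall om, 0 <= f om)%E ->
  (\int[P]_om f om = \int[nu]_w \int[P]_om f (cons w om))%E.
Hypothesis cons_meas : forall f : Omega eps -> \bar R, measurable_fun setT f ->
  (forall om, 0 <= f om)%E -> measurable_fun setT (fun w => \int[P]_om f (cons w om))%E.

Fixpoint Fn (n : nat) (om : Omega eps) (t : R) : R :=
  if n is m.+1 then Fw (noise_at m om) (Fn m om t) else t.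

(** [Fn] recurses on the last map applied; inserting a coordinate at time 0 peels off the first one,
    as an induction over initial measures requires. *)
Lemma Fn_cons n w om t : - ep <= w <= ep -> Fn n.+1 (cons w om) t = Fn n om (Fw w t).
Proof.
move=> wb; elim: n => [|n ih]; first by rewrite /= cons0.
have -> : Fn n.+2 (cons w om) t = Fw (noise_at n.+1 (cons w om)) (Fn n.+1 (cons w om) t) by [].
by rewrite ih consS.
Qed.

Lemma measurable_noise_at i : measurable_fun setT (@noise_at R eps i).
Proof.
move=> _ B' mB; rewrite setTI; apply: sub_sigma_algebra.
by exists i, B'.
Qed.

Lemma measurable_Fn n : measurable_fun [set: Omega eps * R] (fun z => Fn n z.1 z.2).
Proof.
elim: n => [|n ih]; first exact: measurable_snd.
rewrite /= /Fw.
apply: measurable_funD => //; apply: measurable_funM => //.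
apply: (measurableT_comp (f := Xi)); first by apply: continuous_measurable_fun; exact: cX.1.
apply: measurable_funD => //.
by apply: (measurableT_comp (measurable_noise_at _)).
Qed.

Lemma cper_Fn n om f : cper f -> cper (fun t => f (Fn n om t)).
Proof.
by elim: n f => // n ih f cf; apply: (ih (fun t => f (Fw _ t))); exact: cper_comp_Fw.
Qed.

(** Total variation distance of the two images after [n] steps, written as a countable supremum so
    that it is measurable in the noise. *)
Definition dist n J J' om : \bar R := ereal_sup (range (fun i : nat =>
  `|J (fun t => phi_ i (Fn n om t)) - J' (fun t => phi_ i (Fn n om t))|%:E)).

Definition mean_dist n J J' : \bar R := (\int[P]_om dist n J J' om)%E.

Lemma dist_ge0 n J J' om : (0 <= dist n J J' om)%E.
Proof.
apply: (@le_trans _ _ (`|J (fun t => phi_ 0 (Fn n om t)) - J' (fun t => phi_ 0 (Fn n om t))|%:E)).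
  by rewrite lee_fin.
by apply: ereal_sup_ubound; exists 0%N.
Qed.

Lemma mean_dist_ge0 n J J' : (0 <= mean_dist n J J')%E.
Proof. by apply: integral_ge0 => om _; exact: dist_ge0. Qed.

Lemma measurable_dist n J J' : state eps J -> state eps J' ->
  measurable_fun setT (dist n J J').
Proof.
move=> sJ sJ'; rewrite /dist.
have E om : dist n J J' om = esups (fun i =>
    `|J (fun t => phi_ i (Fn n om t)) - J' (fun t => phi_ i (Fn n om t))|%:E) 0.
  by rewrite /dist /esups /sdrop; congr ereal_sup; apply/seteqP; split => _ [i _ <-]; exists i.
rewrite (_ : (fun om => _) = fun om => esups (fun i =>
    `|J (fun t => phi_ i (Fn n om t)) - J' (fun t => phi_ i (Fn n om t))|%:E) 0); last first.
  by apply/funext => om; exact: E.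
apply: (measurable_fun_esups (f := fun i om =>
   `|J (fun t => phi_ i (Fn n om t)) - J' (fun t => phi_ i (Fn n om t))|%:E)).
move=> i; apply/measurable_EFinP; apply: measurableT_comp => //.
have mF : measurable_fun [set: Omega eps * R] (fun z => phi_ i (Fn n z.1 z.2)).
  apply: (measurableT_comp (f := phi_ i)); last exact: measurable_Fn.
  by apply: continuous_measurable_fun; exact: (cphi i).1.
have cF om : cper (fun t => phi_ i (Fn n om t)) by exact: cper_Fn.
apply: measurable_funB.
  exact: (st_meas sJ (Phi := fun om t => phi_ i (Fn n om t)) mF cF).
exact: (st_meas sJ' (Phi := fun om t => phi_ i (Fn n om t)) mF cF).
Qed.

Lemma st_norm1 J f : state eps J -> cper f -> (forall t, `|f t| <= 1) -> `|J f| <= mass J.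
Proof. by move=> sJ cf f1; rewrite -[leRHS]mul1r; exact: (st_norm sJ cf f1). Qed.

Lemma dist_sub n J J' (I : Type) (r : seq I) (K K' : I -> (R -> R) -> R) (r0 r1 : (R -> R) -> R) om :
  state eps r0 -> state eps r1 ->
  (forall f, cper f -> J f - J' f = \sum_(i <- r) (K i f - K' i f) + (r0 f - r1 f)) ->
  (dist n J J' om <= \sum_(i <- r) dist n (K i) (K' i) om + (mass r0 + mass r1)%:E)%E.
Proof.
move=> se se' H; apply: ub_ereal_sup => _ [i _ <-].
set f := fun t => _; have cf : cper f by apply: cper_Fn.
have f1 t : `|f t| <= 1 by exact: phi1.
rewrite H//; apply: (@le_trans _ _ (\sum_(i <- r) `|K i f - K' i f| + (mass r0 + mass r1))%:E).
  rewrite lee_fin (le_trans (ler_normD _ _))// lerD//; first exact: ler_norm_sum.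
  by rewrite (le_trans (ler_normB _ _))// lerD// st_norm1.
rewrite EFinD leeD2r// -sumEFin; apply: lee_sum => j _.
by apply: ereal_sup_ubound; exists i.
Qed.

(** Triangle inequality for a simultaneous splitting of two measures; the leftovers [r0] and [r1]
    cost only their masses, since the test functions are bounded by 1. *)
Lemma mean_dist_sub n J J' (I : Type) (r : seq I) (K K' : I -> (R -> R) -> R) (r0 r1 : (R -> R) -> R) :
  state eps J -> state eps J' -> state eps r0 -> state eps r1 ->
  (forall i, state eps (K i)) -> (forall i, state eps (K' i)) ->
  (forall f, cper f -> J f - J' f = \sum_(i <- r) (K i f - K' i f) + (r0 f - r1 f)) ->
  (mean_dist n J J' <= \sum_(i <- r) mean_dist n (K i) (K' i) + (mass r0 + mass r1)%:E)%E.
Proof.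
move=> sJ sJ' se se' sK sK' H; rewrite /mean_dist -ge0_integral_sum//; last 2 first.
  - by move=> i; exact: measurable_dist.
  - by move=> i om _; exact: dist_ge0.
have m0 : (0 <= (mass r0 + mass r1)%:E)%E by rewrite lee_fin addr_ge0// (@mass_ge0 R eps).
have -> : (mass r0 + mass r1)%:E = (\int[P]_om (cst (mass r0 + mass r1)%:E om))%E.
  by rewrite integral_cst//= -[LHS]mule1; congr (_ * _)%E; exact/esym/probability_setT.
have ms : measurable_fun setT (fun om => \sum_(i <- r) dist n (K i) (K' i) om)%E.
  by apply: emeasurable_sum => i; exact: measurable_dist.
rewrite -ge0_integralD//; last first.
  by move=> om _; apply: sume_ge0 => i _; exact: dist_ge0.
apply: ge0_le_integral => //.
- by move=> om _; exact: dist_ge0.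
- exact: measurable_dist.
- by apply: emeasurable_funD.
- by move=> om _; exact: dist_sub.
Qed.

Lemma mean_dist_eq n J J' K K' : (forall f, cper f -> J f - J' f = K f - K' f) ->
  mean_dist n J J' = mean_dist n K K'.
Proof.
move=> H; apply: eq_integral => om _; rewrite /dist; apply: (congr1 (fun f : nat -> \bar R => ereal_sup (range f))).
apply/funext => i; rewrite H//; exact: cper_Fn.
Qed.

Lemma mean_dist_le_mass n J J' : state eps J -> state eps J' ->
  (mean_dist n J J' <= (mass J + mass J')%:E)%E.
Proof.
move=> sJ sJ'.
have := @mean_dist_sub n J J' unit [::] (fun=> J) (fun=> J') J J' sJ sJ' sJ sJ'.
by rewrite !big_nil add0e; apply => // f _; rewrite big_nil add0r.
Qed.

(** Conditioning on the first noise variable: by [cons_law] the remaining noise has law [P]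
    again. *)
Lemma mean_dist_S_le n J J' (G : R -> \bar R) : state eps J -> state eps J' ->
  measurable_fun setT G -> (forall w, 0 <= G w)%E ->
  (forall w, - ep <= w <= ep -> (mean_dist n (push w J) (push w J') <= G w)%E) ->
  (mean_dist n.+1 J J' <= \int[nu]_w G w)%E.
Proof.
move=> sJ sJ' mG G0 HG; have md := measurable_dist n.+1 sJ sJ'.
have d0 om : (0 <= dist n.+1 J J' om)%E by exact: dist_ge0.
have mg := cons_meas md d0; have g0 w : (0 <= \int[P]_om dist n.+1 J J' (cons w om))%E.
  exact: integral_ge0.
rewrite /mean_dist cons_law// !integral_uniform//.
apply: lee_wpmul2l; first by rewrite lee_fin invr_ge0 subr_ge0 ltW// noise_lt.
apply: ge0_le_integral => //.
- exact: measurable_funTS.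
- exact: measurable_funTS.
- move=> w /=; rewrite in_itv/= => wb; apply: le_trans (HG w wb).
  rewrite le_eqVlt; apply/orP; left; apply/eqP; apply: eq_integral => om _.
  rewrite /dist; apply: (congr1 (fun f : nat -> \bar R => ereal_sup (range f))); apply/funext => i.
  have E : (fun t => phi_ i (Fn n.+1 (cons w om) t)) = (fun t => phi_ i (Fn n om (Fw w t))).
    by apply/funext => t; rewrite Fn_cons.
  by rewrite E.
Qed.

Lemma state_add J J' : state eps J -> state eps J' -> state eps (fun f => J f + J' f).
Proof.
move=> sJ sJ'; split.
- by move=> x y f g cf cg; rewrite (st_lin sJ)// (st_lin sJ')//; ring.
- by move=> f cf f0; rewrite addr_ge0//; [exact: (st_pos sJ)|exact: (st_pos sJ')].
- move=> d X Phi mP cP; apply: measurable_funD.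
    exact: (st_meas sJ mP cP).
  exact: (st_meas sJ' mP cP).
- move=> Phi b mP cP P01 cb H.
  rewrite EFinD -(st_fub sJ mP cP P01 cb H) -(st_fub sJ' mP cP P01 cb H).
  rewrite -ge0_integralD//.
  + move=> w _; rewrite lee_fin; apply: (st_pos sJ) => // t; by have /andP[] := P01 w t.
  + by apply/measurable_EFinP; exact: (st_meas sJ mP cP).
  + move=> w _; rewrite lee_fin; apply: (st_pos sJ') => // t; by have /andP[] := P01 w t.
  + by apply/measurable_EFinP; exact: (st_meas sJ' mP cP).
Qed.

Definition stscale b J : (R -> R) -> R := fun f => b * J f.

Lemma var_le_scale J V b : 0 <= b -> var_le J V -> var_le (stscale b J) (b * V).
Proof. by move=> b0 vb F f dF cf pF F1; rewrite ler_wpM2l//; apply: vb dF _ _ _. Qed.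

Lemma mass_le w i J : state eps J -> mass (shell w i J) <= mass J.
Proof.
move=> sJ; apply: (st_mono sJ); last first.
- by move=> t; rewrite mul1r; have /andP[] := chi01 i (t + w).
- exact: cper_cst.
- by apply: cperM; [exact: cper_cst|apply: cper_shift; exact: cper_chi_].
Qed.

(** Let shell [i] of [J] and shell [j] of [J'] have masses [mi] and [mj]. Scaling the first by
    [mj / m] and the second by [mi / m] gives both the mass [mi mj / m], so an estimate for measures
    of equal mass applies to every pair; the pair of shells 0 alone carries the gain [tau]. Summing
    over pairs restores each shell up to the fraction lost to the residual mass. *)
Lemma pair_bound n c d tau J J' w I (X Y : nat -> R) :
  state eps J -> state eps J' -> mass J = mass J' -> 0 < mass J ->
  0 <= c -> 0 <= d -> (forall i, 0 <= X i) -> (forall i, 0 <= Y i) ->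
  (forall i j : 'I_I.+1,
    (mean_dist n (stscale (mass (shell w j J') / mass J) (shell w i J))
          (stscale (mass (shell w i J) / mass J) (shell w j J')) <=
     (c * (mass (shell w j J') / mass J * X i + mass (shell w i J) / mass J * Y j) +
      (d * (mass (shell w i J) * mass (shell w j J') / mass J)
       - (if (i == ord0) && (j == ord0) then
           tau * (mass (shell w 0 J) * mass (shell w 0 J') / mass J) else 0)))%:E)%E) ->
  (mean_dist n (push w J) (push w J') <=
    (c * (\sum_(i < I.+1) X i + \sum_(i < I.+1) Y i) + d * mass J
     - tau * (mass (shell w 0 J) * mass (shell w 0 J') / mass J)
     + 2 * (mass (resid w I J) + mass (resid w I J')))%:E)%E.
Proof.
move=> sJ sJ' mE m0 c0 d0 X0 Y0 HU.
set m := mass J in m0 HU mE *.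
pose mi i := mass (shell w i J); pose mj i := mass (shell w i J').
have mi0 i : 0 <= mi i by apply: (@mass_ge0 R eps); exact: state_shell.
have mj0 i : 0 <= mj i by apply: (@mass_ge0 R eps); exact: state_shell.
set r := mass (resid w I J); set r' := mass (resid w I J').
have r0 : 0 <= r by apply: (@mass_ge0 R eps); exact: state_resid.
have r'0 : 0 <= r' by apply: (@mass_ge0 R eps); exact: state_resid.
have sm : \sum_(i < I.+1) mi i = m - r by rewrite /m (mass_split sJ w I) addrK.
have sm' : \sum_(i < I.+1) mj i = m - r' by rewrite mE (mass_split sJ' w I) addrK.
pose good K := jpush (Fw w) (fun t => lorC d1 (scale_ I) (t + w)) K.
have sgood K : state eps K -> state eps (good K).
  move=> sK; apply: state_push => //; first exact: cper_Fw.
    by apply: cper_shift; apply: cper_lorC => //; exact: scale_gt0.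
  by move=> t; apply: lorC01; exact: scale_gt0.
have goodE K f : state eps K -> cper f -> good K f = \sum_(i < I.+1) shell w i K f.
  move=> sK cf; rewrite -(st_sum sK); last first.
    by move=> i; apply: cperM; [exact: cper_comp_Fw|apply: cper_shift; exact: cper_chi_].
  congr K; apply/funext => t; rewrite -mulr_sumr sum_chi lorE ?scale_gt0// subKr//.
have iv0 : 0 <= m^-1 by rewrite invr_ge0 ltW.
(* The weights [mj / m] sum to [(m - r') / m] instead of 1; the missing fraction [r' / m] of the
   shells of [J] joins the residue. Altogether the leftovers weigh at most [2 (r + r')]. *)
pose rr0 := fun f => resid w I J f + r' / m * good J f.
pose rr1 := fun f => resid w I J' f + r / m * good J' f.
have srr0 : state eps rr0.
  apply: state_add; first exact: state_resid.
  by apply: state_scale; [exact: sgood|exact: mulr_ge0].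
have srr1 : state eps rr1.
  apply: state_add; first exact: state_resid.
  by apply: state_scale; [exact: sgood|exact: mulr_ge0].
have mg K : state eps K -> mass (good K) = \sum_(i < I.+1) mass (shell w i K).
  by move=> sK; rewrite /mass goodE//; exact: cper_cst.
have := @mean_dist_sub n (push w J) (push w J') _ (index_enum ('I_I.+1 * 'I_I.+1)%type)
  (fun p f => mj p.2 / m * shell w p.1 J f) (fun p f => mi p.1 / m * shell w p.2 J' f) rr0 rr1
  (state_push_w sJ w) (state_push_w sJ' w) srr0 srr1.
move=> /(_ _ _ _)/le_trans; apply.
- by move=> p; apply: state_scale; [exact: state_shell|exact: mulr_ge0].
- by move=> p; apply: state_scale; [exact: state_shell|exact: mulr_ge0].
- move=> f cf; rewrite (push_split sJ w I cf) (push_split sJ' w I cf) sumrB.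
  rewrite -(pair_bigA _ (fun i j : 'I_I.+1 => mj j / m * shell w i J f))/=.
  rewrite -(pair_bigA _ (fun i j : 'I_I.+1 => mi i / m * shell w j J' f))/= [X in _ - X + _]exchange_big/=.
  have e1 : \sum_(i < I.+1) \sum_(j < I.+1) mj j / m * shell w i J f = (m - r') / m * good J f.
    rewrite goodE// mulr_sumr; apply: eq_bigr => i _.
    by rewrite -!mulr_suml sm'.
  have e2 : \sum_(i < I.+1) \sum_(j < I.+1) mi j / m * shell w i J' f = (m - r) / m * good J' f.
    rewrite goodE// mulr_sumr; apply: eq_bigr => i _.
    by rewrite -!mulr_suml sm.
  rewrite e1 e2 /rr0 /rr1 -!goodE//; field; rewrite gt_eqF//.
apply: (@le_trans _ _ (\sum_(p : 'I_I.+1 * 'I_I.+1)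
   (c * (mj p.2 / m * X p.1 + mi p.1 / m * Y p.2) +
      (d * (mi p.1 * mj p.2 / m)
       - (if (p.1 == ord0) && (p.2 == ord0) then
           tau * (mi 0 * mj 0 / m) else 0)))%:E + (mass rr0 + mass rr1)%:E)%E).
  by apply: leeD2r; apply: lee_sum => p _; exact: HU.
rewrite sumEFin -EFinD lee_fin.
have -> : mass rr0 = r + r' / m * (m - r) by rewrite /rr0 /mass -/(mass _) -/(mass (good J)) mg// sm.
have -> : mass rr1 = r' + r / m * (m - r') by rewrite /rr1 /mass -/(mass _) -/(mass (good J')) mg// sm'.
rewrite big_split/= sumrB -mulr_sumr big_split/= -mulr_sumr.
rewrite -(pair_bigA _ (fun i j : 'I_I.+1 => mj j / m * X i))/=.
rewrite -(pair_bigA _ (fun i j : 'I_I.+1 => mi i / m * Y j))/= [X in c * (_ + X)]exchange_big/=.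
rewrite -(pair_bigA _ (fun i j : 'I_I.+1 => mi i * mj j / m))/=.
have -> : \sum_(i < I.+1) \sum_(j < I.+1) mj j / m * X i = (m - r') / m * \sum_(i < I.+1) X i.
  rewrite mulr_sumr; apply: eq_bigr => i _; by rewrite -!mulr_suml sm'.
have -> : \sum_(i < I.+1) \sum_(j < I.+1) mi j / m * Y i = (m - r) / m * \sum_(i < I.+1) Y i.
  rewrite mulr_sumr; apply: eq_bigr => i _; by rewrite -!mulr_suml sm.
have -> : \sum_(i < I.+1) \sum_(j < I.+1) mi i * mj j / m = (m - r) * (m - r') / m.
  under eq_bigr do rewrite -mulr_suml -mulr_sumr.
  by rewrite -!mulr_suml sm sm'.
rewrite [X in d * _ - X](_ : _ = tau * (mi 0%N * mj 0%N / m)); last first.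
  rewrite (bigD1 (ord0, ord0))//= big1 ?addr0// => -[i j].
  by rewrite xpair_eqE /= => /negbTE ->.
have rm : r <= m by rewrite -subr_ge0 -sm sumr_ge0.
have rm' : r' <= m by rewrite -subr_ge0 -sm' sumr_ge0.
have f1 : (m - r') / m * \sum_(i < I.+1) X i <= \sum_(i < I.+1) X i.
  rewrite ler_piMl ?sumr_ge0// ler_pdivrMr// mul1r; lra.
have f2 : (m - r) / m * \sum_(i < I.+1) Y i <= \sum_(i < I.+1) Y i.
  rewrite ler_piMl ?sumr_ge0// ler_pdivrMr// mul1r; lra.
have f3 : (m - r) * (m - r') / m <= m.
  rewrite ler_pdivrMr//; apply: ler_pM; lra.
have f4 : r' / m * (m - r) <= r'.
  by rewrite mulrAC ler_pdivrMr// ler_wpM2l//; lra.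
have f5 : r / m * (m - r') <= r.
  by rewrite mulrAC ler_pdivrMr// ler_wpM2l//; lra.
have f6 := ler_wpM2l c0 (lerD f1 f2).
have f7 := ler_wpM2l d0 f3.
rewrite -/(mi 0%N) -/(mj 0%N); lra.
Qed.

(** * The cost functional and its contraction over one step *)

Variables (C1 u0 : R).
Local Notation Lc := (alpha * del).
(** An interval of length [2 eps] is covered by about [2 eps M + 1] windows, each contributing at
    most [del * C0] at scale [del]; dividing by [2 eps] gives this mean. It stays bounded only if
    [del] is at most of order [eps]. *)
Definition noise_const := del * C0 k h * (M%:R + (2 * ep)^-1).
Hypotheses (del1 : del <= 1) (HC1 : 1 + 16 * noise_const <= C1) (HL : 32 * C1 ^+ 3 <= Lc).
(** The distortion of shell 0 is [u0^4 m], and [u0] is the value of [u] at which [u0^4 m / u^3]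
    equals [u m]: a floor below which lowering [u] no longer pays. *)
Hypotheses (u00 : 0 < u0) (u0E : u0 ^+ 4 = 2 * B / (Lc * del)).
Local Notation K' := ((C1 + 2) * u0).

Lemma noise_const_ge0 : 0 <= noise_const.
Proof.
have D0 := del0; rewrite /noise_const mulr_ge0//; first by rewrite mulr_ge0 ?(ltW D0)// C0_ge0// h_gt0.
Qed.

Lemma C1_ge1 : 1 <= C1.
Proof. by have := noise_const_ge0; have := HC1; lra. Qed.

Lemma mean_resid J i : state eps J ->
  (\int[nu]_w (mass (resid w i J))%:E <= (noise_const / 16 ^+ i * mass J)%:E)%E.
Proof.
move=> sJ; have cl := cper_lor c1 (scale_gt0 i).
have [L dL] := primitive_exists cl.1.
have := state_wavg sJ dL cl (fun t => lor01 d1 t (scale_gt0 i)).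
rewrite (_ : (fun w => _) = (fun w => (mass (resid w i J))%:E)); last first.
  by apply/funext => w; congr (J _)%:E; apply/funext => t; rewrite mul1r.
move=> ->; rewrite lee_fin; apply: (st_le sJ); first exact: cper_wavg cl.
have p16 : 0 < 16 ^+ i :> R by rewrite exprn_gt0.
have e01 : 0 < scale_ i <= 1.
  rewrite scale_gt0/= /scale_ ler_pdivrMr// mul1r (le_trans del1)//.
  by rewrite exprn_ege1// ler1n.
move=> t; rewrite /wavg.
have ep0 : 0 < ep by [].
have ep2 : 0 <= 2 * ep by rewrite mulr_ge0.
have := @lor_interval R d1 d2 dd1 k h k0 h_gt0 ck (scale_ i) L (t - ep) (2 * ep) e01 dL ep2.
have -> : t - ep + 2 * ep = t + ep by ring.
rewrite opprK -mulr2n -[ep *+ 2]mulr_natl invrK => H.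
rewrite ler_pdivrMl ?mulr_gt0//; apply: (le_trans H).
rewrite le_eqVlt; apply/orP; left; apply/eqP; rewrite /noise_const /scale_.
by field; rewrite !gt_eqF.
Qed.

(* The minimum over [u] of [u * m + V / u ^ 3] is of order [m ^ (3/4) * V ^ (1/4)]:
   the variation [V] enters concavely, so the rare shells of weak expansion do not
   destroy the contraction in mean. *)
Definition cost (m V u : R) := u * m + V / u ^+ 3.

(** Every [u >= u0] is allowed instead of the minimising one: the bound is then linear in mass and
    variation, can be summed over shells and averaged over the noise, and the optimisation becomes
    an explicit choice of [u] for each shell. *)
Definition decay_claim n (c d : R) := forall J J' V V' u u',
  state eps J -> state eps J' -> mass J = mass J' -> var_le J V -> var_le J' V' ->
  u0 <= u -> u0 <= u' ->
  (mean_dist n J J' <= (c * (cost (mass J) V u + cost (mass J') V' u') + d * mass J)%:E)%E.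

(** The factor [8^i] enters cubed against the variation and so outweighs the loss of expansion, yet
    it loses to the mean mass [16^-i] of the shell. Dividing [u] by [2 C1] halves the mass part of
    the cost after averaging, and [u0] keeps the value above the floor. *)
Definition shell_u (u : R) (i : nat) := 8 ^+ i * (u0 + u / (2 * C1)).
Definition shell_var (m V : R) (i : nat) := V / (alpha * scale_ i) + 2 * B / (alpha * scale_ i ^+ 2) * m.

Lemma shell_u_ge u i : u0 <= u -> u0 <= shell_u u i.
Proof.
move=> uu; have c := C1_ge1; have U := u00.
have e8 : 1 <= 8 ^+ i :> R by rewrite exprn_ege1// ler1n.
have : 0 <= u / (2 * C1) by rewrite divr_ge0//; lra.
rewrite /shell_u => p; apply: (@le_trans _ _ (1 * (u0 + u / (2 * C1)))); first lra.
by apply: ler_wpM2r => //; lra.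
Qed.

Definition shell_cost (J : (R -> R) -> R) (V u w : R) (i : nat) :=
  cost (mass (shell w i J)) (shell_var (mass J) V i) (shell_u u i).

Definition total_cost (J : (R -> R) -> R) (V u w : R) (I : nat) :=
  (u0 + u / (2 * C1)) * (mass J + \sum_(i < I) 8 ^+ i.+1 * mass (resid w i J))
  + V / (2 * u ^+ 3) + 2 * u0 * mass J.

Lemma geo_half (n : nat) : \sum_(i < n) (2^-1 : R) ^+ i <= 2.
Proof.
suff : \sum_(i < n) (2^-1 : R) ^+ i = 2 - 2 * 2^-1 ^+ n.
  by move=> ->; rewrite gerBl mulr_ge0// exprn_ge0// invr_ge0.
elim: n => [|n ih]; first by rewrite big_ord0 expr0; ring.
by rewrite big_ord_recr/= ih exprS; field.
Qed.

Lemma shell_cost_ge0 J V u w i : state eps J -> var_le J V -> u0 <= u -> 0 <= shell_cost J V u w i.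
Proof.
move=> sJ vb uu; have V0 := var_le_ge0 sJ vb; have m0 := mass_ge0 sJ.
have U := lt_le_trans u00 (shell_u_ge i uu).
rewrite /shell_cost /cost addr_ge0//.
  by rewrite mulr_ge0 ?(ltW U)// (@mass_ge0 R eps)//; exact: state_shell.
rewrite divr_ge0 ?exprn_ge0 ?(ltW U)// /shell_var.
have A0 := alpha0; have s0 := scale_gt0 i; have BB := B0.
apply: addr_ge0.
  by apply: divr_ge0 => //; apply: mulr_ge0; exact: ltW.
apply: mulr_ge0 => //; apply: divr_ge0; first by apply: mulr_ge0 => //; exact: ltW.
by apply: mulr_ge0; [exact: ltW|apply: exprn_ge0; exact: ltW].
Qed.

Lemma pow16 (i : nat) : (16 : R) ^+ i = (2 ^+ i) ^+ 4.
Proof. by rewrite -exprM mulnC exprM; congr (_ ^+ _); ring. Qed.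

Lemma pow8 (i : nat) : (8 : R) ^+ i = (2 ^+ i) ^+ 3.
Proof. by rewrite -exprM mulnC exprM; congr (_ ^+ _); ring. Qed.

Lemma cube_shell_u u i (y : R) : 0 <= y -> y <= u0 + u / (2 * C1) ->
  y ^+ 3 * (2 ^+ i) ^+ 9 <= shell_u u i ^+ 3.
Proof.
move=> y0 yz; have e : ((2 ^+ i) ^+ 3) ^+ 3 = (2 ^+ i) ^+ 9 :> R by rewrite -exprM.
rewrite /shell_u exprMn pow8 e mulrC; apply: ler_wpM2l; first by rewrite !exprn_ge0.
by rewrite lerXn2r// nnegrE (le_trans y0).
Qed.

(** With [y = 2^i], the scales go like [y^-4] and [shell_u] like [y^3]. The old variation
    contributes [y^4 / y^9] and the distortion [y^8 / y^9], both at most [1 / y], hence geometric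
    series. The mass terms are left as they are, because only their noise average is small. *)
Lemma sum_shell_cost J V u w I : state eps J -> var_le J V -> u0 <= u ->
  \sum_(i < I.+1) shell_cost J V u w i <= total_cost J V u w I.
Proof.
move=> sJ vb uu; have V0 := var_le_ge0 sJ vb; have m0 := mass_ge0 sJ.
have U := u00; have u_0 : 0 < u by exact: lt_le_trans uu.
have c := C1_ge1; have A0 := alpha0; have D0 := del0; have BB := B0; have HL' := HL.
have L0 : 0 < Lc by rewrite mulr_gt0.
set s := u / (2 * C1); have s0 : 0 < s by rewrite divr_gt0// mulr_gt0//; lra.
rewrite /shell_cost /cost /total_cost -/s big_split/= -addrA lerD//.
  rewrite big_ord_recl/= mulrDr mulr_sumr lerD//.
    rewrite /shell_u expr0 mul1r -/s ler_wpM2l//; first lra.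
    exact: mass_le.
  apply: ler_sum => i _; rewrite /bump/= /shell_u -/s add1n.
  rewrite [8 ^+ _ * (_ + _)]mulrC -mulrA; apply: ler_wpM2l; first lra.
  apply: ler_wpM2l; first by rewrite exprn_ge0.
  exact: mass_shell_le.
(* The [1/4] comes from [32 * C1^3 <= alpha * del], which beats by 4 the factor [8 * C1^3] produced
   by the cube of [u / (2 C1)]; the series then sums to at most [V / (2 u^3)]. *)
have key (i : nat) : shell_var (mass J) V i / shell_u u i ^+ 3 <=
    V / (4 * u ^+ 3) * 2^-1 ^+ i + u0 * mass J * 2^-1 ^+ i.
  rewrite exprVn; pose y : R := 2 ^+ i; rewrite -/y.
  have y0 : 0 < y by rewrite exprn_gt0.
  have y1 : 1 <= y by rewrite exprn_ege1// ler1n.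
  rewrite /shell_var mulrDl lerD//.
    have E1 : V / (alpha * scale_ i) = V * y ^+ 4 / Lc.
      by rewrite /scale_ pow16 -/y; field; rewrite !gt_eqF// exprn_gt0.
    have E2 : s ^+ 3 * y ^+ 9 <= shell_u u i ^+ 3.
      by apply: cube_shell_u; rewrite -/s; lra.
    have p3 : 0 < s ^+ 3 * y ^+ 9 by rewrite mulr_gt0 ?exprn_gt0.
    have p4 := lt_le_trans p3 E2.
    rewrite ler_pdivrMr// E1.
    apply: (@le_trans _ _ (V / (4 * u ^+ 3) * y^-1 * (s ^+ 3 * y ^+ 9))); last first.
      by apply: ler_wpM2l => //; rewrite mulr_ge0 ?invr_ge0 ?(ltW y0)// divr_ge0// mulr_ge0// exprn_ge0// ltW.
    have -> : V / (4 * u ^+ 3) * y^-1 * (s ^+ 3 * y ^+ 9) = V * y ^+ 8 / (32 * C1 ^+ 3).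
      by rewrite /s; field; rewrite !gt_eqF//; lra.
    apply: ler_pM.
    - by rewrite mulr_ge0// exprn_ge0// ltW.
    - by rewrite invr_ge0 ltW.
    - by rewrite ler_wpM2l// ler_weXn2l.
    - by rewrite lef_pV2// posrE// mulr_gt0// exprn_gt0//; lra.
  have E1 : 2 * B / (alpha * scale_ i ^+ 2) = u0 ^+ 4 * y ^+ 8.
    rewrite u0E /scale_ pow16 -/y.
    by field; rewrite !gt_eqF// exprn_gt0.
  have E2 : u0 ^+ 3 * y ^+ 9 <= shell_u u i ^+ 3.
    by apply: cube_shell_u; rewrite -/s; lra.
  have p3 : 0 < u0 ^+ 3 * y ^+ 9 by rewrite mulr_gt0 ?exprn_gt0.
  have p4 := lt_le_trans p3 E2.
  rewrite ler_pdivrMr// E1.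
  apply: (@le_trans _ _ (u0 * mass J * y^-1 * (u0 ^+ 3 * y ^+ 9))); last first.
    by apply: ler_wpM2l => //; rewrite !mulr_ge0 ?invr_ge0 ?(ltW y0)// ltW.
  rewrite le_eqVlt; apply/orP; left; apply/eqP; field.
  by rewrite gt_eqF.
apply: (@le_trans _ _ (\sum_(i < I.+1) (V / (4 * u ^+ 3) * 2^-1 ^+ i + u0 * mass J * 2^-1 ^+ i))).
  by apply: ler_sum => i _; exact: key.
rewrite big_split/= -!mulr_sumr.
have g := geo_half I.+1.
have a1 : 0 <= V / (4 * u ^+ 3) by rewrite divr_ge0// mulr_ge0// exprn_ge0// ltW.
have a2 : 0 <= u0 * mass J by rewrite mulr_ge0// ltW.
have h1 := ler_wpM2l a1 g; have h2 := ler_wpM2l a2 g.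
have -> : V / (2 * u ^+ 3) = V / (4 * u ^+ 3) * 2 by field; rewrite gt_eqF.
lra.
Qed.

Lemma measurable_mass_resid J i : state eps J ->
  measurable_fun setT (fun w => mass (resid w i J)).
Proof.
move=> sJ; apply: (st_meas sJ (Phi := fun w t => 1 * lor d1 (scale_ i) (t + w))).
  apply: measurable_funM => //; apply: (measurableT_comp (f := lor d1 (scale_ i))).
    by apply: continuous_measurable_fun; apply: (cper_lor c1 (scale_gt0 i)).1.
  exact: measurable_funD.
by move=> w; apply: cperM; [exact: cper_cst|apply: cper_shift; exact: cper_lor (scale_gt0 i)].
Qed.

(** The part of the one-step bound that depends on the noise, isolated for averaging. *)
Definition wsum (J : (R -> R) -> R) (A : R) (I : nat) w :=
  \sum_(i < I) A * (8 ^+ i.+1 * mass (resid w i J)) + 2 * mass (resid w I J).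

Lemma wsum_ge0 J A I w : state eps J -> 0 <= A -> 0 <= wsum J A I w.
Proof.
move=> sJ A0; have r0 i : 0 <= mass (resid w i J).
  by apply: (@mass_ge0 R eps); exact: state_resid.
by rewrite addr_ge0 ?mulr_ge0// sumr_ge0// => i _; rewrite !mulr_ge0// exprn_ge0.
Qed.

Lemma measurable_wsum J A I : state eps J -> measurable_fun setT (wsum J A I).
Proof.
move=> sJ; apply: measurable_funD.
  apply: measurable_sum => i; apply: measurable_funM => //; apply: measurable_funM => //.
  exact: measurable_mass_resid.
by apply: measurable_funM => //; exact: measurable_mass_resid.
Qed.

(** [8^(i+1) / 16^i = 8 / 2^i] sums to at most 16. *)
Lemma mean_wsum J A I : state eps J -> 0 <= A ->
  (\int[nu]_w (wsum J A I w)%:E <= ((16 * noise_const * A + 2 * noise_const / 16 ^+ I) * mass J)%:E)%E.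
Proof.
move=> sJ A0; have r0 i w : 0 <= mass (resid w i J).
  by apply: (@mass_ge0 R eps); exact: state_resid.
have mr i : measurable_fun setT (fun w => (mass (resid w i J))%:E).
  by apply/measurable_EFinP; exact: measurable_mass_resid.
rewrite /wsum; under eq_integral do rewrite EFinD -sumEFin.
rewrite ge0_integralD//; last 4 first.
- by move=> w _; apply: sume_ge0 => i _; rewrite lee_fin !mulr_ge0// exprn_ge0.
- apply: emeasurable_sum => i; apply/measurable_EFinP.
  apply: measurable_funM => //; apply: measurable_funM => //; exact: measurable_mass_resid.
- by move=> w _; rewrite lee_fin mulr_ge0.
- by apply/measurable_EFinP; apply: measurable_funM => //; exact: measurable_mass_resid.
rewrite ge0_integral_sum//; last 2 first.
- move=> i; apply/measurable_EFinP; apply: measurable_funM => //.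
  by apply: measurable_funM => //; exact: measurable_mass_resid.
- by move=> i w _; rewrite lee_fin !mulr_ge0// exprn_ge0.
have intZ (b : R) i : 0 <= b -> (\int[nu]_w (b * mass (resid w i J))%:E <=
    (b * (noise_const / 16 ^+ i * mass J))%:E)%E.
  move=> b0; under eq_integral do rewrite EFinM.
  rewrite ge0_integralZl//; last 2 first.
  - exact: mr.
  - by move=> w _; rewrite lee_fin.
  by rewrite EFinM lee_wpmul2l ?lee_fin//; exact: mean_resid.
apply: (@le_trans _ _ ((\sum_(i < I) (A * 8 ^+ i.+1 * (noise_const / 16 ^+ i * mass J)))%:E +
   (2 * (noise_const / 16 ^+ I * mass J))%:E)%E).
  apply: leeD; last exact: intZ.
  rewrite -sumEFin; apply: lee_sum => i _.
  under eq_integral do rewrite mulrA.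
  by apply: intZ; rewrite mulr_ge0// exprn_ge0.
rewrite -EFinD lee_fin.
rewrite [leRHS]mulrDl; apply: lerD; last by rewrite le_eqVlt; apply/orP; left; apply/eqP; ring.
have m0 := mass_ge0 sJ; have cav := noise_const_ge0.
rewrite [X in X <= _](_ : _ = (8 * noise_const * A * mass J) * \sum_(i < I) 2^-1 ^+ i); last first.
  rewrite mulr_sumr; apply: eq_bigr => i _.
  by rewrite exprS pow16 pow8 exprVn; field; rewrite gt_eqF// exprn_gt0.
have p : 0 <= 8 * noise_const * A * mass J by rewrite mulr_ge0// mulr_ge0// mulr_ge0.
have := ler_wpM2l p (geo_half I); lra.
Qed.

Lemma mean_dist_mass0 n J J' : state eps J -> state eps J' -> mass J = mass J' -> mass J = 0 ->
  (mean_dist n J J' <= 0)%E.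
Proof.
by move=> sJ sJ' mE m0; have := mean_dist_le_mass n sJ sJ'; rewrite -mE m0 addr0.
Qed.

(** Lets the number [I] of shells tend to infinity, the mean residual mass being of order
    [16^-I]. *)
Lemma le_of_geo (x y z : R) : 0 <= z -> (forall I : nat, x <= y + z / 16 ^+ I) -> x <= y.
Proof.
move=> z0 H; apply/ler_addgt0Pr => e e0.
pose I := Num.truncn (z / e).
have ze : 0 <= z / e by rewrite divr_ge0// ltW.
apply: (le_trans (H I)); rewrite lerD2l ler_pdivrMr ?exprn_gt0// mulrC -ler_pdivrMr//.
have /andP[_ /ltW] := truncn_itv ze; move=> /le_trans; apply.
rewrite -natrX ler_nat; exact: ltn_expl.
Qed.

(** The noise average of [pair_bound]. By [1 + 16 * noise_const <= C1] the part [u / (2 C1)] of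
    [shell_u] yields [u m / 2], so the cost is halved; the terms in [u0] yield [(C1 + 2) u0 m] for
    each measure, hence [2 K' c m]. The pair of shells 0 keeps its gain [tau * theta]. *)
Lemma step_claim n c d tau theta J J' V V' u u' : 0 <= c -> 0 <= d -> 0 <= tau -> 0 <= theta ->
  decay_claim n c d ->
  state eps J -> state eps J' -> mass J = mass J' -> var_le J V -> var_le J' V' ->
  u0 <= u -> u0 <= u' -> tau * theta <= d ->
  (forall w, - ep <= w <= ep -> 0 < mass J ->
     theta * mass J <= mass (shell w 0 J) * mass (shell w 0 J') / mass J) ->
  (forall w, - ep <= w <= ep -> 0 < mass J ->
     (mean_dist n (stscale (mass (shell w 0 J') / mass J) (shell w 0 J))
          (stscale (mass (shell w 0 J) / mass J) (shell w 0 J')) <=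
     (c * (mass (shell w 0 J') / mass J * shell_cost J V u w 0 + mass (shell w 0 J) / mass J * shell_cost J' V' u' w 0) +
      (d - tau) * (mass (shell w 0 J) * mass (shell w 0 J') / mass J))%:E)%E) ->
  (mean_dist n.+1 J J' <= (c / 2 * (cost (mass J) V u + cost (mass J') V' u') +
     (d + 2 * K' * c - tau * theta) * mass J)%:E)%E.
Proof.
move=> c0 d0 tau0 th0 HU sJ sJ' mE vb vb' uu uu' tth Hth H00.
have [m0|mn0] := ltP 0 (mass J); last first.
  have m0 : mass J = 0 by apply/eqP; rewrite eq_le mn0 (mass_ge0 sJ).
  apply: (le_trans (mean_dist_mass0 _ sJ sJ' mE m0)); rewrite lee_fin -mE m0 /cost !mulr0 !add0r addr0.
  have up : 0 < u by exact: lt_le_trans uu.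
  have up' : 0 < u' by exact: lt_le_trans uu'.
  have V0 := var_le_ge0 sJ vb; have V'0 := var_le_ge0 sJ' vb'.
  rewrite mulr_ge0 ?divr_ge0// addr_ge0// divr_ge0// exprn_ge0//; exact: ltW.
have cC := C1_ge1; have U := u00; have V0 := var_le_ge0 sJ vb; have V'0 := var_le_ge0 sJ' vb'.
have up : 0 < u by exact: lt_le_trans uu.
have up' : 0 < u' by exact: lt_le_trans uu'.
pose A := c * (u0 + u / (2 * C1)); pose A' := c * (u0 + u' / (2 * C1)).
have A0 : 0 <= A by rewrite mulr_ge0// addr_ge0// ?(ltW U)// divr_ge0//; lra.
have A'0 : 0 <= A' by rewrite mulr_ge0// addr_ge0// ?(ltW U)// divr_ge0//; lra.
(* Everything that does not depend on the noise; the rest is two copies of [wsum]. *)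
pose D := (A + c * 2 * u0) * mass J + c * (V / (2 * u ^+ 3)) +
  ((A' + c * 2 * u0) * mass J' + c * (V' / (2 * u' ^+ 3))) + (d - tau * theta) * mass J.
have D0 : 0 <= D.
  have q1 : 0 <= c * (V / (2 * u ^+ 3)).
    by rewrite mulr_ge0// divr_ge0// mulr_ge0// exprn_ge0// ltW.
  have q2 : 0 <= c * (V' / (2 * u' ^+ 3)).
    by rewrite mulr_ge0// divr_ge0// mulr_ge0// exprn_ge0// ltW.
  have q3 : 0 <= (A + c * 2 * u0) * mass J.
    by rewrite mulr_ge0// ?(ltW m0)// addr_ge0// !mulr_ge0// ltW.
  have q4 : 0 <= (A' + c * 2 * u0) * mass J'.
    by rewrite -mE mulr_ge0// ?(ltW m0)// addr_ge0// !mulr_ge0// ltW.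
  have q5 : 0 <= (d - tau * theta) * mass J by rewrite mulr_ge0// ?(ltW m0)// subr_ge0.
  by rewrite /D; lra.
have main I : (mean_dist n.+1 J J' <= (D + (16 * noise_const * A + 2 * noise_const / 16 ^+ I) * mass J +
    (16 * noise_const * A' + 2 * noise_const / 16 ^+ I) * mass J')%:E)%E.
  pose G w := (D + wsum J A I w + wsum J' A' I w)%:E.
  have mw := measurable_wsum A I sJ; have mw' := measurable_wsum A' I sJ'.
  have wp w := wsum_ge0 I w sJ A0; have wp' w := wsum_ge0 I w sJ' A'0.
  apply: (@le_trans _ _ (\int[nu]_w G w)%E).
    apply: mean_dist_S_le => //.
    - by apply/measurable_EFinP; apply: measurable_funD => //; apply: measurable_funD.
    - by move=> w; rewrite /G lee_fin addr_ge0// addr_ge0.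
    move=> w wb.
    have := @pair_bound n c d tau J J' w I (shell_cost J V u w) (shell_cost J' V' u' w) sJ sJ' mE m0 c0 d0
      (fun i => shell_cost_ge0 w i sJ vb uu) (fun i => shell_cost_ge0 w i sJ' vb' uu') _.
    move=> /(_ _)/le_trans; apply.
      move=> i j.
      have mi : 0 <= mass (shell w i J) by apply: (@mass_ge0 R eps); exact: state_shell.
      have mj : 0 <= mass (shell w j J') by apply: (@mass_ge0 R eps); exact: state_shell.
      case: ifPn => [/andP[/eqP -> /eqP ->]|_].
        by apply: (le_trans (H00 w wb m0)); rewrite lee_fin mulrBl addrA.
      have si := state_scale (state_shell sJ w i) (divr_ge0 mj (ltW m0)).
      have sj := state_scale (state_shell sJ' w j) (divr_ge0 mi (ltW m0)).
      have vi : var_le (shell w i J) (shell_var (mass J) V i) := var_le_shell sJ w i vb.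
      have vj : var_le (shell w j J') (shell_var (mass J') V' j) := var_le_shell sJ' w j vb'.
      have := HU _ _ _ _ _ _ si sj _ (var_le_scale (divr_ge0 mj (ltW m0)) vi)
         (var_le_scale (divr_ge0 mi (ltW m0)) vj) (shell_u_ge i uu) (shell_u_ge j uu').
      move=> /(_ _)/le_trans; apply.
        by rewrite /mass /= -/(mass _) -/(mass (shell w j J')); field; rewrite gt_eqF.
      rewrite lee_fin subr0 le_eqVlt; apply/orP; left; apply/eqP.
      rewrite /shell_cost /cost /mass /= -/(mass (shell w i J)) -/(mass (shell w j J')) -/(mass J) -/(mass J').
      have gi := lt_le_trans U (shell_u_ge i uu); have gj := lt_le_trans U (shell_u_ge j uu').
      by field; rewrite !gt_eqF.
    rewrite lee_fin.
    have t1 := ler_wpM2l c0 (sum_shell_cost w I sJ vb uu); have t2 := ler_wpM2l c0 (sum_shell_cost w I sJ' vb' uu').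
    have t3 := ler_wpM2l tau0 (Hth w wb m0).
    rewrite /D /wsum -!mulr_sumr.
    rewrite /total_cost in t1 t2; rewrite /A /A'; lra.
  rewrite /G; under eq_integral do rewrite EFinD EFinD.
  rewrite ge0_integralD//; last 4 first.
  - by move=> w _; rewrite -EFinD lee_fin addr_ge0.
  - by apply/measurable_EFinP; apply: measurable_funD.
  - by move=> w _; rewrite lee_fin.
  - exact/measurable_EFinP.
  rewrite ge0_integralD//; last 2 first.
  - by move=> w _; rewrite lee_fin.
  - exact/measurable_EFinP.
  rewrite !EFinD; apply: leeD; last exact: mean_wsum.
  apply: leeD; last exact: mean_wsum.
  by rewrite integral_cst//= -[leRHS]mule1 lee_wpmul2l ?lee_fin// probability_le1.
have fA : (mean_dist n.+1 J J' \is a fin_num).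
  by rewrite ge0_fin_numE ?mean_dist_ge0//; apply: (le_lt_trans (main 0%N)); rewrite ltry.
rewrite -(fineK fA) lee_fin.
have cav := noise_const_ge0.
apply: (@le_of_geo _ _ (2 * noise_const * mass J + 2 * noise_const * mass J')).
  by have mm := ltW m0; rewrite -mE addr_ge0// mulr_ge0// mulr_ge0.
move=> I; have := main I; rewrite -(fineK fA) lee_fin => /le_trans; apply.
have HC := HC1; rewrite -!mE in D0 *; rewrite /D -mE.
have e1 : (A + 16 * noise_const * A) * mass J <= (c * C1 * u0 + c * u / 2) * mass J.
  rewrite ler_pM2r//.
  have -> : A + 16 * noise_const * A = (1 + 16 * noise_const) * A by ring.
  apply: (le_trans (ler_wpM2r A0 HC)); rewrite /A le_eqVlt; apply/orP; left; apply/eqP.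
  by field; rewrite gt_eqF//; lra.
have e2 : (A' + 16 * noise_const * A') * mass J <= (c * C1 * u0 + c * u' / 2) * mass J.
  rewrite ler_pM2r//.
  have -> : A' + 16 * noise_const * A' = (1 + 16 * noise_const) * A' by ring.
  apply: (le_trans (ler_wpM2r A'0 HC)); rewrite /A' le_eqVlt; apply/orP; left; apply/eqP.
  by field; rewrite gt_eqF//; lra.
rewrite /cost.
have -> : V / (2 * u ^+ 3) = V / u ^+ 3 / 2 by field; rewrite gt_eqF.
have -> : V' / (2 * u' ^+ 3) = V' / u' ^+ 3 / 2 by field; rewrite gt_eqF.
lra.
Qed.

Lemma K'_ge0 : 0 <= K'.
Proof. by have := C1_ge1; have := u00 => U c; rewrite mulr_ge0 ?(ltW U)//; lra. Qed.

Lemma cost_ge0 J V u : state eps J -> var_le J V -> u0 <= u -> 0 <= cost (mass J) V u.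
Proof.
move=> sJ vb uu; have U := lt_le_trans u00 uu; have V0 := var_le_ge0 sJ vb; have m0 := mass_ge0 sJ.
apply: addr_ge0; first by apply: mulr_ge0 => //; exact: ltW.
by apply: divr_ge0 => //; apply: exprn_ge0; exact: ltW.
Qed.

Lemma Uclaim0 n : decay_claim n 0 2.
Proof.
move=> J J' V V' u u' sJ sJ' mE vb vb' uu uu'.
by apply: (le_trans (mean_dist_le_mass n sJ sJ')); rewrite lee_fin -mE mul0r add0r; lra.
Qed.

Lemma decay_claim_mono n c d c' d' : c <= c' -> d <= d' -> decay_claim n c d -> decay_claim n c' d'.
Proof.
move=> cc dd HU J J' V V' u u' sJ sJ' mE vb vb' uu uu'.
apply: (le_trans (HU _ _ _ _ _ _ sJ sJ' mE vb vb' uu uu')).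
rewrite lee_fin lerD//; first by rewrite ler_wpM2r// addr_ge0// cost_ge0.
by rewrite ler_wpM2r// (mass_ge0 sJ).
Qed.

Lemma pair00_decay_claim n c d J J' V V' u u' w : decay_claim n c d ->
  state eps J -> state eps J' -> mass J = mass J' -> var_le J V -> var_le J' V' ->
  u0 <= u -> u0 <= u' -> 0 < mass J ->
  (mean_dist n (stscale (mass (shell w 0 J') / mass J) (shell w 0 J))
          (stscale (mass (shell w 0 J) / mass J) (shell w 0 J')) <=
     (c * (mass (shell w 0 J') / mass J * shell_cost J V u w 0 + mass (shell w 0 J) / mass J * shell_cost J' V' u' w 0) +
      d * (mass (shell w 0 J) * mass (shell w 0 J') / mass J))%:E)%E.
Proof.
move=> HU sJ sJ' mE vb vb' uu uu' m0.
have mi : 0 <= mass (shell w 0 J) by apply: (@mass_ge0 R eps); exact: state_shell.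
have mj : 0 <= mass (shell w 0 J') by apply: (@mass_ge0 R eps); exact: state_shell.
have si := state_scale (state_shell sJ w 0) (divr_ge0 mj (ltW m0)).
have sj := state_scale (state_shell sJ' w 0) (divr_ge0 mi (ltW m0)).
have vi : var_le (shell w 0 J) (shell_var (mass J) V 0) := var_le_shell sJ w 0 vb.
have vj : var_le (shell w 0 J') (shell_var (mass J') V' 0) := var_le_shell sJ' w 0 vb'.
have := HU _ _ _ _ _ _ si sj _ (var_le_scale (divr_ge0 mj (ltW m0)) vi)
   (var_le_scale (divr_ge0 mi (ltW m0)) vj) (shell_u_ge 0 uu) (shell_u_ge 0 uu').
move=> /(_ _)/le_trans; apply.
  by rewrite /mass /= -/(mass _) -/(mass (shell w 0 J')); field; rewrite gt_eqF.
rewrite lee_fin le_eqVlt; apply/orP; left; apply/eqP.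
rewrite /shell_cost /cost /mass /= -/(mass (shell w 0 J)) -/(mass (shell w 0 J')) -/(mass J) -/(mass J').
have gi := lt_le_trans u00 (shell_u_ge 0 uu); have gj := lt_le_trans u00 (shell_u_ge 0 uu').
by field; rewrite !gt_eqF.
Qed.

Lemma decay_claim_S n c d : 0 <= c -> 0 <= d -> decay_claim n c d -> decay_claim n.+1 (c / 2) (d + 2 * K' * c).
Proof.
move=> c0 d0 HU J J' V V' u u' sJ sJ' mE vb vb' uu uu'.
have := @step_claim n c d 0 0 J J' V V' u u' c0 d0 (lexx 0) (lexx 0) HU sJ sJ' mE vb vb' uu uu'.
rewrite (mul0r (0 : R)) !subr0; apply => // w wb m0.
  rewrite mul0r mulr_ge0 ?invr_ge0 ?(ltW m0)// mulr_ge0// (@mass_ge0 R eps)//; exact: state_shell.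
by exact: pair00_decay_claim.
Qed.

(** [c] halves at each step while [d] grows by [2 K'] times the current [c], a geometric series
    bounded by [4 K' c]. *)
Lemma decay_claim_iter N n c d : 0 <= c -> 0 <= d -> decay_claim n c d ->
  decay_claim (n + N) (c / 2 ^+ N) (d + 4 * K' * c * (1 - (2 ^+ N)^-1)).
Proof.
move=> c0 d0 HU; have K0 := K'_ge0.
have p N' : 1 <= 2 ^+ N' :> R by rewrite exprn_ege1// ler1n.
elim: N => [|N ih].
  by rewrite addn0 !expr0 invr1 subrr mulr0 addr0 mulr1.
rewrite addnS; have := p N; have i1 : (2 ^+ N : R)^-1 <= 1.
  by rewrite invf_le1// (lt_le_trans ltr01).
move=> pN; have pp : 0 < 2 ^+ N :> R by rewrite (lt_le_trans ltr01).
have a1 : 0 <= c / 2 ^+ N by rewrite divr_ge0// ltW.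
have a2 : 0 <= d + 4 * K' * c * (1 - (2 ^+ N)^-1).
  by rewrite addr_ge0// !mulr_ge0// ?subr_ge0//; [have := C1_ge1; lra|exact: ltW].
have := decay_claim_S a1 a2 ih; congr decay_claim.
  by rewrite exprS; field; rewrite gt_eqF.
by rewrite exprS; field; rewrite gt_eqF.
Qed.

(* [tau] records how much of the mass is certain to be coupled. *)
Definition gain_claim n (cc l c d tau : R) := forall J J' V V' u u' s s',
  state eps J -> state eps J' -> mass J = mass J' -> var_le J V -> var_le J' V' ->
  u0 <= u -> u0 <= u' -> density_ge J (cc * mass J) s l -> density_ge J' (cc * mass J') s' l ->
  (mean_dist n J J' <= (c * (cost (mass J) V u + cost (mass J') V' u') + (d - tau) * mass J)%:E)%E.

(** * Coupling through a common multiple of Lebesgue measure *)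

Lemma state_subLeb J c s : state eps J -> 0 <= c -> density_ge J c s 1 ->
  state eps (fun f => J f - c * junif 0 1 f).
Proof.
move=> sJ c0 lb; apply: state_sub => //.
  by apply: state_scale => //; apply: state_junif; exact: ler01.
by move=> f cf f0; exact: density_ge_full lb f cf f0.
Qed.

Lemma var_le_subLeb J c V : var_le J V -> var_le (fun f => J f - c * junif 0 1 f) V.
Proof.
move=> vb F f dF cf pF F1; rewrite (junifE ler01 dF cf.1).
by have := pF 0; rewrite add0r => ->; rewrite subrr mulr0 subr0; apply: vb dF cf pF F1.
Qed.

Lemma mass_junif : mass (@junif R 0 1) = 1.
Proof.
by rewrite /mass (junifE ler01 (@primitive_id R) (@cper_cst R 1).1) subr0.
Qed.

(** Both densities are at least [b = cc * m] on the whole circle, so [b] times Lebesgue measure is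
    removed from both: the difference is unchanged, the masses drop by the fraction [cc], and the
    variation bounds persist because Lebesgue measure kills derivatives of periodic functions. *)
Lemma gain_claim_full n cc c d : 0 <= c -> 0 <= d -> 0 <= cc <= 1 -> decay_claim n c d -> gain_claim n cc 1 c d (cc * d).
Proof.
move=> c0 d0 /andP[cc0 cc1] HU J J' V V' u u' s s' sJ sJ' mE vb vb' uu uu' lb lb'.
have m0 := mass_ge0 sJ; have m'0 := mass_ge0 sJ'.
pose b := cc * mass J; have b0 : 0 <= b by rewrite mulr_ge0.
rewrite -mE in lb'.
pose K f := J f - b * junif 0 1 f; pose L f := J' f - b * junif 0 1 f.
have sK : state eps K by exact: state_subLeb lb.
have sL : state eps L by exact: state_subLeb lb'.
have mK : mass K = mass J - b by rewrite /K /mass -/(mass (@junif R 0 1)) mass_junif mulr1.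
have mL : mass L = mass J' - b by rewrite /L /mass -/(mass (@junif R 0 1)) mass_junif mulr1.
rewrite (@mean_dist_eq n J J' K L); last by move=> f _; rewrite /K /L; ring.
have mKL : mass K = mass L by rewrite mK mL mE.
have vK : var_le K V by exact: var_le_subLeb.
have vL : var_le L V' by exact: var_le_subLeb.
apply: (le_trans (HU K L V V' u u' sK sL mKL vK vL uu uu')).
rewrite lee_fin mK mL.
have up := lt_le_trans u00 uu; have up' := lt_le_trans u00 uu'.
have z1 : cost (mass J - b) V u <= cost (mass J) V u.
  by rewrite /cost lerD2r; apply: ler_wpM2l; [exact: ltW|lra].
have z2 : cost (mass J' - b) V' u' <= cost (mass J') V' u'.
  by rewrite /cost lerD2r; apply: ler_wpM2l; [exact: ltW|lra].
have := ler_wpM2l c0 (lerD z1 z2); rewrite /b; lra.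
Qed.

Hypotheses (aB : 1 <= 2 * alpha * B) (Lc6 : 6 <= Lc).

(** For the pair of shells 0, [density_ge_shell] lengthens the arcs from [l] to [l'] and divides the
    relative height by [2 alpha B]. Each shell 0 keeps at least the fraction [cc * l / 6] of the
    mass, and the pair its square, which multiplies [tau]; all other pairs use the plain claim. *)
Lemma gain_claim_S n cc l l' c d tau : 0 <= c -> 0 <= d -> 0 < cc -> 0 <= tau <= d -> cc * l / 6 <= 1 ->
  6 * del / k <= l <= h -> 0 <= l' <= alpha * k * l ^+ 2 / 18 ->
  decay_claim n c d -> gain_claim n (cc / (2 * alpha * B)) l' c d tau ->
  gain_claim n.+1 cc l (c / 2) (d + 2 * K' * c) (tau * (cc * l / 6) ^+ 2).
Proof.
move=> c0 d0 cc0 /andP[tau0 taud] cl1 lb1 l'1 HU HE J J' V V' u u' s s' sJ sJ' mE vb vb' uu uu' lb lb'.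
have m0 := mass_ge0 sJ; have m'0 := mass_ge0 sJ'.
have D0 := del0; have K0 := k0; have A0 := alpha0; have BB := B0.
have l0 : 0 < l.
  by have /andP[+ _] := lb1; apply: lt_le_trans; rewrite divr_gt0// mulr_gt0.
have th0 : 0 <= cc * l / 6 by rewrite divr_ge0// mulr_ge0// ltW.
have ccm : 0 <= cc * mass J by rewrite mulr_ge0// ltW.
have ccm' : 0 <= cc * mass J' by rewrite mulr_ge0// ltW.
have gr w := density_ge_shell w sJ ccm lb lb1.
have gr' w := density_ge_shell w sJ' ccm' lb' lb1.
apply: step_claim => //.
- exact: sqr_ge0.
- by apply: (le_trans _ taud); rewrite ler_piMr// expr2 mulr_ile1.
- move=> w wb mp; have [_ g1] := gr w; have [_ g2] := gr' w.
  rewrite ler_pdivlMr// -mE in g2 *.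
  have -> : (cc * l / 6) ^+ 2 * mass J * mass J = (cc * mass J * l / 6) * (cc * mass J * l / 6) by ring.
  by apply: ler_pM => //; rewrite divr_ge0// mulr_ge0// ltW.
move=> w wb mp.
have mi : 0 <= mass (shell w 0 J) by apply: (@mass_ge0 R eps); exact: state_shell.
have mj : 0 <= mass (shell w 0 J') by apply: (@mass_ge0 R eps); exact: state_shell.
have si := state_scale (state_shell sJ w 0) (divr_ge0 mj (ltW mp)).
have sj := state_scale (state_shell sJ' w 0) (divr_ge0 mi (ltW mp)).
have vi : var_le (shell w 0 J) (shell_var (mass J) V 0) := var_le_shell sJ w 0 vb.
have vj : var_le (shell w 0 J') (shell_var (mass J') V' 0) := var_le_shell sJ' w 0 vb'.
have [/(_ l' l'1)[v lv] _] := gr w; have [/(_ l' l'1)[v' lv'] _] := gr' w.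
have wk K b b' x : 0 <= b -> b <= b' -> density_ge K b' x l' -> density_ge K b x l'.
  move=> b0 bb lbK G g dG cg g0; apply: le_trans (lbK G g dG cg g0).
  apply: ler_wpM2r => //; rewrite subr_ge0; apply: (primitive_mono dG) => //.
  by rewrite lerDl; have /andP[] := l'1.
have aB0 : 0 < 2 * alpha * B by rewrite !mulr_gt0.
have mle := mass_le w 0 sJ; have mle' := mass_le w 0 sJ'.
have lb1' : density_ge (stscale (mass (shell w 0 J') / mass J) (shell w 0 J))
    (cc / (2 * alpha * B) * mass (stscale (mass (shell w 0 J') / mass J) (shell w 0 J))) v l'.
  apply: (wk _ _ (mass (shell w 0 J') / mass J * (cc * mass J / (2 * alpha * B)))).
  - by rewrite mulr_ge0 ?divr_ge0 ?(ltW cc0) ?(ltW aB0)//; apply: (@mass_ge0 R eps); exact: si.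
  - rewrite /mass /stscale -/(mass (shell w 0 J)) -/(mass (shell w 0 J')) -/(mass J).
    rewrite mulrCA; apply: ler_wpM2l; first by rewrite divr_ge0// ltW.
    by rewrite mulrAC ler_pM2r ?invr_gt0// ler_pM2l.
  by apply: density_ge_scale => //; rewrite divr_ge0// ltW.
have lb2' : density_ge (stscale (mass (shell w 0 J) / mass J) (shell w 0 J'))
    (cc / (2 * alpha * B) * mass (stscale (mass (shell w 0 J) / mass J) (shell w 0 J'))) v' l'.
  apply: (wk _ _ (mass (shell w 0 J) / mass J * (cc * mass J' / (2 * alpha * B)))).
  - by rewrite mulr_ge0 ?divr_ge0 ?(ltW cc0) ?(ltW aB0)//; apply: (@mass_ge0 R eps); exact: sj.
  - rewrite /mass /stscale -/(mass (shell w 0 J)) -/(mass (shell w 0 J')) -/(mass J) -/(mass J').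
    rewrite mulrCA; apply: ler_wpM2l; first by rewrite divr_ge0// ltW.
    by rewrite mulrAC ler_pM2r ?invr_gt0// ler_pM2l.
  by apply: density_ge_scale => //; rewrite divr_ge0// ltW.
have mEE : mass (stscale (mass (shell w 0 J') / mass J) (shell w 0 J)) =
    mass (stscale (mass (shell w 0 J) / mass J) (shell w 0 J')).
  by rewrite /mass /stscale -/(mass (shell w 0 J)) -/(mass (shell w 0 J')); field; rewrite gt_eqF.
have := HE _ _ _ _ _ _ _ _ si sj mEE (var_le_scale (divr_ge0 mj (ltW mp)) vi)
   (var_le_scale (divr_ge0 mi (ltW mp)) vj) (shell_u_ge 0 uu) (shell_u_ge 0 uu') lb1' lb2'.
move=> /le_trans; apply.
rewrite lee_fin le_eqVlt; apply/orP; left; apply/eqP.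
rewrite /shell_cost /cost /mass /= -/(mass (shell w 0 J)) -/(mass (shell w 0 J')) -/(mass J) -/(mass J').
have gi := lt_le_trans u00 (shell_u_ge 0 uu); have gj := lt_le_trans u00 (shell_u_ge 0 uu').
by field; rewrite !gt_eqF.
Qed.

Hypothesis alk : 18 <= alpha * k * h ^+ 2.

(** From [l >= 6 del / k] and [alpha * del >= 6] the new length [alpha k l^2 / 18] is at least
    [2 l]. After at most [N] doublings, capped at the window length [h] up to which [monotone_third]
    works, [18 <= alpha k h^2] makes the next image cover the circle. [N'] and [tau] are fixed
    before the measures. *)
Lemma gain_claim_chain N : forall l cc, 6 * del / k <= l <= h -> h <= 2 ^+ N * l -> 0 < cc <= 1 ->
  exists (N' : nat) (tau : R), [/\ (0 < N')%N, 0 < tau <= 1 &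
   forall n c d, 0 <= c -> 0 <= d -> decay_claim n c d ->
    gain_claim (n + N') cc l (c / 2 ^+ N') (d + 4 * K' * c * (1 - (2 ^+ N')^-1)) (tau * d)].
Proof.
have A0 := alpha0; have BB := B0; have aB' := aB; have K0 := k0; have D0 := del0.
have h0 := h_gt0; have h1 := h_le1; have KK := K'_ge0; have L6 := Lc6; have alk' := alk.
have aB0 : 0 < 2 * alpha * B by lra.
have cc2 cc : 0 < cc <= 1 -> 0 < cc / (2 * alpha * B) <= 1.
  move=> /andP[cc0 cc1]; rewrite divr_gt0//= ler_pdivrMr// mul1r; lra.
have base cc : 0 < cc <= 1 -> 6 * del / k <= h -> exists (N' : nat) (tau : R), [/\ (0 < N')%N, 0 < tau <= 1 &
   forall n c d, 0 <= c -> 0 <= d -> decay_claim n c d ->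
    gain_claim (n + N') cc h (c / 2 ^+ N') (d + 4 * K' * c * (1 - (2 ^+ N')^-1)) (tau * d)].
  move=> ccb dh; have /andP[q0 q1] := cc2 _ ccb; have /andP[cc0 cc1] := ccb.
  have ch : 0 < cc * h / 6 by rewrite divr_gt0// mulr_gt0.
  have ch1 : cc * h / 6 <= 1.
    have : cc * h <= 1 * 1 by apply: ler_pM => //; exact: ltW.
    lra.
  exists 1%N, (cc / (2 * alpha * B) * (cc * h / 6) ^+ 2); split => //.
    rewrite mulr_gt0 ?exprn_gt0//= mulr_ile1// ?(ltW q0)// ?exprn_ge0 ?(ltW ch)//.
    by rewrite expr2 mulr_ile1 ?(ltW ch).
  move=> n c d c0 d0 HU; rewrite addn1.
  have q01 : 0 <= cc / (2 * alpha * B) <= 1 by rewrite (ltW q0) q1.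
  have HE := gain_claim_full c0 d0 q01 HU.
  have := @gain_claim_S n cc h 1 c d (cc / (2 * alpha * B) * d) c0 d0 cc0 _ ch1 _ _ HU HE.
  rewrite mulr_ge0 ?(ltW q0)// dh lexx ler_piMl//.
  have b1 : (0 : R) <= 1 <= alpha * k * h ^+ 2 / 18 by lra.
  move=> /(_ isT isT b1); congr gain_claim; last by ring.
    by rewrite expr1; field.
elim: N => [|N ih] l cc /andP[ll lh] hl ccb.
  have -> : l = h by apply/eqP; rewrite eq_le lh -[l]mul1r -(expr0 2).
  by apply: base => //; apply: le_trans lh.
have l0 : 0 < l by apply: lt_le_trans ll; rewrite divr_gt0// mulr_gt0.
pose l2 := Num.min (2 * l) h.
have l2h : l2 <= h by rewrite ge_min lexx orbT.
have l2l : l <= l2 by rewrite le_min lh andbT; lra.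
have l22 : l2 <= 2 * l by rewrite ge_min lexx.
have l2b : 6 * del / k <= l2 <= h by rewrite l2h (le_trans ll).
have hl2 : h <= 2 ^+ N * l2.
  rewrite /l2; case: (leP (2 * l) h) => _.
    by apply: (le_trans hl); rewrite exprSr mulrA.
  by rewrite ler_peMl ?(ltW h0)// exprn_ege1// ler1n.
have [N' [tau [N0 /andP[t0 t1] HN]]] := ih l2 _ l2b hl2 (cc2 _ ccb).
have /andP[cc0 cc1] := ccb.
have cl0 : 0 < cc * l / 6 by rewrite divr_gt0// mulr_gt0.
have cl1 : cc * l / 6 <= 1.
  have : cc * l <= 1 * 1 by apply: ler_pM => //; [exact: ltW|exact: ltW|lra].
  lra.
exists N'.+1, (tau * (cc * l / 6) ^+ 2); split => //.
  rewrite mulr_gt0 ?exprn_gt0//= mulr_ile1// ?(ltW t0)// ?exprn_ge0 ?(ltW cl0)//.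
  by rewrite expr2 mulr_ile1 ?(ltW cl0).
move=> n c d c0 d0 HU; rewrite addnS.
have p : 1 <= 2 ^+ N' :> R by rewrite exprn_ege1// ler1n.
have pp : 0 < 2 ^+ N' :> R by rewrite (lt_le_trans ltr01).
have i1 : (2 ^+ N' : R)^-1 <= 1 by rewrite invf_le1.
have a1 : 0 <= c / 2 ^+ N' by rewrite divr_ge0// ltW.
have a3 : 0 <= 4 * K' * c * (1 - (2 ^+ N')^-1).
  apply: mulr_ge0; last by rewrite subr_ge0.
  by apply: mulr_ge0 => //; apply: mulr_ge0.
have a2 : 0 <= d + 4 * K' * c * (1 - (2 ^+ N')^-1) by apply: addr_ge0.
have td : 0 <= tau * d <= d + 4 * K' * c * (1 - (2 ^+ N')^-1).
  rewrite mulr_ge0 ?(ltW t0)//=.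
  have : tau * d <= 1 * d by rewrite ler_wpM2r.
  lra.
have lb1 : 6 * del / k <= l <= h by rewrite ll.
have lbl : 0 <= l2 <= alpha * k * l ^+ 2 / 18.
  rewrite (le_trans (ltW l0) l2l)/= (le_trans l22)//.
  have kl : 6 * del <= k * l by move: ll; rewrite ler_pdivrMr// [l * k]mulrC.
  have : alpha * (6 * del) * l <= alpha * (k * l) * l by rewrite ler_pM2r// ler_pM2l.
  have : 6 * l <= Lc * l by rewrite ler_pM2r.
  rewrite expr2; lra.
have HU' := decay_claim_iter N' c0 d0 HU; have HE := HN n c d c0 d0 HU.
have := gain_claim_S a1 a2 cc0 td cl1 lb1 lbl HU' HE.
congr gain_claim; [| |ring].
  by rewrite exprS; field; rewrite gt_eqF.
by rewrite exprS; field; rewrite gt_eqF.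
Qed.

(** * Contraction and exponential decay in mean *)

Local Notation ratio := (32 * K').
Hypotheses (Hl : 24 * del / k * (2 * ratio ^+ 4 + 1) <= 1) (Hh : 6 * del / k <= h).

(** The cost bounds each of its terms: [u <= ratio], then [V <= ratio * m * u^3 <= ratio^4 * m].
    About [2 ratio^4] cells therefore suffice in [density_ge_of_var_le], and [Hl] says that half of
    such a cell is at least [12 del / k] long. *)
Lemma good_density_ge J V u l : state eps J -> var_le J V -> u0 <= u -> 0 < mass J ->
  cost (mass J) V u <= ratio * mass J -> 0 <= l -> l <= 12 * del / k ->
  exists s, density_ge J (2^-1 * mass J) s l.
Proof.
move=> sJ vb uu m0 Zle l0 ll.
have up := lt_le_trans u00 uu; have V0 := var_le_ge0 sJ vb; have D0 := del0; have K0 := k0.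
have u3 : 0 < u ^+ 3 by rewrite exprn_gt0.
have vu : 0 <= V / u ^+ 3 by rewrite divr_ge0// ltW.
have um : 0 <= u * mass J by rewrite mulr_ge0 ?ltW.
have uR : u <= ratio by rewrite -(ler_pM2r m0); move: Zle; rewrite /cost; lra.
have VR : V <= ratio ^+ 4 * mass J.
  have : V / u ^+ 3 <= ratio * mass J by move: Zle; rewrite /cost; lra.
  rewrite ler_pdivrMr// => /le_trans; apply.
  have -> : ratio ^+ 4 * mass J = (ratio * mass J) * ratio ^+ 3 by ring.
  apply: ler_wpM2l; first exact: le_trans (cost_ge0 sJ vb uu) Zle.
  by rewrite lerXn2r// nnegrE ?(ltW up)// (le_trans (ltW up)).
pose Q := 2 * ratio ^+ 4.
have Q0 : 0 <= Q by rewrite mulr_ge0// exprn_even_ge0.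
pose n := (Num.truncn Q).+1; have /andP[n1 n2] := truncn_itv Q0.
have n0 : 0 < n%:R :> R by rewrite ltr0n.
have Vn : V <= n%:R * mass J / 2.
  apply: (le_trans VR); have : Q * mass J <= n%:R * mass J by rewrite ler_pM2r// ltW.
  rewrite /Q; lra.
have [s lb] := density_ge_of_var_le sJ vb (ltn0Sn _ : (0 < n)%N) Vn.
exists s; rewrite mulrC; apply: density_ge_weaken lb; first by rewrite divr_ge0// ltW.
rewrite l0/= (le_trans ll)//.
rewrite -[leRHS]mul1r ler_pdivlMr ?mulr_gt0//.
apply: le_trans Hl.
have -> : 24 * del / k * (2 * ratio ^+ 4 + 1) = 12 * del / k * (2 * (Q + 1)) by rewrite /Q; ring.
apply: ler_wpM2l; first by rewrite divr_ge0// ?mulr_ge0// ltW.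
by rewrite ler_pM2l// /n -natr1 lerD2r.
Qed.

(** Claims with the fixed proportion [d = y c] contract in both of two cases. If the total cost is
    at most [32 K' m], coupling removes [tau d], at least twice what [d] has gained. Otherwise
    [tau d m = 8 K' c m] is less than a quarter of [c] times the cost, and the halving of the cost
    leaves room for it. *)
Lemma contraction : exists (N : nat) (q y : R), [/\ (0 < N)%N, 0 < q < 1, 0 < y &
  forall n c, 0 <= c -> decay_claim n c (y * c) -> decay_claim (n + N) (q * c) (y * (q * c))].
Proof.
have D0 := del0; have K0 := k0; have h0 := h_gt0; have C1' := C1_ge1; have U := u00.
have K'0 : 0 < K' by rewrite mulr_gt0//; lra.
pose l := 6 * del / k.
have l0 : 0 < l by rewrite divr_gt0// mulr_gt0.
have lb : 6 * del / k <= l <= h by rewrite lexx.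
pose N0 := (Num.truncn (h / l)).+1.
have hl : h <= 2 ^+ N0 * l.
  rewrite -ler_pdivrMr//.
  have /truncn_itv /andP[_ /ltW /le_trans] : 0 <= h / l by rewrite divr_ge0// ltW.
  by apply; rewrite -natrX ler_nat ltnW// ltn_expl.
have hf : 0 < (2^-1 : R) <= 1 by lra.
have [N [tau [NN /andP[t0 t1] HN]]] := @gain_claim_chain N0 l 2^-1 lb hl hf.
(* Chosen so that [tau * d = 8 K' c]: half of it pays for the growth of [d] by at most [4 K' c], the
   other half is the net gain, whence [1 - tau / 2] in [q]. The [3 / 4] is [1 / 2 + 1 / 4] from the
   case of large cost. *)
pose y := 8 * K' / tau; have y0 : 0 < y by rewrite divr_gt0// mulr_gt0.
pose q := Num.max (3 / 4) (1 - tau / 2).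
have q1 : q < 1 by rewrite gt_max; apply/andP; split; lra.
have q34 : 3 / 4 <= q by rewrite le_max lexx.
have qt : 1 - tau / 2 <= q by rewrite le_max lexx orbT.
exists N, q, y; split => //; first by rewrite q1 andbT; lra.
move=> n c c0 HU; set d := y * c; have d0 : 0 <= d by rewrite mulr_ge0// ltW.
have p2 : 2 <= 2 ^+ N :> R.
  by rewrite -[leLHS]expr1 ler_weXn2l// ler1n.
have pp : 0 < 2 ^+ N :> R by lra.
have i0 : 0 < (2 ^+ N : R)^-1 by rewrite invr_gt0.
have i2 : (2 ^+ N : R)^-1 <= 2^-1 by rewrite lef_pV2// posrE.
have dt : tau * d = 8 * K' * c by rewrite /d /y; field; rewrite gt_eqF.
have kc : 0 <= K' * c by rewrite mulr_ge0// ltW.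
have e1 : d + 4 * K' * c * (1 - (2 ^+ N)^-1) - tau * d <= y * (q * c).
  have : K' * c * (1 - (2 ^+ N)^-1) <= K' * c by rewrite ler_piMr//; lra.
  have : (1 - tau / 2) * d <= q * d by apply: ler_wpM2r.
  by rewrite /d in dt *; lra.
move=> J J' V V' u u' sJ sJ' mE vb vb' uu uu'.
have z0 := cost_ge0 sJ vb uu; have z0' := cost_ge0 sJ' vb' uu'.
set Z := cost (mass J) V u + cost (mass J') V' u'.
have Z0 : 0 <= Z by rewrite addr_ge0.
have mm := mass_ge0 sJ.
have zc2 : c / 2 ^+ N * Z <= c / 2 * Z by rewrite ler_wpM2r// ler_wpM2l.
have zc3 : c / 2 * Z <= q * c * Z.
  by rewrite ler_wpM2r// mulrC ler_wpM2r//; lra.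
have [m0|mn0] := ltP 0 (mass J); last first.
  have m0 : mass J = 0 by apply/eqP; rewrite eq_le mn0.
  apply: (le_trans (mean_dist_mass0 _ sJ sJ' mE m0)); rewrite lee_fin m0 mulr0 addr0.
  by rewrite (le_trans _ zc3)// mulr_ge0// divr_ge0.
have [good|bad] := leP Z (ratio * mass J).
  have g1 : cost (mass J) V u <= ratio * mass J by rewrite /Z in good; lra.
  have g2' : cost (mass J') V' u' <= ratio * mass J by rewrite /Z in good; lra.
  have g2 : cost (mass J') V' u' <= ratio * mass J' by apply: (le_trans g2'); rewrite mE.
  have ll : l <= 12 * del / k.
    by rewrite /l ler_pM2r ?invr_gt0//; lra.
  have [s lbs] := good_density_ge sJ vb uu m0 g1 (ltW l0) ll.
  have m0' : 0 < mass J' by rewrite -mE.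
  have [s' lbs'] := good_density_ge sJ' vb' uu' m0' g2 (ltW l0) ll.
  apply: (le_trans (HN n c d c0 d0 HU J J' V V' u u' s s' sJ sJ' mE vb vb' uu uu' lbs lbs')).
  rewrite lee_fin -/Z lerD//; first exact: le_trans zc2 zc3.
  by rewrite ler_pM2r.
apply: (le_trans (decay_claim_iter N c0 d0 HU sJ sJ' mE vb vb' uu uu')).
rewrite lee_fin -/Z.
have e2 : (d + 4 * K' * c * (1 - (2 ^+ N)^-1)) * mass J <= y * (q * c) * mass J + tau * d * mass J.
  by rewrite -mulrDl ler_pM2r//; lra.
have e3 : tau * d * mass J <= c / 4 * Z.
  rewrite dt; have -> : 8 * K' * c * mass J = c / 4 * (ratio * mass J) by field.
  by rewrite ler_wpM2l ?divr_ge0// ltW.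
have zc4 : 3 / 4 * c * Z <= q * c * Z by rewrite ler_wpM2r// ler_wpM2r.
lra.
Qed.

(** The trivial bound [2 m] holds after any number of steps, in particular after [n] modulo [N];
    from there every [N] steps contribute a factor [q]. *)
Lemma decay_claim_decay : exists (C g : R), [/\ 0 < C, 0 < g &
  forall n, decay_claim n (C * expR (- g * n%:R)) (C * expR (- g * n%:R))].
Proof.
have [N [q [y [N0 /andP[q0 q1] y0 H]]]] := contraction.
have base r j : decay_claim (r + j * N) (q ^+ j * (2 / y)) (y * (q ^+ j * (2 / y))).
  elim: j => [|j ih].
    rewrite mul0n addn0 expr0 mul1r; apply: decay_claim_mono (Uclaim0 r).
      by rewrite divr_ge0// ltW.
    by rewrite mulrC divfK// gt_eqF.
  rewrite mulSnr addnA exprS -mulrA; apply: H => //.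
  by rewrite mulr_ge0 ?exprn_ge0 ?divr_ge0// ltW.
have NR : 0 < N%:R :> R by rewrite ltr0n.
pose g := - ln q / N%:R.
have g0 : 0 < g by rewrite divr_gt0// oppr_gt0 ln_lt0// q0 q1.
pose C := (2 / y + 2) / q.
have C0 : 0 < C by rewrite divr_gt0// addr_gt0// divr_gt0.
exists C, g; split => // n.
have qj : q ^+ (n %/ N) <= q^-1 * expR (- g * n%:R).
  have qE : q = expR (- g * N%:R).
    by rewrite /g mulNr divfK ?gt_eqF// opprK lnK// posrE.
  rewrite [in leLHS]qE [in X in X^-1 * _]qE -expRN -expRM_natl -expRD ler_expR.
  have : (n%:R : R) < ((n %/ N).+1 * N)%:R by rewrite ltr_nat ltn_ceil.
  rewrite natrM -natr1 => /ltW Hn.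
  have := ler_wpM2l (ltW g0) Hn; rewrite -mulr_natl; lra.
rewrite {1}(divn_eq n N) addnC; apply: decay_claim_mono (base (n %% N)%N (n %/ N)%N).
  have -> : C * expR (- g * n%:R) = (2 / y + 2) * (q^-1 * expR (- g * n%:R)).
    by rewrite /C mulrA.
  have yy : 0 <= 2 / y by rewrite divr_ge0// ltW.
  have p : 0 <= q^-1 * expR (- g * n%:R) by rewrite mulr_ge0 ?expR_ge0// invr_ge0 ltW.
  apply: (@le_trans _ _ (2 / y * (q^-1 * expR (- g * n%:R)))).
    by rewrite [leLHS]mulrC ler_wpM2l.
  by rewrite [leRHS]mulrDl lerDl mulr_ge0.
have -> : y * (q ^+ (n %/ N) * (2 / y)) = 2 * q ^+ (n %/ N) by field; rewrite gt_eqF.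
have yy : 0 <= 2 / y by rewrite divr_ge0// ltW.
have p : 0 <= q^-1 * expR (- g * n%:R) by rewrite mulr_ge0 ?expR_ge0// invr_ge0 ltW.
have -> : C * expR (- g * n%:R) = (2 / y + 2) * (q^-1 * expR (- g * n%:R)).
  by rewrite /C mulrA.
apply: (@le_trans _ _ (2 * (q^-1 * expR (- g * n%:R)))); first by rewrite ler_wpM2l.
by rewrite [leRHS]mulrDl lerDr mulr_ge0.
Qed.

Lemma var_le_junif (b c b' : R) : 0 <= b' -> b <= c -> var_le (stscale b' (junif b c)) (2 * b').
Proof.
move=> b0 bc F f dF cf pF F1; rewrite /stscale (junifE bc dF cf.1) mulrC ler_wpM2r//.
have := F1 b; have := F1 c; rewrite !ler_norml; lra.
Qed.

Lemma var_le_Leb : var_le (@junif R 0 1) 0.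
Proof.
move=> F f dF cf pF F1; rewrite (junifE ler01 dF cf.1).
by have := pF 0; rewrite add0r => ->; rewrite subrr.
Qed.

Lemma mass_junif_itv (b c : R) : b <= c -> mass (junif b c) = c - b.
Proof. by move=> bc; rewrite /mass (junifE bc (@primitive_id R) (@cper_cst R 1).1). Qed.

(** Lebesgue measure on a cell, normalised to mass 1, has variation at most [2 m]; as [decay_claim]
    is linear in the variation, the price is a single factor [m]. *)
Lemma decay_interval : exists (C g : R), [/\ 0 < C, 0 < g &
  forall n (m j : nat), (0 < m)%N ->
   (mean_dist n (stscale m%:R (junif (j%:R / m%:R) (j.+1%:R / m%:R))) (junif 0 1) <=
     (C * expR (- g * n%:R) * m%:R)%:E)%E].
Proof.
have [C [g [C0 g0 HU]]] := decay_claim_decay; have U := u00.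
exists (C * (2 * u0 + 5)), g; split => //; first by rewrite mulr_gt0//; lra.
move=> n m j m0; have mR : 0 < m%:R :> R by rewrite ltr0n.
have jj : j%:R / m%:R <= j.+1%:R / m%:R :> R by rewrite ler_pM2r ?invr_gt0// ler_nat.
have sI := state_junif eps jj.
have sJ : state eps (stscale m%:R (junif (j%:R / m%:R) (j.+1%:R / m%:R))).
  by apply: state_scale => //; exact: ltW.
have mJ : mass (stscale m%:R (junif (j%:R / m%:R) (j.+1%:R / m%:R))) = 1.
  rewrite /mass /stscale -/(mass (junif _ _)) mass_junif_itv// -natr1; field.
  by rewrite gt_eqF.
have mE : mass (stscale m%:R (junif (j%:R / m%:R) (j.+1%:R / m%:R))) = mass (@junif R 0 1).
  by rewrite mJ mass_junif.
have uu : u0 <= u0 + 1 by lra.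
have := HU n _ _ _ _ _ _ sJ (state_junif eps ler01) mE (var_le_junif (ltW mR) jj) var_le_Leb uu uu.
move=> /le_trans; apply; rewrite lee_fin mass_junif mJ /cost mul0r addr0 !mulr1.
have u3 : 1 <= (u0 + 1) ^+ 3 by rewrite exprn_ege1//; lra.
have v3 : 2 * m%:R / (u0 + 1) ^+ 3 <= 2 * m%:R.
  rewrite ler_pdivrMr; last lra.
  by rewrite ler_peMr// mulr_ge0// ltW.
have m1 : 1 <= m%:R :> R by rewrite ler1n.
have e0 : 0 < C * expR (- g * n%:R) by rewrite mulr_gt0// expR_gt0.
have um : u0 * 1 <= u0 * m%:R by rewrite ler_pM2l.
have : (u0 + 1 + 2 * m%:R / (u0 + 1) ^+ 3 + (u0 + 1)) + 1 <= (2 * u0 + 5) * m%:R by lra.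
move=> /(ler_wpM2l (ltW e0)); lra.
Qed.

Lemma cons_le (b : Omega eps -> \bar R) (G : R -> \bar R) : measurable_fun setT b ->
  (forall om, 0 <= b om)%E -> measurable_fun setT G -> (forall w, 0 <= G w)%E ->
  (forall w, - ep <= w <= ep -> (\int[P]_om b (cons w om) <= G w)%E) ->
  (\int[P]_om b om <= \int[nu]_w G w)%E.
Proof.
move=> mb b0 mG G0 HG.
have g0 w : (0 <= \int[P]_om b (cons w om))%E by exact: integral_ge0.
rewrite cons_law// !integral_uniform//; last exact: cons_meas.
apply: lee_wpmul2l; first by rewrite lee_fin invr_ge0 subr_ge0 ltW// noise_lt.
apply: ge0_le_integral => //.
- by apply: measurable_funTS; exact: cons_meas.
- exact: measurable_funTS.
Qed.

(** The one-step image of Lebesgue measure need not have finite variation, so [decay_claim] does not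
    apply to it directly. It is first cut into shells, and each shell is compared with the multiple
    of Lebesgue measure of the same mass. [b] is a function of the whole noise, known only after
    conditioning on the first coordinate. *)
Lemma decay_push : exists (C g : R), [/\ 0 < C, 0 < g &
  forall n (b : Omega eps -> \bar R), measurable_fun setT b -> (forall om, 0 <= b om)%E ->
   (forall w om, - ep <= w <= ep -> b (cons w om) = dist n (push w (junif 0 1)) (junif 0 1) om) ->
   (\int[P]_om b om <= (C * expR (- g * n%:R))%:E)%E].
Proof.
have [C [g [C0 g0 HU]]] := decay_claim_decay; have U := u00; have C1' := C1_ge1.
have sL : state eps (@junif R 0 1) by exact: (state_junif eps ler01).
exists (C * (10 * C1 * u0 + 2)), g; split => //.
  by rewrite mulr_gt0// addr_gt0// !mulr_gt0//; lra.
move=> n b mb b0 Hb; set e := C * expR (- g * n%:R).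
have e0 : 0 < e by rewrite mulr_gt0// expR_gt0.
pose A := e * (2 * u0); have A0 : 0 <= A by rewrite !mulr_ge0// ltW.
pose D := e * (5 * u0 + 1); have D0 : 0 <= D by rewrite mulr_ge0// ?(ltW e0)//; lra.
have main I : (\int[P]_om b om <= (D + (16 * noise_const * A + 2 * noise_const / 16 ^+ I))%:E)%E.
  pose G w := (D + wsum (junif 0 1) A I w)%:E.
  have mw := measurable_wsum A I sL; have wp w := wsum_ge0 I w sL A0.
  apply: (@le_trans _ _ (\int[nu]_w G w)%E).
    apply: cons_le => //.
    - by apply/measurable_EFinP; apply: measurable_funD.
    - by move=> w; rewrite /G lee_fin addr_ge0.
    move=> w wb; under eq_integral do rewrite Hb//.
    rewrite -/(mean_dist n (push w (junif 0 1)) (junif 0 1)).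
    have ms i : 0 <= mass (shell w i (junif 0 1)).
      by apply: (@mass_ge0 R eps); exact: state_shell.
    have rs : 0 <= mass (resid w I (junif 0 1)).
      by apply: (@mass_ge0 R eps); exact: state_resid.
    have spl := mass_split sL w I; rewrite mass_junif in spl.
    have := @mean_dist_sub n (push w (junif 0 1)) (junif 0 1) _ (index_enum 'I_I.+1)
      (fun i => shell w i (junif 0 1)) (fun i => stscale (mass (shell w i (junif 0 1))) (junif 0 1))
      (resid w I (junif 0 1)) (stscale (mass (resid w I (junif 0 1))) (junif 0 1))
      (state_push_w sL w) sL (state_resid sL w I) (state_scale sL rs)
      (fun i => state_shell sL w i) (fun i => state_scale sL (ms i)).
    move=> /(_ _)/le_trans; apply.
      move=> f cf; rewrite (push_split sL w I cf) sumrB -mulr_suml.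
      have jf : junif 0 1 f = (\sum_(i < I.+1) mass (shell w i (junif 0 1)) +
          mass (resid w I (junif 0 1))) * junif 0 1 f by rewrite -spl mul1r.
      rewrite [X in _ - X = _]jf /stscale; ring.
    have mr : mass (stscale (mass (resid w I (junif 0 1))) (junif 0 1)) = mass (resid w I (junif 0 1)).
      by rewrite /mass /stscale -/(mass (junif 0 1)) mass_junif mulr1.
    rewrite mr; apply: (@le_trans _ _ ((\sum_(i < I.+1) (e * (shell_cost (junif 0 1) 0 u0 w i +
        u0 * mass (shell w i (junif 0 1))) + e * mass (shell w i (junif 0 1))))%:E +
        (mass (resid w I (junif 0 1)) + mass (resid w I (junif 0 1)))%:E)%E).
      apply: leeD2r; rewrite -sumEFin; apply: lee_sum => i _.
      have mi : mass (stscale (mass (shell w i (junif 0 1))) (junif 0 1)) = mass (shell w i (junif 0 1)).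
        by rewrite /mass /stscale -/(mass (junif 0 1)) mass_junif mulr1.
      have vi : var_le (shell w i (junif 0 1)) (shell_var (mass (junif 0 1)) 0 i) := var_le_shell sL w i var_le_Leb.
      have := HU n _ _ _ _ _ _ (state_shell sL w i) (state_scale sL (ms i)) (esym mi) vi
        (var_le_scale (ms i) var_le_Leb) (shell_u_ge i (lexx u0)) (lexx u0).
      by rewrite mi /cost mulr0 mul0r addr0.
    rewrite -EFinD lee_fin.
    have sX := sum_shell_cost w I sL var_le_Leb (lexx u0).
    rewrite big_split/= -!mulr_sumr big_split/= -mulr_sumr.
    have sm : \sum_(i < I.+1) mass (shell w i (junif 0 1)) <= 1 by lra.
    have t1 := ler_wpM2l (ltW e0) sX.
    have t2 : e * (u0 * \sum_(i < I.+1) mass (shell w i (junif 0 1))) <= e * (u0 * 1).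
      by rewrite !ler_pM2l.
    have t3 : e * \sum_(i < I.+1) mass (shell w i (junif 0 1)) <= e * 1 by rewrite ler_pM2l.
    have W0 : 0 <= \sum_(i < I) 8 ^+ i.+1 * mass (resid w i (junif 0 1)).
      apply: sumr_ge0 => i _; rewrite mulr_ge0 ?exprn_ge0//.
      by apply: (@mass_ge0 R eps); exact: state_resid.
    have uc : u0 + u0 / (2 * C1) <= 2 * u0.
      have : u0 / (2 * C1) <= u0 by rewrite ler_pdivrMr ?ler_peMr// ?(ltW U)//; lra.
      lra.
    have t4 : e * ((u0 + u0 / (2 * C1)) * (1 + \sum_(i < I) 8 ^+ i.+1 * mass (resid w i (junif 0 1))))
       <= e * ((2 * u0) * (1 + \sum_(i < I) 8 ^+ i.+1 * mass (resid w i (junif 0 1)))).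
      by rewrite ler_pM2l// ler_wpM2r//; lra.
    rewrite /wsum -mulr_sumr /D /A; rewrite /total_cost mass_junif mul0r in t1; lra.
  rewrite /G; under eq_integral do rewrite EFinD.
  rewrite ge0_integralD//; last 2 first.
  - by move=> w _; rewrite lee_fin.
  - exact/measurable_EFinP.
  rewrite EFinD; apply: leeD.
    by rewrite integral_cst//= -[leRHS]mule1 lee_wpmul2l ?lee_fin// probability_le1.
  by have := mean_wsum I sL A0; rewrite mass_junif mulr1.
have fA : ((\int[P]_om b om)%E \is a fin_num).
  rewrite ge0_fin_numE; last exact: integral_ge0.
  by apply: (le_lt_trans (main 0%N)); rewrite ltry.
rewrite -(fineK fA) lee_fin.
have cav := noise_const_ge0; have HC := HC1.
have A16 : 16 * noise_const * A <= (C1 - 1) * A by apply: ler_wpM2r => //; lra.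
apply: (@le_of_geo _ _ (2 * noise_const)); first by rewrite mulr_ge0.
move=> I; have := main I; rewrite -(fineK fA) lee_fin => /le_trans; apply.
rewrite addrA lerD2r.
have : e * (u0 * 1) <= e * (u0 * C1) by rewrite !ler_pM2l.
have -> : C * (10 * C1 * u0 + 2) * expR (- g * n%:R) = e * (10 * C1 * u0 + 2) by rewrite /e; ring.
have : 0 <= e * u0 by rewrite mulr_ge0// ltW.
rewrite /A in A16; rewrite /D /A; lra.
Qed.
End dynamics.

(** [del = del0 * min (eps, 1)] keeps [del / eps <= 1], so [C1] can be fixed independently of
    [alpha] and [eps]; and [eps > alpha^(c-1)] with [alpha >= 1] gives
    [alpha * del >= del0 * alpha^c], which is at least any prescribed [L0] once [alpha] is large.
    This is where the relation between [eps] and [alpha] enters. *)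
Lemma parameters (R : realType) (B k c : R) (M : nat) : 0 < B -> 0 < k -> (0 < M)%N -> 0 < c < 1 ->
  exists alpha0 : R, forall (alpha : R) (eps : {posnum R}), alpha0 <= alpha ->
    alpha `^ (c - 1) < eps%:num ->
  exists del C1 u0 : R,
   [/\ [/\ 0 < alpha, 0 < del, del <= 1, 1 + 16 * noise_const eps del k M <= C1 & 32 * C1 ^+ 3 <= alpha * del],
       [/\ 0 < u0, u0 ^+ 4 = 2 * B / (alpha * del * del), 1 <= 2 * alpha * B & 6 <= alpha * del],
       18 <= alpha * k * M%:R^-1 ^+ 2,
       24 * del / k * (2 * (32 * ((C1 + 2) * u0)) ^+ 4 + 1) <= 1 &
       6 * del / k <= M%:R^-1].
Proof.
move=> B0 k0 M0 /andP[c0 c1].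
have h0 : 0 < (M%:R^-1 : R) by rewrite invr_gt0 ltr0n.
have h1 : (M%:R^-1 : R) <= 1 by rewrite invf_le1 ?ltr0n// ler1n.
set h : R := M%:R^-1 in h0 h1 *.
have C00 : 0 <= C0 k h := C0_ge0 k0 h0.
pose C1 := 1 + 16 * (C0 k h * (M%:R + 2^-1)).
have C1p : 0 < C1.
  have : 0 <= C0 k h * (M%:R + 2^-1) by rewrite mulr_ge0// addr_ge0.
  by rewrite /C1; lra.
pose del0 := Num.min 1 (k * h / 48).
have kh : 0 < k * h by rewrite mulr_gt0.
have d0 : 0 < del0 by rewrite lt_min ltr01/= divr_gt0.
have d1 : del0 <= 1 by rewrite ge_min lexx.
have dkh : del0 <= k * h / 48 by rewrite ge_min lexx orbT.
pose S := (32 * (C1 + 2)) ^+ 4.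
have S0 : 0 < S by rewrite exprn_gt0// mulr_gt0// addr_gt0.
(* In the condition on [24 * del / k], the part with [u0^4 = 2 B / (alpha del^2)] equals
   [T / (2 alpha del)], at most one half when [alpha * del >= T]; [del0 <= k h / 48] bounds the rest
   by another half. *)
pose T := 192 * S * B / k.
have T0 : 0 < T by rewrite divr_gt0// mulr_gt0// mulr_gt0.
have C3 : 0 < C1 ^+ 3 by rewrite exprn_gt0.
pose L0 := 32 * C1 ^+ 3 + 6 + T.
have L00 : 0 < L0 by rewrite /L0; lra.
pose r := (L0 / del0) `^ c^-1.
have r0 : 0 <= r by exact: powR_ge0.
have B2 : 0 < (2 * B)^-1 by rewrite invr_gt0 mulr_gt0.
have K2 : 0 < 18 / (k * h ^+ 2) by rewrite divr_gt0// mulr_gt0// exprn_gt0.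
exists (1 + r + (2 * B)^-1 + 18 / (k * h ^+ 2)) => alpha eps al ae.
have a1 : 1 <= alpha by lra.
have a0 : 0 < alpha by lra.
have ra : r <= alpha by lra.
have rac : L0 / del0 <= alpha `^ c.
  have : r `^ c <= alpha `^ c by apply: ge0_ler_powR; rewrite ?nnegrE// ltW.
  by rewrite /r -powRrM mulVf ?gt_eqF// powRr1// divr_ge0// ltW.
have e0 : 0 < eps%:num by [].
have eps1 : alpha `^ c <= alpha * eps%:num.
  have : alpha * alpha `^ (c - 1) <= alpha * eps%:num by rewrite ler_pM2l// ltW.
  rewrite -{1}[alpha]powRr1; last exact: ltW.
  by rewrite -powRD ?(gt_eqF a0) ?implybT// addrC subrK.
have epsa : alpha `^ c <= alpha.
  by rewrite -[leRHS]powRr1 ?(ltW a0)//; apply: ler_powR => //; exact: ltW.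
pose m := Num.min eps%:num 1.
have m0 : 0 < m by rewrite lt_min e0 ltr01.
have m1 : m <= 1 by rewrite ge_min lexx orbT.
have me : m <= eps%:num by rewrite ge_min lexx.
have am : alpha `^ c <= alpha * m by rewrite /m; case: (leP eps%:num 1); rewrite ?mulr1.
pose del := del0 * m.
have D0 : 0 < del by rewrite mulr_gt0.
have D1 : del <= del0 by rewrite ler_piMr// ltW.
have LL : L0 <= alpha * del.
  have : del0 * (L0 / del0) <= del0 * (alpha * m) by rewrite ler_pM2l// (le_trans rac).
  rewrite mulrC divfK ?gt_eqF// => /le_trans; apply.
  by rewrite /del mulrCA.
have L1 : 0 < alpha * del by rewrite mulr_gt0.
pose v := 2 * B / (alpha * del * del).
have v0 : 0 < v by rewrite divr_gt0// ?mulr_gt0.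
exists del, C1, (Num.sqrt (Num.sqrt v)).
have u4 : Num.sqrt (Num.sqrt v) ^+ 4 = v.
  by rewrite (exprM _ 2 2) !sqr_sqrtr ?sqrtr_ge0 ?ltW.
have dk : del / k <= h / 48.
  by rewrite ler_pdivrMr//; lra.
split.
- split => //; first exact: le_trans D1 d1.
    rewrite /C1 lerD2l ler_pM2l// /noise_const -/h.
    rewrite -mulrA mulrCA ler_wpM2l// mulrDr; apply: lerD.
      by rewrite ler_piMl// (le_trans D1).
    rewrite ler_pdivrMr ?mulr_gt0// mulrA mulVf ?mul1r//.
    apply: le_trans me; rewrite /del ler_piMl// ltW//.
  by rewrite /L0 in LL; lra.
- split => //; first by rewrite !sqrtr_gt0.
    have : (2 * B)^-1 * (2 * B) <= alpha * (2 * B) by rewrite ler_pM2r ?mulr_gt0//; lra.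
    by rewrite mulVf ?gt_eqF ?mulr_gt0//; lra.
  by rewrite /L0 in LL; lra.
- have : 18 / (k * h ^+ 2) * (k * h ^+ 2) <= alpha * (k * h ^+ 2).
    by rewrite ler_pM2r ?mulr_gt0 ?exprn_gt0//; lra.
  by rewrite divfK ?mulrA// gt_eqF// mulr_gt0// exprn_gt0.
- rewrite mulrA exprMn u4 -/S.
  have -> : 24 * del / k * (2 * (S * v) + 1) = T / (2 * (alpha * del)) + 24 * (del / k).
    by rewrite /v /T; field; rewrite !gt_eqF.
  have : T / (2 * (alpha * del)) <= 2^-1.
    by rewrite ler_pdivrMr ?mulr_gt0//; rewrite /L0 in LL; lra.
  lra.
- by rewrite -mulrA; lra.
Qed.

(** * The law of the noise and its shifts *)

Section noise_law.
Variables (R : realType) (eps : {posnum R}).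
Local Notation ep := (eps%:num).
Local Notation nu := (uniform_prob (noise_lt eps)).

Definition cylinder (J : {fset int}) (B : int -> set R) : set (Omega eps) :=
  \bigcap_(j in [set` J]) noise_at j @^-1` B j.

Lemma measurable_cylinder (J : {fset int}) B : (forall j, measurable (B j)) -> measurable (cylinder J B).
Proof.
move=> mB; apply: fin_bigcap_measurable; first exact: finite_fset.
move=> j _.
by rewrite -[X in measurable X]setTI; exact: measurable_noise_at.
Qed.

Lemma measurable_to_Omega d (T : measurableType d) (f : T -> Omega eps) :
  (forall i, measurable_fun setT (fun x => noise_at i (f x))) -> measurable_fun setT f.
Proof.
move=> mf; apply: (@measurability _ _ _ _ _ _ [set A : set (Omega eps) |
    exists i, exists2 B : set R, measurable B & A = noise_at i @^-1` B]) => //.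
by move=> _ [_ [i [B mB ->]] <-]; exact: mf.
Qed.

(** Cylinders form a generating pi-system. Those whose index set contains 0 suffice, since [setT]
    may be imposed there, and they let the argument for [cons_noise] split off the factor at time
    0. *)
Lemma Omega_law_unique (P Q : {measure set (Omega eps) -> \bar R}) : P setT = 1%E ->
  (forall (J : {fset int}) B, 0 \in J -> (forall j, measurable (B j)) -> P (cylinder J B) = Q (cylinder J B)) ->
  forall A, measurable A -> P A = Q A.
Proof.
move=> P1 PQ A mA.
pose G := [set A : set (Omega eps) | exists J : {fset int}, exists2 B, 0 \in J /\ (forall j, measurable (B j)) &
  A = cylinder J B].
have GT : G setT.
  exists [fset 0]%fset, (fun=> setT); first by split; [rewrite inE|move=> j].
  by rewrite /cylinder; apply/seteqP; split.
apply: (@measure_unique _ _ _ G (fun=> setT)) => //.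
- apply/seteqP; split => [X mX|X].
    apply: smallest_sub mX; first exact: smallest_sigma_algebra.
    move=> _ [i [B mB ->]]; apply: sub_sigma_algebra.
    exists [fset 0; i]%fset, (fun j => if j == i then B else setT).
      split; first by rewrite !inE eqxx.
      by move=> j; case: ifP.
    apply/seteqP; split => om /=.
      move=> Bi j /=; rewrite !inE => /orP[]/eqP ->; case: eqP => // -> //.
    by move=> /(_ i); rewrite /= !inE !eqxx orbT; exact.
  apply: smallest_sub; first exact: sigma_algebra_measurable.
  by move=> _ [J [B [_ mB] ->]]; exact: measurable_cylinder.
- move=> _ _ [J [B [J0 mB] ->]] [J' [B' [J'0 mB'] ->]].
  exists (J `|` J')%fset, (fun j => (if j \in J then B j else setT) `&` (if j \in J' then B' j else setT)).
    split; first by rewrite inE J0.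
    by move=> j; apply: measurableI; case: ifP.
  apply/seteqP; split => om /=.
    move=> [H H'] j /= _; split; case: ifP => // jJ; [exact: H|exact: H'].
  move=> H; split => j /= jJ; have := H j; rewrite /= inE jJ ?orbT => /(_ isT)[]; rewrite //.
- by apply/seteqP; split => // om _; exists 0%N.
- by move=> _ [J [B [J0 mB] ->]]; exact: PQ.
- by move=> n; rewrite P1 ltry.
Qed.

Variable P : probability (Omega eps) R.
Hypothesis HP : is_product_uniform P.

Lemma P_cylinder (J : {fset int}) B : (forall j, measurable (B j)) ->
  P (cylinder J B) = (\prod_(j <- J) nu (B j))%E.
Proof. exact: HP. Qed.

(* Inserts [w] at time 0, so that [P] is invariant under [cons_noise] with [w] uniform. *)
Definition cons_noise (w : R) (om : Omega eps) : Omega eps := fun i =>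
  if i == 0 then insubd (exist (fun t : R => t \in `[- ep, ep]) 0 (noise0_subproof eps)) w
  else if 0 < i then om (i - 1) else om i.

Lemma cons_noise0 w om : - ep <= w <= ep -> noise_at 0 (cons_noise w om) = w.
Proof. by move=> wb; rewrite /noise_at /cons_noise eqxx -/(val _) insubdK// /in_mem/= in_itv. Qed.

Lemma cons_noiseS w om (n : nat) : noise_at n.+1 (cons_noise w om) = noise_at n om.
Proof. by rewrite /noise_at /cons_noise/=; congr (sval (om _)); rewrite -addn1 PoszD addrK. Qed.

Lemma measurable_cons_noise :
  measurable_fun [set: R * Omega eps] (fun z => cons_noise z.1 z.2).
Proof.
apply: measurable_to_Omega => i; rewrite /noise_at /cons_noise.
have [_|i0] := eqVneq i 0; last first.
  case: (0 < i).
    exact: (measurableT_comp (@measurable_noise_at R eps (i - 1)) measurable_snd).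
  exact: (measurableT_comp (@measurable_noise_at R eps i) measurable_snd).
rewrite (_ : (fun x => _) = fun x => \1_`[- ep, ep] x.1 * x.1); last first.
  apply/funext => -[w om] /=; rewrite -/(val _) val_insubd indicE mem_setE.
  by case: ifP => _; rewrite ?mul1r// mul0r.
apply: measurable_funM; last exact: measurable_fst.
by apply: (measurableT_comp (measurable_indic _) measurable_fst).
Qed.

Lemma measurable_theta : measurable_fun setT (@theta R eps).
Proof.
apply: measurable_to_Omega => i; exact: (@measurable_noise_at _ _ (i + 1)).
Qed.

Lemma measurable_theta_inv : measurable_fun setT (@theta_inv R eps).
Proof.
apply: measurable_to_Omega => i; exact: (@measurable_noise_at _ _ (i - 1)).
Qed.

Lemma nu_itv B : measurable B -> nu (B `&` `[- ep, ep]) = nu B.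
Proof.
move=> mB; rewrite /uniform_prob [in RHS]integral_uniform_pdf.
by [].
Qed.

Lemma cons_noise_image A : measurable A ->
  pushforward (nu \x P)%E (fun z => cons_noise z.1 z.2) A = P A.
Proof.
move=> mA; have mc := measurable_cons_noise.
pose Q : {measure set (Omega eps) -> \bar R} := pushforward (nu \x P)%E (fun z => cons_noise z.1 z.2).
apply/esym; apply: (@Omega_law_unique P (Q mc)) => //; first exact: probability_setT.
move=> J B J0 mB; apply: (etrans (P_cylinder J mB)); rewrite /Q/= /pushforward.
(* For [i] different from 0, the index in the old sequence of the coordinate found at [i] after the
   insertion; [s'] undoes it. *)
pose s (i : int) : int := if 0 < i then i - 1 else i.
pose s' (i : int) : int := if 0 <= i then i + 1 else i.
have ss (i : int) : i != 0 -> s' (s i) = i.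
  by move=> i0; rewrite /s /s'; case: (ltP 0 i) => b; case: ifP => b'; lia.
pose J' := [fset s i | i in (J `\ 0)%fset]%fset.
have inj : {in (J `\ 0)%fset &, injective s}.
  move=> i j; rewrite !inE => /andP[i0 _] /andP[j0 _] E.
  by rewrite -(ss i)// E ss.
(* For [w] outside [[-eps, eps]] the inserted value is the default 0; this accounts for the second,
   [nu]-null, piece of the first factor. *)
rewrite (_ : _ @^-1` _ = (B 0 `&` `[- ep, ep] `|` [set w | B 0 0 /\ w \notin `[- ep, ep]]) `*` cylinder J' (fun j => B (s' j))); last first.
  apply/seteqP; split => -[w om] /= H.
    split.
      have := H 0 J0; rewrite /noise_at /cons_noise/= -/(val _) val_insubd; case: ifPn => wb b; [left|right] => //.
    move=> j /= /imfsetP[i iJ' ->]; move: iJ'; rewrite /= !inE => /andP[i0 iJ]; rewrite ss//.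
    by have := H i iJ; rewrite /noise_at /cons_noise /= (negbTE i0) /s; case: ifP.
  move=> i iJ; rewrite /= /noise_at /cons_noise; have [->|i0] := eqVneq i 0.
    rewrite -/(val _) val_insubd; case: H => -[[b wb]|[b wb]] _; first by rewrite wb.
    by rewrite (negbTE wb).
  have iJ' : s i \in J' by apply/imfsetP; exists i => //=; rewrite !inE i0.
  by have := H.2 (s i) iJ'; rewrite /= ss// /noise_at/= /s; case: ifP.
have mB1 : measurable (B 0 `&` `[- ep, ep]) by exact: measurableI.
have mB2 : measurable [set w | B 0 0 /\ w \notin `[- ep, ep]].
  have [b|nb] := pselect (B 0 0).
    rewrite (_ : [set w | _] = ~` `[- ep, ep]); first exact: measurableC.
    by apply/seteqP; split => w /=; [move=> [_ /negP]|move=> /negP].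
  by rewrite (_ : [set w | _] = set0)//; apply/seteqP; split => w // -[].
rewrite product_measure1E//; [|exact: measurableU|exact: measurable_cylinder].
rewrite [X in (_ = _ * X)%E]P_cylinder//; rewrite big_imfset//=.
rewrite (big_fsetD1 0)//=; congr (_ * _)%E.
  rewrite -[RHS]nu_itv; last exact: measurableU.
  rewrite -[LHS]nu_itv; last exact: mB.
  congr (nu _); apply/seteqP; split => w /=.
    by move=> [b wb]; split => //; left.
  by move=> [[[b _]|[_ /negP]]//].
by apply: eq_big_seq => i; rewrite !inE => /andP[i0 _]; rewrite ss.
Qed.

Lemma cons_noise_law (f : Omega eps -> \bar R) : measurable_fun setT f -> (forall om, 0 <= f om)%E ->
  (\int[P]_om f om = \int[nu]_w \int[P]_om f (cons_noise w om))%E.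
Proof.
move=> mf f0; have mc := measurable_cons_noise.
pose Q : {measure set (Omega eps) -> \bar R} := pushforward (nu \x P)%E (fun z => cons_noise z.1 z.2).
rewrite (eq_measure_integral (Q mc)); last by move=> A mA _; exact/esym/cons_noise_image.
rewrite ge0_integral_pushforward// preimage_setT.
have mfc : measurable_fun setT (f \o (fun z => cons_noise z.1 z.2)) by exact: measurableT_comp.
have K := fubini_tonelli1 (m1 := nu) (m2 := P) _ mfc (fun z => f0 _).
exact: K.
Qed.

Lemma cons_noise_meas (f : Omega eps -> \bar R) : measurable_fun setT f -> (forall om, 0 <= f om)%E ->
  measurable_fun setT (fun w => \int[P]_om f (cons_noise w om))%E.
Proof.
move=> mf f0; have mc := measurable_cons_noise.
apply: (measurable_fun_fubini_tonelli_F (m2 := P) (f \o (fun z => cons_noise z.1 z.2))) => //.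
  exact: measurableT_comp.
by move=> z; exact: f0.
Qed.

Lemma shift_image (h : Omega eps -> Omega eps) (m : int) : measurable_fun setT h ->
  (forall i om, noise_at i (h om) = noise_at (i + m) om) ->
  forall A, measurable A -> P (h @^-1` A) = P A.
Proof.
move=> mh hE A mA.
pose Q : {measure set (Omega eps) -> \bar R} := pushforward P h.
apply/esym; apply: (@Omega_law_unique P (Q mh)) => //; first exact: probability_setT.
move=> J B J0 mB; apply: (etrans (P_cylinder J mB)); rewrite /Q/= /pushforward.
have inj : {in J &, injective (fun i => i + m)} by move=> i j _ _; exact: addIr.
rewrite (_ : h @^-1` _ = cylinder [fset (i + m)%R | i in J]%fset (fun j => B (j - m))); last first.
  apply/seteqP; split => om /= H.
    by move=> j /= /imfsetP[i /= iJ ->]; rewrite /= addrK -hE; exact: H.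
  move=> i iJ; have := H (i + m); rewrite /= addrK hE; apply.
  exact: in_imfset.
apply/esym; apply: (etrans (P_cylinder _ _)) => //; rewrite big_imfset//=; apply: eq_bigr => i _; by rewrite addrK.
Qed.

Lemma theta_image A : measurable A -> P (@theta R eps @^-1` A) = P A.
Proof. exact: (shift_image measurable_theta (m := 1)). Qed.

Lemma theta_inv_image A : measurable A -> P (@theta_inv R eps @^-1` A) = P A.
Proof. exact: (shift_image measurable_theta_inv (m := -1)). Qed.

End noise_law.

(** * Test functions on the circle *)

Section circle_basics.
Variable R : realType.
Implicit Types (s t a b : R) (f g : R -> R).

Lemma circle_pi_eq s t : (circle_pi s = circle_pi t) <-> (s - t \is a Num.int).
Proof.
have -> : (s - t \is a Num.int) = (circle_pi s == circle_pi t).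
  exact: (@Quotient.idealrBE R (GRing.ZmodClosed.clone R (@Num.int_num_subdef R) _)).
by split; [move=> ->|move/eqP].
Qed.

Lemma circle_piD s t : circle_pi (s + t) = circle_pi s + circle_pi t.
Proof.
exact: (@raddfD _ _ (\pi_(Quotient.quot (GRing.ZmodClosed.clone R (@Num.int_num_subdef R) _)))%qT).
Qed.

Lemma circle_piB s t : circle_pi (s - t) = circle_pi s - circle_pi t.
Proof.
exact: (@raddfB _ _ (\pi_(Quotient.quot (GRing.ZmodClosed.clone R (@Num.int_num_subdef R) _)))%qT).
Qed.

Lemma circle_pi0 : circle_pi 0 = 0 :> circle R.
Proof. by have := circle_piB 0 0; rewrite !subrr. Qed.

Lemma circle_pi1 t : circle_pi (t + 1) = circle_pi t.
Proof. by apply/circle_pi_eq; rewrite addrAC subrr add0r. Qed.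

Lemma circle_repr (x : circle R) : circle_pi (repr x) = x.
Proof. exact: reprK. Qed.

Lemma circle_repr01 (x : circle R) : exists2 t : R, 0 <= t < 1 & circle_pi t = x.
Proof.
exists (repr x - (Num.floor (repr x))%:~R).
  by have := floor_itv (repr x); rewrite intrD; lra.
rewrite -[RHS]circle_repr; apply/circle_pi_eq.
by rewrite addrAC subrr add0r rpredN; exact: intr_int.
Qed.

Definition descend f (x : circle R) : R := f (repr x).

Lemma descend_pi f t : (forall t, f (t + 1) = f t) -> descend f (circle_pi t) = f t.
Proof.
move=> pf; have /circle_pi_eq/intrP[n nE] := circle_repr (circle_pi t).
by rewrite /descend -(subrK t (repr _)) nE addrC periodic_int.
Qed.

Lemma measurable_descend f : cper f -> measurable_fun setT (descend f).
Proof.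
move=> [cf pf]; apply: (measurability _ (RGenOpens.measurableE R)).
move=> _ [_ [x [y ->]] <-]; rewrite setTI; apply: sub_sigma_algebra.
set U := `]x, y[%classic; have oU : open U by exact: interval_open.
rewrite /open/=.
rewrite (_ : _ @^-1` _ = f @^-1` U); first by move/continuousP : cf; exact.
by apply/seteqP; split => t /=; rewrite -[descend f _]/(descend f (circle_pi t)) descend_pi.
Qed.

End circle_basics.

Section test_functions.
Variable R : realType.
Implicit Types (t a b M x : R).

(* A countable family of continuous functions, dense in L^1 of every finite measure. *)
Definition comb (c : rat * seq (rat * (rat * rat * nat))) t : R :=
  ratr c.1 + \sum_(p <- c.2) ratr p.1 * tent (ratr p.2.1.1) (ratr p.2.1.2) p.2.2%:R t.

Lemma cper_comb c : cper (comb c).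
Proof.
apply: cperD; first exact: cper_cst.
by apply: cper_sum => p; apply: cperZ; exact: cper_tent.
Qed.

Definition clip M x : R := Num.max (- M) (Num.min M x).

Lemma clip_le M x : 0 <= M -> `|clip M x| <= M.
Proof.
by move=> M0; rewrite /clip; case: (leP M x) => ?; case: (leP (- M) _) => ?; rewrite ler_norml; lra.
Qed.

Lemma clip_dist M x y : 0 <= M -> `|x| <= M -> `|x - clip M y| <= `|x - y|.
Proof.
move=> M0; rewrite /clip ler_norml => xM.
rewrite ler_norml; have := ler_norm (x - y); have := ler_norm (- (x - y)); rewrite normrN.
by case: (leP M y) => ?; case: (leP (- M) _) => ?; lra.
Qed.

Lemma clip_id M x : `|x| <= M -> clip M x = x.
Proof.
by rewrite /clip ler_norml => xM; case: (leP M x) => ?; case: (leP (- M) _) => ?; lra.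
Qed.

(** Integers that code nothing give the constant 0. Clipping to [[-1, 1]] does not increase the
    distance to a target bounded by 1, so density is kept. *)
Definition test (k : nat) t : R := clip 1 (comb (odflt (0, [::]) (choice.unpickle k)) t).

Lemma cper_test k : cper (test k).
Proof.
have [cc pc] := cper_comb (odflt (0, [::]) (choice.unpickle k)).
split => t; last by rewrite /test pc.
apply: (@continuous_max R R (fun=> - 1) (fun t => Num.min 1 (comb _ t)) t); first exact: cvg_cst.
by apply: (@continuous_min R R (fun=> 1) (fun t => comb _ t) t); [exact: cvg_cst|exact: cc].
Qed.

Lemma test1 k t : `|test k t| <= 1.
Proof. by apply: clip_le; exact: ler01. Qed.

End test_functions.

(** The number of levels [(i + 1) / n] not exceeding [phi x] is the integer part of [n * phi x]. *)
Lemma staircase (R : realType) (T : Type) (phi : T -> R) (n : nat) x : (0 < n)%N -> 0 <= phi x <= 1 ->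
  `|phi x - n%:R^-1 * \sum_(i < n) \1_[set y | i.+1%:R / n%:R <= phi y] x| <= n%:R^-1.
Proof.
move=> n0 /andP[p0 p1]; have nR : 0 < n%:R :> R by rewrite ltr0n.
pose q := Num.truncn (n%:R * phi x); have np : 0 <= n%:R * phi x by rewrite mulr_ge0// ltW.
have /andP[q1 q2] := truncn_itv np.
have qn : (q <= n)%N.
  by rewrite -(ler_nat R) (le_trans q1)// ler_piMr// ltW.
have -> : \sum_(i < n) \1_[set y | i.+1%:R / n%:R <= phi y] x = q%:R :> R.
  rewrite (eq_bigr (fun i : 'I_n => if (i < q)%N then 1 else 0)); last first.
    move=> i _; rewrite indicE; have -> : (x \in [set y | i.+1%:R / n%:R <= phi y]) = (i < q)%N.
      apply/idP/idP; rewrite inE/= ler_pdivrMr// mulrC => H.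
        by have := le_lt_trans H q2; rewrite ltr_nat ltnS.
      by apply: le_trans q1; rewrite ler_nat.
    by case: ifP.
  by rewrite -big_mkcond/= -(big_ord_widen n (fun=> 1) qn) sumr_const card_ord.
have -> : phi x - n%:R^-1 * q%:R = (n%:R * phi x - q%:R) / n%:R by field; rewrite gt_eqF.
rewrite normrM [X in _ * X]ger0_norm ?invr_ge0 ?(ltW nR)// -[leRHS]mul1r ler_pM2r ?invr_gt0//.
by rewrite ler_norml; move: q2; rewrite -natr1; lra.
Qed.

(** * Density of the test functions in L^1 *)

Section density.
Variables (R : realType) (S : {measure set (circle R) -> \bar R}).
Hypothesis Sfin : (S setT < +oo)%E.
Implicit Types (f g h : circle R -> R).

Definition approximable g := forall e : R, 0 < e ->
  exists c, (\int[S]_x `|g x - descend (@comb R c) x|%:E <= e%:E)%E.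

Lemma mdescend_comb c : measurable_fun setT (descend (@comb R c)).
Proof. by apply: measurable_descend; exact: cper_comb. Qed.

Lemma L1_le f g h : measurable_fun setT f -> measurable_fun setT g -> measurable_fun setT h ->
  (forall x, `|f x| <= `|g x| + `|h x|) ->
  (\int[S]_x `|f x|%:E <= \int[S]_x `|g x|%:E + \int[S]_x `|h x|%:E)%E.
Proof.
move=> mf mg mh H; rewrite -ge0_integralD//; last 2 first.
- by apply/measurable_EFinP; exact: measurableT_comp.
- by apply/measurable_EFinP; exact: measurableT_comp.
apply: ge0_le_integral => //.
- by apply/measurable_EFinP; exact: measurableT_comp.
- apply: emeasurable_funD; apply/measurable_EFinP; exact: measurableT_comp.
- by move=> x _; rewrite -EFinD lee_fin.
Qed.

Lemma approx_close g : measurable_fun setT g ->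
  (forall e, 0 < e -> exists h, [/\ measurable_fun setT h, approximable h &
     (\int[S]_x `|g x - h x|%:E <= e%:E)%E]) -> approximable g.
Proof.
move=> mg H e e0; have e2 : 0 < e / 2 by rewrite divr_gt0.
have [h [mh ah gh]] := H _ e2; have [c hc] := ah _ e2; exists c.
apply: (@le_trans _ _ (\int[S]_x `|g x - h x|%:E + \int[S]_x `|h x - descend (comb c) x|%:E)%E).
  apply: (L1_le (f := fun x => g x - descend (comb c) x) (g := fun x => g x - h x)
    (h := fun x => h x - descend (comb c) x)).
  - by apply: measurable_funB => //; exact: mdescend_comb.
  - exact: measurable_funB.
  - by apply: measurable_funB => //; exact: mdescend_comb.
  - by move=> x; exact: ler_distD.
by rewrite [e in leRHS]splitr EFinD leeD.
Qed.

Lemma approx_comb c : approximable (descend (@comb R c)).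
Proof.
move=> e e0; exists c; under eq_integral do rewrite subrr normr0.
by rewrite integral0 lee_fin ltW.
Qed.

Lemma approx_cst (q : rat) : approximable (fun=> ratr q).
Proof.
have := approx_comb (q, [::]); congr approximable; apply/funext => x.
by rewrite /descend /comb/= big_nil addr0.
Qed.

Lemma approxD g h : measurable_fun setT g -> measurable_fun setT h ->
  approximable g -> approximable h -> approximable (fun x => g x + h x).
Proof.
move=> mg mh ag ah e e0; have e2 : 0 < e / 2 by rewrite divr_gt0.
have [c gc] := ag _ e2; have [c' hc] := ah _ e2; exists (c.1 + c'.1, c.2 ++ c'.2).
have E x : descend (comb (c.1 + c'.1, c.2 ++ c'.2)) x = descend (comb c) x + descend (comb c') x.
  by rewrite /descend /comb/= big_cat/= rmorphD; ring.
apply: (@le_trans _ _ (\int[S]_x `|g x - descend (comb c) x|%:E +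
    \int[S]_x `|h x - descend (comb c') x|%:E)%E).
  apply: (L1_le (f := fun x => g x + h x - descend (comb (c.1 + c'.1, c.2 ++ c'.2)) x)
    (g := fun x => g x - descend (comb c) x) (h := fun x => h x - descend (comb c') x)).
  - by apply: measurable_funB; [exact: measurable_funD|exact: mdescend_comb].
  - by apply: measurable_funB => //; exact: mdescend_comb.
  - by apply: measurable_funB => //; exact: mdescend_comb.
  - by move=> x; rewrite E (le_trans _ (ler_normD _ _))// le_eqVlt; apply/orP; left;
      apply/eqP; congr (`|_|); ring.
by rewrite [e in leRHS]splitr EFinD leeD.
Qed.

Lemma approxZ (q : rat) g : measurable_fun setT g -> approximable g ->
  approximable (fun x => ratr q * g x).
Proof.
move=> mg ag e e0; pose k : R := `|ratr q| + 1; have k0 : 0 < k by rewrite ltr_wpDl.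
have [c gc] := ag _ (divr_gt0 e0 k0).
exists (q * c.1, [seq (q * p.1, p.2) | p <- c.2]).
have E x : descend (comb (q * c.1, [seq (q * p.1, p.2) | p <- c.2])) x = ratr q * descend (comb c) x.
  rewrite /descend /comb/= big_map/= mulrDr rmorphM mulr_sumr; congr (_ + _).
  by apply: eq_bigr => p _; rewrite rmorphM mulrA.
apply: (@le_trans _ _ (\int[S]_x (`|ratr q : R|%:E * `|g x - descend (comb c) x|%:E))%E).
  rewrite le_eqVlt; apply/orP; left; apply/eqP; apply: eq_integral => x _.
  by rewrite E -EFinM -normrM mulrBr.
rewrite ge0_integralZl//; last first.
  apply/measurable_EFinP; apply: measurableT_comp => //.
  by apply: measurable_funB => //; exact: mdescend_comb.
apply: (@le_trans _ _ (k%:E * (e / k)%:E)%E).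
  by apply: lee_pmul => //; [exact: integral_ge0|rewrite lee_fin /k lerDl].
by rewrite -EFinM lee_fin mulrCA mulfV ?mulr1// gt_eqF.
Qed.

Lemma approx_sum (I : Type) (r : seq I) (h : I -> circle R -> R) :
  (forall i, measurable_fun setT (h i)) -> (forall i, approximable (h i)) ->
  approximable (fun x => \sum_(i <- r) h i x).
Proof.
move=> mh ah; elim: r => [|i r ih].
  have := approx_cst 0; congr approximable; apply/funext => x; rewrite big_nil; exact: rmorph0.
rewrite (_ : (fun x => _) = fun x => h i x + \sum_(j <- r) h j x).
  by apply: approxD => //; exact: measurable_sum.
by apply/funext => x; rewrite big_cons.
Qed.

(** Dominated convergence: the distances are at most 1 and eventually vanish at each point. *)
Lemma approx_pointwise g (h : nat -> circle R -> R) : measurable_fun setT g ->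
  (forall n, measurable_fun setT (h n)) -> (forall n, approximable (h n)) ->
  (forall n x, `|g x - h n x| <= 1) ->
  (forall x, exists N, forall n, (N <= n)%N -> h n x = g x) -> approximable g.
Proof.
move=> mg mh ah b1 ev; apply: approx_close => // e e0.
have mf n : measurable_fun setT (fun x => `|g x - h n x|%:E).
  by apply/measurable_EFinP; apply: measurableT_comp => //; exact: measurable_funB.
have cv : (\int[S]_x `|g x - h n x|%:E)%E @[n --> \oo] --> 0%E.
  have := @dominated_cvg _ _ _ S setT measurableT (fun n x => `|g x - h n x|%:E)
    (fun=> 0%E) (fun=> 1%E) mf.
  rewrite integral0; apply.
  - move=> x _; have [N HN] := ev x; apply: cvg_near_cst.
    by exists N => // n /= Nn; rewrite HN// subrr normr0.
  - by [].
  - apply/integrableP; split; first exact: measurable_cst.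
    under eq_integral do rewrite abse1.
    by rewrite integral_cst// mul1e.
  - by move=> n x _; rewrite abse_EFin lee_fin normr_id.
have [N _ HN] := cv _ (open_nbhs_nbhs (conj (@open_ereal_lt_ereal R e%:E) (e0 : (0 < e%:E)%E))).
by exists (h N); split => //; apply: ltW; exact: (HN N (leqnn N)).
Qed.

Lemma approx_indic_compl (A : set (circle R)) : measurable A ->
  approximable \1_A -> approximable \1_(~` A).
Proof.
move=> mA aA; have := @approxD (fun=> ratr 1) _ (measurable_cst _) _ (approx_cst 1)
  (@approxZ (-1) _ (measurable_indic mA) aA).
rewrite (_ : (fun x => ratr 1 + _) = \1_(~` A)); last first.
  apply/funext => x; rewrite rmorphN rmorph1 !indicE in_setC; case: (x \in A) => /=; ring.
by apply; exact: measurable_funM.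
Qed.

Lemma approx_indic_bigcup (F : nat -> set (circle R)) : (forall n, measurable (F n)) ->
  trivIset setT F -> (forall n, approximable \1_(F n)) -> approximable \1_(\bigcup_k F k).
Proof.
move=> mF tF aF.
have iE n x : \sum_(i < n) \1_(F i) x = (\1_(\big[setU/set0]_(i < n) F i) x : R).
  elim: n => [|n ih]; first by rewrite !big_ord0 indic0.
  rewrite !big_ord_recr/= ih !indicE in_setU.
  case xU: (x \in \big[setU/set0]_(i < n) F i); case xn: (x \in F n) => //=; rewrite ?add0r ?addr0//.
  exfalso; move/set_mem: xU; move/set_mem: xn => xn; rewrite -bigcup_mkord => -[i /= iN xi].
  have E : i = n by apply: (tF i n I I); exists x.
  by rewrite E ltnn in iN.
apply: (@approx_pointwise _ (fun n x => \sum_(i < n) \1_(F i) x)).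
- by apply: measurable_indic; exact: bigcupT_measurable.
- by move=> n; apply: measurable_sum => i; exact: measurable_indic.
- by move=> n; apply: approx_sum => i //; exact: measurable_indic.
- move=> n x; rewrite iE !indicE ler_norml; case: (_ \in _); case: (_ \in _) => /=; lra.
- move=> x; have [[N _ xN]|nx] := pselect ((\bigcup_k F k) x); last first.
    exists 0%N => n _; rewrite iE !indicE !memNset// -bigcup_mkord => -[i _ xi].
    by apply: nx; exists i.
  exists N.+1 => n Nn; rewrite iE !indicE !mem_set//; first by exists N.
  by rewrite -bigcup_mkord; exists N.
Qed.

(** Defined through a continuous function, so that measurability is immediate; [arcsetE] identifies
    it with an open arc. *)
Definition arcset (a b : R) : set (circle R) := [set x | 0 < descend (tent a b 1) x].

Lemma arcsetE a b t : 0 <= a <= b -> b <= 1 -> 0 <= t < 1 -> arcset a b (circle_pi t) <-> a < t < b.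
Proof.
move=> ab b1 t01; rewrite /arcset/= descend_pi; last exact: (cper_tent _ _ _).2.
split => [|tab].
  by apply: contraPP => H; rewrite (@tent_out _ a b)//; lra.
by have := chord_gt0 ab b1 tab; rewrite /tent mul1r lt_min ltr01/= lt_max => ->; rewrite orbT.
Qed.

Lemma measurable_arcset a b : measurable (arcset a b).
Proof.
rewrite -[arcset _ _]setTI; rewrite (_ : arcset a b = descend (tent a b 1) @^-1` `]0, +oo[).
  by apply: measurable_descend => //; exact: cper_tent.
by apply/seteqP; split => x; rewrite /arcset/= in_itv/= andbT.
Qed.

Definition rat_arcs : set (set (circle R)) :=
  [set A | exists a b : rat, [/\ 0 <= a <= b, b <= 1 & A = arcset (ratr a) (ratr b)]].

Lemma rat_bounds (a b : rat) : 0 <= a <= b -> b <= 1 ->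
  0 <= (ratr a : R) <= ratr b /\ (ratr b : R) <= 1.
Proof.
move=> /andP[a0 ab] b1; rewrite ler0q a0 ler_rat ab; split => //.
by rewrite -(rmorph1 (@ratr R)) ler_rat.
Qed.

Lemma approx_rat_arc A : rat_arcs A -> approximable \1_A.
Proof.
move=> [a [b [ab b1 ->]]]; have [ab' b1'] := rat_bounds ab b1.
have hE n x : descend (comb (0, [:: (1, (a, b, n))])) x = descend (tent (ratr a) (ratr b) (n%:R : R)) x.
  by rewrite /descend /comb/= big_seq1/= rmorph0 rmorph1 add0r mul1r.
apply: (@approx_pointwise _ (fun n => descend (comb (0, [:: (1, (a, b, n))])))).
- by apply: measurable_indic; exact: measurable_arcset.
- by move=> n; exact: mdescend_comb.
- by move=> n; exact: approx_comb.
- move=> n x; rewrite hE indicE ler_norml.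
  by have := tent01 (ratr a) (ratr b) (repr x) (ler0n R n); rewrite /descend; case: (_ \in _) => /=; lra.
move=> x; have [t t01 <-] := circle_repr01 x.
have pb n := (cper_tent (ratr a) (ratr b) (n : R)).2.
have [tab|ntab] := pselect (ratr a < t < ratr b).
  have g0 := chord_gt0 ab' b1' tab.
  exists (Num.truncn (chord (ratr a) (ratr b) t)^-1).+1 => n Nn.
  rewrite hE descend_pi// indicE mem_set; last exact/arcsetE.
  rewrite /tent (max_idPr (ltW g0)); apply/min_idPl.
  rewrite -ler_pdivrMr// div1r.
  have /truncn_itv/andP[_ /ltW/le_trans] : 0 <= (chord (ratr a) (ratr b) t)^-1 by rewrite invr_ge0 ltW.
  by apply; rewrite ler_nat.
exists 0%N => n _; rewrite hE descend_pi// indicE memNset; last by move/arcsetE => /(_ ab' b1' t01).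
by apply: tent_out => //; lra.
Qed.

Lemma rat_arcs_setI : setI_closed rat_arcs.
Proof.
move=> _ _ [a [b [ab b1 ->]]] [a' [b' [ab' b1' ->]]].
have [rab rb] := rat_bounds ab b1; have [rab' rb'] := rat_bounds ab' b1'.
pose a2 := Num.max a a'; pose b2 := Num.max a2 (Num.min b b').
have H1 : 0 <= a2 <= b2 by by move: ab ab'; rewrite /b2 le_max /a2 le_max => /andP[-> _] _; rewrite lexx.
have H2 : b2 <= 1 by by move: ab ab'; rewrite /b2 /a2 !ge_max ge_min b1 => /andP[_ h1] /andP[_ h2]; rewrite (le_trans h1)// (le_trans h2).
have [rab2 rb2] := rat_bounds H1 H2.
exists a2, b2; split => //; apply/seteqP; split => x.
  have [t t01 <-] := circle_repr01 x.
  move=> [/arcsetE H /arcsetE H']; apply/arcsetE => //.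
  have {}H := H rab rb t01; have {}H' := H' rab' rb' t01.
  have h1 : (ratr a2 : R) < t by rewrite /a2; case: (leP a a') => _; lra.
  have h2 : t < (ratr (Num.min b b') : R) by case: (leP b b') => _; lra.
  by rewrite h1 (lt_le_trans h2)// ler_rat /b2 le_max lexx orbT.
have [t t01 <-] := circle_repr01 x; move=> /arcsetE H; have {}H := H rab2 rb2 t01.
suff : (ratr a < t < ratr b) && (ratr a' < t < ratr b').
  by move=> /andP[? ?]; split; exact/arcsetE.
have m1 : (ratr a : R) <= ratr a2 by rewrite ler_rat le_max lexx.
have m2 : (ratr a' : R) <= ratr a2 by rewrite ler_rat le_max lexx orbT.
have [c|c] := leP a2 (Num.min b b').
  have bE : b2 = Num.min b b' by rewrite /b2 (max_idPr c).
  have m3 : (ratr b2 : R) <= ratr b by rewrite ler_rat bE ge_min lexx.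
  have m4 : (ratr b2 : R) <= ratr b' by rewrite ler_rat bE ge_min lexx orbT.
  lra.
have bE : b2 = a2 by rewrite /b2 (max_idPl (ltW c)).
by move: H; rewrite bE; lra.
Qed.

(** Away from the point 0 an open set is the union of the countably many rational arcs it contains;
    the singleton of 0 is the complement of the arc from 0 to 1. *)
Lemma rat_arcs_generate : @measurable _ (circle R) = <<s rat_arcs >>.
Proof.
apply/seteqP; split; last first.
  apply: smallest_sub; first exact: sigma_algebra_measurable.
  by move=> _ [a [b [_ _ ->]]]; exact: measurable_arcset.
apply: smallest_sub; first exact: smallest_sigma_algebra.
move=> U oU.
pose GT := g_sigma_algebraType rat_arcs.
pose F (p : rat * rat) : set (circle R) :=
  if `[< [/\ 0 <= p.1 <= p.2, p.2 <= 1 & arcset (ratr p.1) (ratr p.2) `<=` U] >]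
  then arcset (ratr p.1) (ratr p.2) else set0.
have mF : @measurable _ GT (\bigcup_p F p).
  apply: countable_bigcupT_measurable; first exact: countableP.
  move=> p; rewrite /F; case: asboolP => [[h1 h2 _]|//].
  by apply: sub_sigma_algebra; exists p.1, p.2.
have FU : \bigcup_p F p `<=` U.
  by move=> x [p _]; rewrite /F; case: asboolP => // -[_ _]; exact.
have UF x : U x -> x <> 0 -> (\bigcup_p F p) x.
  have [t /andP[t0 t1] <-] := circle_repr01 x => Ut tn0.
  have {t0}t0 : 0 < t by rewrite lt_neqAle t0 andbT; apply/eqP => z; apply: tn0; rewrite -z circle_pi0.
  have /nbhs_ballP[e/= e0 He] : nbhs t (@circle_pi R @^-1` U) by apply: open_nbhs_nbhs; split.
  have t1t : Num.max 0 (t - e) < t by rewrite gt_max t0; lra.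
  have t2t : t < Num.min 1 (t + e) by rewrite lt_min t1; lra.
  have [a] := rat_in_itvoo t1t; rewrite in_itv/= => /andP[a1 a2].
  have [b] := rat_in_itvoo t2t; rewrite in_itv/= => /andP[b1 b2].
  move: a1 b2; rewrite gt_max lt_min => /andP[a0 ae] /andP[b1' be].
  have a0' : 0 <= a by rewrite -(ler0q R) ltW.
  have ab : a <= b by rewrite -(ler_rat R); lra.
  have b1q : b <= 1 by rewrite -(ler_rat R) rmorph1 ltW.
  have abq : 0 <= a <= b by rewrite a0'.
  have [rab rb] := rat_bounds abq b1q.
  exists (a, b) => //; rewrite /F; case: asboolP => /= [_|nH]; first by apply/arcsetE => //; lra.
  exfalso; apply: nH; split => // y; have [s s01 <-] := circle_repr01 y.
  move/arcsetE => /(_ rab rb s01) sab; apply: He; rewrite /ball/= ltr_distl; lra.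
have m0 : @measurable _ GT [set 0].
  rewrite (_ : [set 0] = ~` arcset 0 1).
    apply: measurableC; apply: sub_sigma_algebra; exists 0, 1.
    by rewrite rmorph0 rmorph1; split => //; rewrite ler01 lexx.
  have h01 : 0 <= (0 : R) <= 1 by rewrite lexx ler01.
  apply/seteqP; split => [_ ->|x] /=.
    have h00 : 0 <= (0 : R) < 1 by rewrite lexx ltr01.
    by rewrite -circle_pi0 => /(arcsetE h01 (lexx 1) h00); rewrite ltxx.
  have [t t01 <-] := circle_repr01 x => H.
  have -> : t = 0; last exact: circle_pi0.
  apply: contrapT => t0; apply: H; apply/arcsetE => //.
  by move/eqP: t0 => t0; move/andP: t01 => [h ->]; rewrite lt_neqAle eq_sym t0 h.
have [U0|U0] := pselect (U 0).
  have -> : U = \bigcup_p F p `|` [set 0]; last exact: (@measurableU _ GT).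
  apply/seteqP; split => [x Ux|x [/FU//|->//]].
  by have [->|/eqP x0] := eqVneq x 0; [right|left; exact: UF].
have -> : U = \bigcup_p F p; last exact: mF.
apply/seteqP; split => [x Ux|x /FU//]; apply: UF => // x0; apply: U0; by rewrite -x0.
Qed.

Lemma approx_indic A : measurable A -> approximable \1_A.
Proof.
move=> mA; have sA := mA; rewrite rat_arcs_generate in sA.
move: sA; apply: (@dynkin_induction _ (circle R) rat_arcs (fun A => approximable \1_A)).
- exact: rat_arcs_generate.
- exact: rat_arcs_setI.
- by have := approx_cst 1; congr approximable; apply/funext => x; rewrite rmorph1 indicE in_setT.
- by move=> B; exact: approx_rat_arc.
- by move=> B; exact: approx_indic_compl.
- by move=> F mF tF; exact: approx_indic_bigcup.
Qed.

Lemma approx_unit g : measurable_fun setT g -> (forall x, 0 <= g x <= 1) -> approximable g.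
Proof.
move=> mg g01; apply: approx_close => // e e0.
pose m := fine (S setT); have Sf : S setT \is a fin_num by rewrite ge0_fin_numE.
have m0 : 0 <= m by exact: fine_ge0.
pose n := (Num.truncn (m / e)).+1.
have nR : 0 < n%:R :> R by rewrite ltr0n.
have mA i : measurable [set y | i.+1%:R / n%:R <= g y].
  rewrite -[X in measurable X]setTI (_ : [set y | _] = g @^-1` `[i.+1%:R / n%:R, +oo[).
    exact: mg.
  by apply/seteqP; split => y /=; rewrite in_itv/= andbT.
have ms : measurable_fun setT (fun x => \sum_(i < n) \1_[set y | i.+1%:R / n%:R <= g y] x : R).
  by apply: measurable_sum => i; exact: measurable_indic.
exists (fun x => n%:R^-1 * \sum_(i < n) \1_[set y | i.+1%:R / n%:R <= g y] x); split.
- exact: measurable_funM.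
- have qE : ratr (n%:R^-1 : rat) = n%:R^-1 :> R by rewrite (fmorphV (@ratr R)) rmorph_nat.
  have := @approxZ (n%:R^-1) _ ms; rewrite qE; apply.
  apply: approx_sum => i; first exact: measurable_indic.
  exact: approx_indic.
apply: (@le_trans _ _ (\int[S]_x (cst (n%:R^-1)%:E x))%E).
  apply: ge0_le_integral => //.
  - apply/measurable_EFinP; apply: measurableT_comp => //; apply: measurable_funB => //.
    exact: measurable_funM.
  - by move=> x _; rewrite lee_fin; exact: staircase.
rewrite integral_cst// -(fineK Sf) -EFinM lee_fin -/m ler_pdivrMl//.
rewrite -ler_pdivrMr//; have /truncn_itv/andP[_ /ltW] : 0 <= m / e by rewrite divr_ge0// ltW.
exact.
Qed.

Lemma test_dense g : measurable_fun setT g -> (forall x, `|g x| <= 1) -> forall e : R, 0 < e ->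
  exists k, (\int[S]_x `|g x - descend (@test R k) x|%:E <= e%:E)%E.
Proof.
move=> mg g1 e e0.
have mg' : measurable_fun setT (fun x => (g x + 1) / 2).
  by apply: measurable_funM => //; exact: measurable_funD.
have : approximable g.
  have g01 x : 0 <= (g x + 1) / 2 <= 1 by have := g1 x; rewrite ler_norml; lra.
  have := approxD _ _ (@approxZ 2 _ mg' (approx_unit mg' g01)) (approx_cst (-1)).
  rewrite (_ : (fun x => ratr 2 * _ + _) = g).
    by apply => //; exact: measurable_funM.
  by apply/funext => x; rewrite rmorphN rmorph1 ratr_nat; field.
move=> /(_ e e0)[c hc]; exists (choice.pickle c); apply: le_trans hc.
have mt : measurable_fun setT (descend (@test R (choice.pickle c))).
  by apply: measurable_descend; exact: cper_test.
apply: ge0_le_integral => //.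
- by apply/measurable_EFinP; apply: measurableT_comp => //; exact: measurable_funB.
- apply/measurable_EFinP; apply: measurableT_comp => //; apply: measurable_funB => //.
  exact: mdescend_comb.
- move=> x _; rewrite lee_fin /descend /test choice.pickleK/=.
  by apply: clip_dist.
Qed.

End density.

(** * Total variation distance through countably many test functions *)

Section total_variation.
Variable R : realType.
Local Notation leb := (@lebesgue_measure R).
Implicit Types (f g : R -> R) (b c s t : R) (phi : circle R -> R).

Definition mbounded f := measurable_fun setT f /\ exists M, forall t, `|f t| <= M.

Lemma itv_finite b c : (leb `[b, c] < +oo)%E.
Proof. by rewrite lebesgue_measure_itv/=; case: ifP; rewrite ?ltry// -EFinB ltry. Qed.

Lemma junif_integrable b c f : mbounded f -> leb.-integrable `[b, c] (EFin \o f).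
Proof.
move=> [mf [M fM]]; apply: measurable_bounded_integrable => //; first exact: itv_finite.
  exact: measurable_funTS.
exists M; split; first exact: num_real.
by move=> x Mx t _; exact: le_trans (ltW Mx).
Qed.

Lemma mboundedB f g : mbounded f -> mbounded g -> mbounded (fun t => f t - g t).
Proof.
move=> [mf [M fM]] [mg [N gN]]; split; first exact: measurable_funB.
by exists (M + N) => t; rewrite (le_trans (ler_normB _ _))// lerD.
Qed.

Lemma mboundedM f g : mbounded f -> mbounded g -> mbounded (fun t => f t * g t).
Proof.
move=> [mf [M fM]] [mg [N gN]]; split; first exact: measurable_funM.
by exists (M * N) => t; rewrite normrM ler_pM.
Qed.

Lemma mbounded_abs f : mbounded f -> mbounded (fun t => `|f t|).
Proof.
by move=> [mf [M fM]]; split; [exact: measurableT_comp|exists M => t; rewrite normr_id].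
Qed.

Lemma mbounded_cst (r : R) : mbounded (fun=> r).
Proof. by split; [exact: measurable_cst|exists `|r|]. Qed.

Lemma junif_le b c f g : mbounded f -> mbounded g -> (forall t, b <= t <= c -> f t <= g t) ->
  junif b c f <= junif b c g.
Proof.
by move=> bf bg fg; apply: le_Rintegral; [|exact: junif_integrable|exact: junif_integrable|].
Qed.

Lemma junifB b c f g : mbounded f -> mbounded g ->
  junif b c (fun t => f t - g t) = junif b c f - junif b c g.
Proof. by move=> bf bg; apply: RintegralB => //; exact: junif_integrable. Qed.

Lemma junif_abs b c f : mbounded f -> `|junif b c f| <= junif b c (fun t => `|f t|).
Proof. by move=> bf; apply: le_normr_Rintegral => //; exact: junif_integrable. Qed.

Lemma junifZ b c (r : R) f : mbounded f -> junif b c (fun t => r * f t) = r * junif b c f.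
Proof. by move=> bf; apply: RintegralZl => //; exact: junif_integrable. Qed.

Lemma junif_cst b c (r : R) : b <= c -> junif b c (fun=> r) = r * (c - b).
Proof.
move=> bc; rewrite /junif Rintegral_cst//; congr (_ * _).
suff E : (leb `[b, c] = (c - b)%:E)%E by exact: (congr1 fine E).
rewrite lebesgue_measure_itv/= lte_fin; case: ltP => [_|cb]; first by rewrite -EFinB.
by have -> : b = c; [lra|rewrite subrr].
Qed.

Lemma junif_EFin b c f : mbounded f -> (junif b c f)%:E = (\int[leb]_(t in `[b, c]) (f t)%:E)%E.
Proof. by move=> bf; rewrite /junif /Rintegral fineK//; apply: integrable_fin_num => //; exact: junif_integrable. Qed.

Lemma mbounded_test k (G : R -> R) : measurable_fun setT G -> mbounded (fun t => test k (G t)).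
Proof.
move=> mG; split; last by exists 1 => t; exact: test1.
by apply: measurableT_comp mG; apply: continuous_measurable_fun; exact: (cper_test R k).1.
Qed.

Lemma mbounded_circle phi M (G : R -> R) : measurable_fun setT phi -> (forall x, `|phi x| <= M) ->
  measurable_fun setT G -> mbounded (fun t => phi (circle_pi (G t))).
Proof.
move=> mp pM mG; split; last by exists M.
by apply: (measurableT_comp mp); apply: (measurableT_comp (@measurable_circle_pi R)).
Qed.

Lemma restr_integral (D : set R) (mD : measurable D) (f : R -> \bar R) :
  measurable_fun setT f -> (forall t, 0 <= f t)%E ->
  (\int[mrestr leb mD]_t f t = \int[leb]_(t in D) f t)%E.
Proof.
move=> mf f0; have := @ge0_negligible_integral _ _ _ (mrestr leb mD) setT (~` D) f
  (measurableC mD) measurableT mf (fun t _ => f0 t).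
have z : mrestr leb mD (~` D) = 0%E by rewrite /mrestr setICl measure0.
move=> /(_ z) ->.
rewrite setTD setCK; apply: eq_measure_integral => A mA AD.
by rewrite -[LHS]/(leb (A `&` D)) setIidl.
Qed.

Definition image_law b c (G : R -> R) (mG : measurable_fun setT (fun t => circle_pi (G t))) :
    {measure set (circle R) -> \bar R} :=
  measure_function_pushforward__canonical__measure_function_Measure
    (mrestr leb (measurable_itv `[b, c])) mG.

Lemma mrestr_fin b c (G : R -> R) (mG : measurable_fun setT (fun t => circle_pi (G t))) :
  (image_law b c mG setT < +oo)%E.
Proof. by rewrite /image_law/= /pushforward /mrestr preimage_setT setTI itv_finite. Qed.

Lemma image_law_integral b c (G : R -> R) (mG : measurable_fun setT (fun t => circle_pi (G t)))
    (f : circle R -> \bar R) : measurable_fun setT f -> (forall x, 0 <= f x)%E ->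
  (\int[image_law b c mG]_x f x = \int[leb]_(t in `[b, c]) f (circle_pi (G t)))%E.
Proof.
move=> mf f0; rewrite /image_law ge0_integral_pushforward//.
rewrite preimage_setT restr_integral//; last by move=> t; exact: f0.
exact: (measurableT_comp mf mG).
Qed.

Lemma measurable_pi (G : R -> R) : measurable_fun setT G ->
  measurable_fun setT (fun t => circle_pi (G t)).
Proof. by move=> mG; apply: (measurableT_comp (@measurable_circle_pi R)). Qed.

(** Density is applied to the sum of the two image measures, so that one index serves both. *)
Lemma test_dense2 b1 c1 b2 c2 (G1 G2 : R -> R) phi : measurable_fun setT G1 -> measurable_fun setT G2 ->
  measurable_fun setT phi -> (forall x, `|phi x| <= 1) -> forall e : R, 0 < e -> exists k,
  junif b1 c1 (fun t => `|phi (circle_pi (G1 t)) - test k (G1 t)|) <= e /\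
  junif b2 c2 (fun t => `|phi (circle_pi (G2 t)) - test k (G2 t)|) <= e.
Proof.
move=> mG1 mG2 mp p1 e e0.
pose S1 := image_law b1 c1 (measurable_pi mG1); pose S2 := image_law b2 c2 (measurable_pi mG2).
pose S : {measure set (circle R) -> \bar R} := measure_add S1 S2.
have Sfin : (S setT < +oo)%E by rewrite -[X in (X < _)%E]/(measure_add S1 S2 setT) measure_addE lte_add_pinfty//; exact: mrestr_fin.
have [k] := test_dense Sfin mp p1 e0; exists k.
have mf : measurable_fun setT (fun x => `|phi x - descend (@test R k) x|%:E).
  apply/measurable_EFinP; apply: measurableT_comp => //; apply: measurable_funB => //.
  by apply: measurable_descend; exact: cper_test.
move: p; rewrite ge0_integral_measure_add// !image_law_integral//.
have E (G : R -> R) t : descend (@test R k) (circle_pi (G t)) = test k (G t).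
  by rewrite descend_pi//; exact: (cper_test R k).2.
under [X in (X + _)%E]eq_integral do rewrite E.
under [X in (_ + X)%E]eq_integral do rewrite E.
have mb (G : R -> R) : measurable_fun setT G -> mbounded (fun t => `|phi (circle_pi (G t)) - test k (G t)|).
  move=> mG; apply: mbounded_abs; apply: mboundedB; last exact: mbounded_test.
  exact: mbounded_circle.
rewrite -!junif_EFin//; [|exact: mb|exact: mb].
rewrite -EFinD lee_fin.
have n1 : 0 <= junif b1 c1 (fun t => `|phi (circle_pi (G1 t)) - test k (G1 t)|) by exact: Rintegral_ge0.
have n2 : 0 <= junif b2 c2 (fun t => `|phi (circle_pi (G2 t)) - test k (G2 t)|) by exact: Rintegral_ge0.
lra.
Qed.

(** A bound on countably many continuous tests extends to all measurable [phi] bounded by 1, by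
    approximating [phi] in L^1 of both image measures at once. *)
Lemma tv_junif b c s d (G1 G2 : R -> R) : 0 <= s -> measurable_fun setT G1 -> measurable_fun setT G2 ->
  (forall k, `|s * junif b c (fun t => test k (G1 t)) - junif 0 1 (fun t => test k (G2 t))| <= d) ->
  forall phi, measurable_fun setT phi -> (forall x, `|phi x| <= 1) ->
  `|s * junif b c (fun t => phi (circle_pi (G1 t))) - junif 0 1 (fun t => phi (circle_pi (G2 t)))| <= d.
Proof.
move=> s0 mG1 mG2 H phi mp p1; apply/ler_addgt0Pr => e e0.
have es : 0 < e / (s + 1) by rewrite divr_gt0// ltr_wpDl.
have [k [h1 h2]] := test_dense2 b c 0 1 mG1 mG2 mp p1 es.
have mb (G : R -> R) : measurable_fun setT G -> mbounded (fun t => phi (circle_pi (G t))).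
  by move=> mG; exact: mbounded_circle.
have D b' c' (G : R -> R) : measurable_fun setT G ->
    `|junif b' c' (fun t => phi (circle_pi (G t))) - junif b' c' (fun t => test k (G t))| <=
    junif b' c' (fun t => `|phi (circle_pi (G t)) - test k (G t)|).
  move=> mG; rewrite -junifB; [|exact: mb|exact: mbounded_test].
  by apply: junif_abs; apply: mboundedB; [exact: mb|exact: mbounded_test].
have d1 := le_trans (D b c _ mG1) h1; have d2 := le_trans (D 0 1 _ mG2) h2.
have := H k.
have d1' : s * `|junif b c (fun t => phi (circle_pi (G1 t))) - junif b c (fun t => test k (G1 t))| <= s * (e / (s + 1)).
  exact: ler_wpM2l.
have eE : s * (e / (s + 1)) + e / (s + 1) = e by field; rewrite gt_eqF// ltr_wpDl.
move: d1' d2; rewrite -{1}(ger0_norm s0) -normrM mulrBr !ler_norml; lra.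
Qed.

Lemma circle_integral phi M : measurable_fun setT phi -> (forall x, `|phi x| <= M) ->
  (\int[circle_lebesgue]_x (phi x)%:E = (junif 0 1 (fun t => phi (circle_pi t)))%:E)%E.
Proof.
move=> mp pM.
have mb : mbounded (fun t => phi (circle_pi t)) by exact: (mbounded_circle mp pM (@measurable_id _ _ setT)).
pose Q := measure_function_pushforward__canonical__measure_function_Measure
    (mrestr leb (measurable_itv `[0, 1[)) (@measurable_circle_pi R).
rewrite (eq_measure_integral Q)//.
have mD : measurable (`[0, 1[%classic : set R) by exact: measurable_itv.
have fi : (mrestr leb mD).-integrable setT ((fun x => (phi x)%:E) \o (@circle_pi R)).
  apply: (@measurable_bounded_integrable _ _ _ (mrestr leb mD) (fun t => phi (circle_pi t))) => //.
  - by rewrite -[X in (X < _)%E]/(leb (setT `&` `[0, 1[)) setTI lebesgue_measure_itv/= lte_fin ltr01 -EFinB ltry.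
  - exact: mb.1.
  - exists M; split; first exact: num_real.
    by move=> y My t _; exact: le_trans (ltW My).
rewrite integral_pushforward//; last exact/measurable_EFinP.
rewrite preimage_setT.
have z : mrestr leb mD (~` `[0, 1[) = 0%E by rewrite /mrestr setICl measure0.
have := @negligible_integral _ _ _ (mrestr leb mD) setT (~` `[0, 1[) _ (measurableC mD) measurableT fi z.
move=> ->; rewrite setTD setCK.
rewrite (eq_measure_integral leb); last by move=> A mA AD; rewrite -[LHS]/(leb (A `&` _)) setIidl.
rewrite junif_EFin// integral_itv_bndo_bndc//.
  by apply/measurable_EFinP; apply: measurable_funTS; exact: mb.1.
exact: measurable_circle_pi.
Qed.

End total_variation.

(** * Nonsingularity of the maps *)

Section nonsingular.
Variables (R : realType) (eps : {posnum R}).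
Implicit Types (f g F G L : R -> R) (J : (R -> R) -> R) (e x t w : R).
Variables (Xi d1 d2 : R -> R) (B alpha a : R).
Hypotheses (cX : cper Xi) (c1 : cper d1) (c2 : cper d2).
Hypotheses (dX : primitive_of Xi d1) (dd1 : primitive_of d1 d2).
Hypotheses (B0 : 0 < B) (B2 : forall t, `|d2 t| <= B).
Hypothesis alpha0 : 0 < alpha.
Variables (del k : R) (M : nat).
Hypotheses (del0 : 0 < del) (del1 : del <= 1).
Hypotheses (k0 : 0 < k) (M0 : (0 < M)%N) (ck : cells d1 d2 k M%:R^-1).
Local Notation leb01 := (@junif R 0 1).

(** Finitely many shells have finite variation, hence bounded density by [UB_of_var_le], and with
    enough shells the residual mass is at most [e]. The constant [C] varies with [e], because the
    density of the image need not be bounded. *)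
Lemma push_abs_cont w e : 0 < e -> exists2 C, 0 <= C & forall g, cper g -> (forall t, 0 <= g t <= 1) ->
  push Xi alpha a w leb01 g <= C * leb01 g + e.
Proof.
move=> e0; have sJ : state eps leb01 := state_junif eps ler01.
have h0 : 0 < (M%:R^-1 : R) by rewrite invr_gt0 ltr0n.
pose K := (1 / M%:R^-1 + 1) * C0 k M%:R^-1.
have K0 : 0 <= K by rewrite mulr_ge0 ?C0_ge0// addr_ge0// divr_ge0// ltW.
have [I HI] : exists I : nat, scale_ del I * K <= e.
  exists (Num.truncn (K / e)).+1; set n := _.+1; rewrite /scale_.
  have p : 0 < 16 ^+ n :> R by rewrite exprn_gt0.
  have : K / e <= n%:R by have /truncn_itv/andP[_ /ltW] : 0 <= K / e by rewrite divr_ge0// ltW.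
  rewrite ler_pdivrMr// => Kn.
  have n16 : n%:R <= 16 ^+ n :> R by rewrite -natrX ler_nat ltnW// ltn_expl.
  rewrite mulrAC ler_pdivrMr//.
  have : del * K <= 1 * K by rewrite ler_wpM2r.
  have : n%:R * e <= 16 ^+ n * e by rewrite ler_pM2r.
  lra.
have ms i : 0 <= mass (shell Xi d1 alpha a del w i leb01).
  by apply: (@mass_ge0 R eps); apply: state_shell.
have vb i := var_le_shell a cX c1 c2 dX dd1 B0 B2 alpha0 del0 sJ w i (@var_le_Leb R).
exists (\sum_(i < I.+1) (mass (shell Xi d1 alpha a del w i leb01) +
   (0 / (alpha * scale_ del i) + 2 * B / (alpha * scale_ del i ^+ 2) * mass leb01))).
  apply: sumr_ge0 => i _; apply: addr_ge0 => //.
  apply: (@var_le_ge0 R eps) (vb i); exact: state_shell.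
move=> g cg g01; rewrite (push_split alpha a cX c1 del0 sJ w I cg) mulr_suml.
have [G dG] := primitive_exists cg.1.
have gE : leb01 g = G 1 - G 0 := junifE ler01 dG cg.1.
apply: lerD.
  apply: ler_sum => i _; rewrite gE.
  apply: (UB_of_var_le (state_shell alpha a cX c1 del0 sJ w i) (vb i) dG cg) => t.
  by have /andP[] := g01 t.
apply: le_trans HI.
have e01 : 0 < scale_ del I <= 1.
  rewrite scale_gt0//= /scale_ ler_pdivrMr ?exprn_gt0// mul1r (le_trans del1)//.
  by rewrite exprn_ege1// ler1n.
have cl : cper (lor d1 (scale_ del I)) by apply: cper_lor => //; exact: scale_gt0.
have [L dL] := primitive_exists cl.1.
have cl' := cper_shift w cl.
have rE : leb01 (fun t => lor d1 (scale_ del I) (t + w)) = L (w + 1) - L w.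
  rewrite [w + 1]addrC -[X in _ = _ - L X]add0r.
  exact: (@junifE _ 0 1 (fun t => L (t + w)) _ ler01 (shift_primitive w dL) cl'.1).
have := lor_interval dd1 k0 h0 ck w e01 dL ler01.
rewrite -rE => H.
apply: (@le_trans _ _ (leb01 (fun t => lor d1 (scale_ del I) (t + w)))); last first.
  by apply: (le_trans H); rewrite /K le_eqVlt; apply/orP; left; apply/eqP; ring.
apply: (st_mono sJ) => //.
  by apply: cperM => //; exact: cper_comp_Fw.
move=> t; have /andP[g0 g1] := g01 (Fw Xi alpha a w t).
by rewrite ler_piMl//; have /andP[] := lor01 d1 (t + w) (scale_gt0 del0 I).
Qed.

(** The indicator of [N] is approximated by one continuous function, in L^1 of Lebesgue measure and
    of its image at once, and [push_abs_cont] is applied to that function. *)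
Lemma push_null w (N : set (circle R)) : measurable N -> circle_lebesgue N = 0%E ->
  leb01 (fun t => \1_N (circle_pi (Fw Xi alpha a w t))) = 0.
Proof.
move=> mN N0; have mF : measurable_fun setT (Fw Xi alpha a w).
  by apply: continuous_measurable_fun; exact: (cper_Fw _ _ cX _).1.
have mI : measurable_fun setT (\1_N : circle R -> R) by exact: measurable_indic.
have I1 (x : circle R) : `|\1_N x : R| <= 1 by rewrite indicE; case: (_ \in _); rewrite ?normr1// normr0 ler01.
have mb (G : R -> R) : measurable_fun setT G -> mbounded (fun t => \1_N (circle_pi (G t)) : R).
  by move=> mG; exact: (mbounded_circle mI I1 mG).
have mid : measurable_fun setT (fun t : R => t) by exact: measurable_id.
have z : leb01 (fun t => \1_N (circle_pi t)) = 0.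
  have := circle_integral mI I1; rewrite integral_indic// setIT => H.
  by have := esym (etrans (esym N0) H); case.
apply/eqP; rewrite eq_le; apply/andP; split; last by apply: Rintegral_ge0 => t _.
apply/ler_addgt0Pr => e e0; rewrite add0r.
have e2 : 0 < e / 2 by rewrite divr_gt0.
have [C C0 HC] := push_abs_cont w e2.
have es : 0 < e / 2 / (C + 1) by rewrite divr_gt0// ltr_wpDl.
have [j [h1 h2]] := test_dense2 0 1 0 1 mid mF mI I1 es.
(* The positive part is no further from an indicator and takes values in [[0, 1]], as
   [push_abs_cont] asks. *)
pose g t := Num.max 0 (test j t) : R.
have cg : cper g.
  have [ct pt] := cper_test R j; split => t; last by rewrite /g pt.
  by apply: (@continuous_max R R (fun=> 0) (test j) t); [exact: cvg_cst|exact: ct].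
have g01 t : 0 <= g t <= 1.
  by rewrite /g le_max lexx/= ge_max ler01/=; have := test1 j t; rewrite ler_norml => /andP[].
have dle (x y : R) : 0 <= x -> `|x - Num.max 0 y| <= `|x - y|.
  move=> x0; have := ler_norm (x - y); have := ler_norm (- (x - y)); rewrite normrN ler_norml.
  by case: (leP 0 y) => ? ? ?; lra.
have key (G : R -> R) : measurable_fun setT G ->
    `|leb01 (fun t => \1_N (circle_pi (G t))) - leb01 (fun t => g (G t))| <=
    leb01 (fun t => `|\1_N (circle_pi (G t)) - test j (G t)|).
  move=> mG; have mg : mbounded (fun t => g (G t)).
    split; last by exists 1 => t; have := g01 (G t); rewrite ler_norml; lra.
    by apply: measurableT_comp mG; apply: continuous_measurable_fun; exact: cg.1.
  rewrite -junifB//; last exact: mb.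
  apply: (le_trans (junif_abs _ _ (mboundedB (mb _ mG) mg))).
  apply: junif_le; [by apply: mbounded_abs; apply: mboundedB => //; exact: mb| |].
    by apply: mbounded_abs; apply: mboundedB; [exact: mb|exact: mbounded_test].
  by move=> t _; apply: dle.
have k1 := le_trans (key _ mid) h1; have k2 := le_trans (key _ mF) h2.
have H := HC g cg g01; rewrite /push in H.
have E : C * (e / 2 / (C + 1)) + e / 2 / (C + 1) = e / 2 by field; rewrite gt_eqF// ltr_wpDl.
have CC : C * leb01 g <= C * (e / 2 / (C + 1)).
  by apply: ler_wpM2l => //; move: k1; rewrite z ler_norml; lra.
move: k2; rewrite ler_norml; lra.
Qed.

End nonsingular.

(** * Kernels from families of measures, and their joint laws *)

Section kernel_of_family.
Context d d' (X : measurableType d) (Y : measurableType d') (R : realType).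
Variable k : X -> set Y -> \bar R.
Hypotheses (k0 : forall x, k x set0 = 0%E) (kge0 : forall x B, (0 <= k x B)%E).
Hypothesis kadd : forall x, semi_sigma_additive (k x).
Hypothesis kmeas : forall B, measurable B -> measurable_fun setT (k ^~ B).
Hypothesis k1 : forall x, k x setT = 1%E.

Definition family_measure x : set Y -> \bar R := k x.

HB.instance Definition _ x := isMeasure.Build _ _ _ (family_measure x) (k0 x) (kge0 x) (@kadd x).

Definition family_kernel x : {measure set Y -> \bar R} := family_measure x.

HB.instance Definition _ := isKernel.Build _ _ _ _ _ family_kernel kmeas.
HB.instance Definition _ := Kernel_isProbability.Build _ _ _ _ _ family_kernel k1.

Lemma family_pker : exists K : R.-pker X ~> Y, forall x B, K x B = k x B.
Proof. by exists family_kernel. Qed.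

End kernel_of_family.

Section kernel_joint.
Context d d' (X : measurableType d) (Y : measurableType d') (R : realType).
Variables (P : probability X R) (K : R.-pker X ~> Y).

Definition kernel_joint (E : set (X * Y)) : \bar R := (\int[P]_x K x (xsection E x))%E.

Lemma measurable_kernel_xsection E : measurable E -> measurable_fun setT (fun x => K x (xsection E x)).
Proof. by move=> mE; apply: measurable_fun_xsection_finite_kernel; rewrite inE. Qed.

Let joint0 : kernel_joint set0 = 0%E.
Proof.
rewrite /kernel_joint; under eq_integral do rewrite xsection0 measure0.
exact: integral0.
Qed.

Let joint_ge0 E : (0 <= kernel_joint E)%E.
Proof. by apply: integral_ge0 => x _; exact: measure_ge0. Qed.

Let joint_add : semi_sigma_additive kernel_joint.
Proof.
move=> F mF tF mU.
have H x : (fun n => \sum_(0 <= i < n) K x (xsection (F i) x))%E @ \oo --> K x (xsection (\bigcup_i F i) x).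
  rewrite xsection_bigcup; apply: measure_semi_sigma_additive.
  - by move=> i; exact: measurable_xsection.
  - exact: trivIset_xsection.
  - by rewrite -xsection_bigcup; exact: measurable_xsection.
have -> : kernel_joint (\bigcup_n F n) = (\int[P]_x limn (fun n => \sum_(0 <= i < n) K x (xsection (F i) x)))%E.
  by apply: eq_integral => x _; apply/esym/cvg_lim.
rewrite monotone_convergence//; last 3 first.
- by move=> n; apply: emeasurable_sum => i; exact: measurable_kernel_xsection.
- by move=> n x _; apply: sume_ge0 => i _; exact: measure_ge0.
- move=> x _ m n mn; apply: lee_sum_nneg_natr => // i _ _; exact: measure_ge0.
apply: cvg_toP; first by apply: is_cvg_nneseries => n _ _; exact: joint_ge0.
congr (limn _); apply/funext => n.
by rewrite -ge0_integral_sum// => i; exact: measurable_kernel_xsection.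
Qed.

HB.instance Definition _ := isMeasure.Build _ _ _ kernel_joint joint0 joint_ge0 joint_add.

Let jointT : kernel_joint setT = 1%E.
Proof.
rewrite /kernel_joint (eq_integral (fun=> 1%E)).
  by rewrite integral_cst// mul1e; exact: probability_setT.
move=> x _; rewrite (_ : xsection setT x = setT); first exact: prob_kernel.
by apply/seteqP; split => y // _; rewrite /xsection/= inE.
Qed.

HB.instance Definition _ := Measure_isProbability.Build _ _ _ kernel_joint jointT.

Lemma joint_law : exists mu : probability (X * Y)%type R,
  (forall E, mu E = \int[P]_x K x (xsection E x))%E /\ disintegrates P K mu.
Proof.
exists kernel_joint; split => // A B mA mB; rewrite /= /kernel_joint [RHS]integral_mkcond.
apply: eq_integral => x _; rewrite patchE; case: ifPn => xA.
  by rewrite in_xsectionX.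
by rewrite notin_xsectionX// measure0.
Qed.

End kernel_joint.

(** * A Borel section of the projection to the circle *)

Section circle_section.
Variable R : realType.

(** [repr] is an arbitrary choice of representative; removing its integer part gives the one in
    [[0, 1)], which depends measurably on the point. *)
Definition sec (x : circle R) : R := repr x - (Num.floor (repr x))%:~R.

Lemma sec01 x : 0 <= sec x < 1.
Proof. by rewrite /sec; have := floor_itv (repr x); rewrite intrD; lra. Qed.

Lemma sec_pi x : circle_pi (sec x) = x.
Proof.
rewrite -[RHS]circle_repr; apply/circle_pi_eq.
by rewrite addrAC subrr add0r rpredN; exact: intr_int.
Qed.

Lemma measurable_sec : measurable_fun setT sec.
Proof.
apply: (measurability _ (RGenInftyO.measurableE R)).
move=> _ [_ [c ->] <-]; rewrite setTI.
have m0 : measurable [set (0 : circle R)].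
  rewrite (_ : [set 0] = ~` arcset 0 1); first by apply: measurableC; exact: measurable_arcset.
  have h01 : 0 <= (0 : R) <= 1 by rewrite lexx ler01.
  apply/seteqP; split => [_ ->|x] /=.
    have h00 : 0 <= (0 : R) < 1 by rewrite lexx ltr01.
    by rewrite -circle_pi0 => /(arcsetE h01 (lexx 1) h00); rewrite ltxx.
  have /andP[h h'] := sec01 x => H.
  rewrite -(sec_pi x); have -> : sec x = 0; last exact: circle_pi0.
  apply: contrapT => /eqP t0; apply: H; rewrite -(sec_pi x).
  apply/(arcsetE h01 (lexx 1) (sec01 x)).
  by rewrite h' lt_neqAle eq_sym t0 h.
have [c0|c0] := leP c 0.
  rewrite (_ : _ @^-1` _ = set0)//; apply/seteqP; split => x //=; rewrite in_itv/=.
  by have := sec01 x; lra.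
have [c1|c1] := leP 1 c.
  rewrite (_ : _ @^-1` _ = setT)//; apply/seteqP; split => x //= _; rewrite in_itv/=.
  by have := sec01 x; lra.
rewrite (_ : _ @^-1` _ = arcset 0 c `|` [set 0]).
  by apply: measurableU => //; exact: measurable_arcset.
have hc : 0 <= (0 : R) <= c by rewrite lexx ltW.
apply/seteqP; split => x /=; rewrite in_itv/=.
  move=> xc; have /andP[h h'] := sec01 x.
  have [x0|x0] := eqVneq (sec x) 0; first by right; rewrite -(sec_pi x) x0 circle_pi0.
  left; rewrite -(sec_pi x); apply/(arcsetE hc (ltW c1)); first by rewrite h.
  by rewrite xc andbT lt_neqAle eq_sym x0 h.
case=> [|->].
  by rewrite -{1}(sec_pi x) => /(arcsetE hc (ltW c1) (sec01 x))/andP[].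
have := sec01 0; have /circle_pi_eq : circle_pi (sec 0) = circle_pi 0 by rewrite sec_pi circle_pi0.
rewrite subr0 => /intrP[n ->]; rewrite ler0z ltrz1 => /andP[n0 n1].
by have -> : n = 0 by lia.
Qed.

End circle_section.

Lemma fine_integral_unit d (T : measurableType d) (R : realType) (m : {measure set T -> \bar R})
    (phi : T -> R) (n : nat) : m setT = 1%E -> measurable_fun setT phi -> (forall x, 0 <= phi x <= 1) ->
  (0 < n)%N -> `|fine (\int[m]_x (phi x)%:E) -
     n%:R^-1 * \sum_(i < n) fine (m [set y | i.+1%:R / n%:R <= phi y])| <= n%:R^-1.
Proof.
move=> m1 mp p01 n0.
have mA i : measurable [set y | i.+1%:R / n%:R <= phi y].
  rewrite -[X in measurable X]setTI (_ : [set y | _] = phi @^-1` `[i.+1%:R / n%:R, +oo[).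
    exact: mp.
  by apply/seteqP; split => y /=; rewrite in_itv/= andbT.
pose s x : R := n%:R^-1 * \sum_(i < n) \1_[set y | i.+1%:R / n%:R <= phi y] x.
have ms : measurable_fun setT s.
  by apply: measurable_funM => //; apply: measurable_sum => i; exact: measurable_indic.
have fin (f : T -> R) : measurable_fun setT f -> (forall x, `|f x| <= 1) -> m.-integrable setT (EFin \o f).
  move=> mf f1; apply: measurable_bounded_integrable => //; first by rewrite m1 ltry.
  exists 1; split; first exact: num_real.
  by move=> M M1 x _; exact: le_trans (f1 x) (ltW M1).
have n1 : n%:R^-1 <= 1 :> R by rewrite invf_le1 ?ltr0n// ler1n.
have st x : `|phi x - s x| <= n%:R^-1 by exact: staircase.
have s1 x : `|s x| <= 1.
  have s0 : 0 <= s x by rewrite mulr_ge0 ?invr_ge0// sumr_ge0// => i _; rewrite indicE.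
  rewrite ger0_norm// /s ler_pdivrMl ?ltr0n// mulr1.
  apply: (@le_trans _ _ (\sum_(i < n) (1 : R))); last by rewrite sumr_const card_ord.
  by apply: ler_sum => i _; rewrite indicE; case: (_ \in _).
have p1 x : `|phi x| <= 1 by have := p01 x; rewrite ler_norml; lra.
have sE : (\int[m]_x s x) = n%:R^-1 * \sum_(i < n) fine (m [set y | i.+1%:R / n%:R <= phi y]).
  rewrite /s RintegralZl//; last first.
    apply: measurable_bounded_integrable => //; first by rewrite m1 ltry.
      by apply: measurable_sum => i; exact: measurable_indic.
    exists n%:R; split; first exact: num_real.
    move=> M M1 x _; apply: le_trans (ltW M1); rewrite ger0_norm ?sumr_ge0//.
    apply: (@le_trans _ _ (\sum_(i < n) (1 : R))); last by rewrite sumr_const card_ord.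
    by apply: ler_sum => i _; rewrite indicE; case: (_ \in _).
  congr (_ * _); rewrite /Rintegral; under eq_integral do rewrite -sumEFin.
  rewrite ge0_integral_sum//; last first.
    by move=> i; apply/measurable_EFinP; exact: measurable_indic.
  rewrite (eq_bigr (fun i : 'I_n => (fine (m [set y | i.+1%:R / n%:R <= phi y]))%:E)).
    by rewrite sumEFin.
  move=> i _; rewrite integral_indic// setIT fineK// ge0_fin_numE//.
  have : (m [set y | (i.+1%:R / n%:R <= phi y)%R] <= m setT)%E.
    by apply: le_measure; rewrite ?inE//; exact: mA.
  by rewrite m1 => /le_lt_trans; apply; rewrite ltry.
rewrite -sE -[fine _]/(\int[m]_x phi x) -RintegralB//; [|exact: fin|exact: fin].
have fd : m.-integrable setT (EFin \o (fun x => phi x - s x)).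
  by apply: fin; [exact: measurable_funB|move=> x; exact: le_trans n1].
apply: (le_trans (le_normr_Rintegral measurableT fd)).
apply: (@le_trans _ _ (\int[m]_x cst (n%:R^-1) x)); last first.
  by rewrite Rintegral_cst// m1 mulr1.
apply: le_Rintegral => //.
- apply: fin; first by apply: measurableT_comp => //; exact: measurable_funB.
  by move=> x; rewrite normr_id; exact: le_trans n1.
- by apply: fin; [exact: measurable_cst|move=> x; rewrite ger0_norm ?invr_ge0].
Qed.

(** Up to an error [1 / n], the integral of [phi] is an average of measures of superlevel sets, so a
    bound uniform over sets passes to functions with the same constant. *)
Lemma setwise_close d (T : measurableType d) (R : realType) (m m' : {measure set T -> \bar R})
    (phi : T -> R) (e : R) : m setT = 1%E -> m' setT = 1%E ->
  (forall B, measurable B -> `|fine (m B) - fine (m' B)| <= e) ->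
  measurable_fun setT phi -> (forall x, 0 <= phi x <= 1) ->
  `|fine (\int[m]_x (phi x)%:E) - fine (\int[m']_x (phi x)%:E)| <= e.
Proof.
move=> m1 m1' H mp p01; apply/ler_addgt0Pr => r r0.
pose n := (Num.truncn (2 / r)).+1; have nR : 0 < n%:R :> R by rewrite ltr0n.
have nr : n%:R^-1 <= r / 2.
  rewrite -[r / 2]invrK lef_pV2 ?posrE ?invr_gt0 ?divr_gt0// invf_div.
  by have /truncn_itv/andP[_ /ltW] : 0 <= 2 / r by rewrite divr_ge0// ltW.
have mA i : measurable [set y | i.+1%:R / n%:R <= phi y].
  rewrite -[X in measurable X]setTI (_ : [set y | _] = phi @^-1` `[i.+1%:R / n%:R, +oo[).
    exact: mp.
  by apply/seteqP; split => y /=; rewrite in_itv/= andbT.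
have h1 := fine_integral_unit m1 mp p01 (ltn0Sn _ : (0 < n)%N).
have h2 := fine_integral_unit m1' mp p01 (ltn0Sn _ : (0 < n)%N).
have h3 : `|n%:R^-1 * \sum_(i < n) fine (m [set y | i.+1%:R / n%:R <= phi y]) -
    n%:R^-1 * \sum_(i < n) fine (m' [set y | i.+1%:R / n%:R <= phi y])| <= e.
  rewrite -mulrBr -sumrB normrM ger0_norm ?invr_ge0 ?(ltW nR)// ler_pdivrMl//.
  apply: (le_trans (ler_norm_sum _ _ _)).
  apply: (@le_trans _ _ (\sum_(i < n) e)); first by apply: ler_sum => i _; exact: H.
  by rewrite sumr_const card_ord mulr_natl.
move: h1 h2 h3; rewrite !ler_norml; lra.
Qed.

Lemma measurable_slice d1 d2 d3 (X : measurableType d1) (Y : measurableType d2) (Z : measurableType d3)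
  (f : X * Y -> Z) : measurable_fun setT f -> forall x, measurable_fun setT (fun y => f (x, y)).
Proof. by move=> mf x; apply: (measurableT_comp mf); apply: measurable_fun_pair. Qed.

Lemma cvg_sum_nat (R : realType) (u : nat -> nat -> R) (l : nat -> R) N :
  (forall i, u i n @[n --> \oo] --> l i) ->
  (fun n => \sum_(0 <= i < N) u i n) @ \oo --> \sum_(0 <= i < N) l i.
Proof.
move=> H; elim: N => [|N ih].
  rewrite (_ : (fun n => _) = fun=> 0); first by rewrite big_geq//; exact: cvg_cst.
  by apply/funext => n; rewrite big_geq.
rewrite (_ : (fun n => _) = fun n => \sum_(0 <= i < N) u i n + u N n).
  by rewrite big_nat_recr//=; exact: cvgD.
by apply/funext => n; rewrite big_nat_recr.
Qed.

(** * The equivariant family of limit measures *)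

Section equivariant_family.
Variables (R : realType) (eps : {posnum R}) (xi : circle R -> R) (a alpha : R).
Local Notation Xi := (fun t : R => xi (circle_pi t)).
Hypothesis cX : cper Xi.
Hypothesis null : forall w (N : set (circle R)), measurable N -> circle_lebesgue N = 0%E ->
  junif 0 1 (fun t => \1_N (circle_pi (Fw Xi alpha a w t)) : R) = 0.
Local Notation F := (@Fn R eps Xi alpha a).
Local Notation th := (@theta R eps).
Local Notation thi := (@theta_inv R eps).
Implicit Types (om : Omega eps) (phi : circle R -> R) (B : set (circle R)).

Lemma fmap_pi w t : Defs.fmap xi a alpha w (circle_pi t) = circle_pi (Fw Xi alpha a w t).
Proof. by rewrite /Defs.fmap /Fw circle_piD. Qed.

Lemma fiter_pi n om t : fiter xi a alpha n om (circle_pi t) = circle_pi (F n om t).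
Proof. by elim: n => //= n ->; rewrite fmap_pi. Qed.

Lemma measurable_fmap : measurable_fun [set: R * circle R] (fun z => Defs.fmap xi a alpha z.1 z.2).
Proof.
rewrite (_ : (fun z => _) = fun z => circle_pi (Fw Xi alpha a z.1 (sec z.2))); last first.
  by apply/funext => z; rewrite -fmap_pi sec_pi.
apply: (measurableT_comp (@measurable_circle_pi R)); rewrite /Fw.
apply: measurable_funD => //; apply: measurable_funM => //.
apply: (measurableT_comp (f := Xi)); first by apply: continuous_measurable_fun; exact: cX.1.
apply: measurable_funD => //.
exact: (measurableT_comp (@measurable_sec R) measurable_snd).
Qed.

Lemma measurable_fmap1 w : measurable_fun setT (Defs.fmap xi a alpha w).
Proof. exact: (measurable_slice measurable_fmap w). Qed.

Lemma measurable_skew : measurable_fun setT (@skew_product R xi a alpha eps).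
Proof.
apply: measurable_fun_pair.
  exact: (measurableT_comp (@measurable_theta R eps) measurable_fst).
apply: (measurableT_comp measurable_fmap (g := fun z : Omega eps * circle R => (noise_at 0 z.1, z.2))).
apply: measurable_fun_pair => //.
exact: (measurableT_comp (@measurable_noise_at R eps 0) measurable_fst).
Qed.

Lemma thetaK om : th (thi om) = om.
Proof. by apply/funext => i; rewrite /theta /theta_inv addrK. Qed.

Lemma theta_invK om : thi (th om) = om.
Proof. by apply/funext => i; rewrite /theta /theta_inv subrK. Qed.

Lemma measurable_iter_theta_inv n : measurable_fun setT (iter n thi).
Proof.
elim: n => [|n ih]; first exact: measurable_id.
exact: (measurableT_comp (@measurable_theta_inv R eps) ih).
Qed.

Lemma measurable_iter_theta n : measurable_fun setT (iter n th).
Proof.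
elim: n => [|n ih]; first exact: measurable_id.
exact: (measurableT_comp (@measurable_theta R eps) ih).
Qed.

Lemma noise_iter_theta_inv n i om : noise_at i (iter n thi om) = noise_at (i - n%:Z) om.
Proof.
elim: n i => [|n ih] i; first by rewrite subr0.
have -> : noise_at i (iter n.+1 thi om) = noise_at (i - 1) (iter n thi om) by [].
by rewrite ih; congr (noise_at _ om); lia.
Qed.

(** The orbit starts [n] steps in the past and ends at time 0: raising [n] inserts a map at the
    start and keeps the last ones, which is why the images can converge. *)
Definition past n om t : R := F n (iter n thi om) t.

Lemma past_theta n om t : past n.+1 (th om) t = Fw Xi alpha a (noise_at 0 om) (past n om t).
Proof.
rewrite /past iterSr theta_invK /=; congr (Fw _ _ _ _ _).
by rewrite noise_iter_theta_inv subrr.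
Qed.

Lemma measurable_F n : measurable_fun [set: Omega eps * R] (fun z => F n z.1 z.2).
Proof. exact: measurable_Fn. Qed.

Lemma measurable_F1 n om : measurable_fun setT (F n om).
Proof. exact: (measurable_slice (measurable_F n) om). Qed.

Lemma measurable_past n : measurable_fun [set: Omega eps * R] (fun z => past n z.1 z.2).
Proof.
apply: (measurableT_comp (measurable_F n) (g := fun z : Omega eps * R => (iter n thi z.1, z.2))).
apply: measurable_fun_pair => //.
exact: (measurableT_comp (measurable_iter_theta_inv n) measurable_fst).
Qed.

(** Both terms are images under the same last [n] maps: of [f_omega] applied to Lebesgue measure,
    and of Lebesgue measure itself. *)
Definition gap n om : \bar R := ereal_sup (range (fun k =>
  `|junif 0 1 (fun t => test k (F n.+1 om t)) - junif 0 1 (fun t => test k (F n (th om) t))|%:E)).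

Lemma junif_test_le k (G : R -> R) : measurable_fun setT G ->
  `|junif 0 1 (fun t => test k (G t))| <= 1.
Proof.
move=> mG; apply: (le_trans (junif_abs _ _ (mbounded_test _ mG))).
have := junif_le (b := 0) (c := 1) (mbounded_abs (mbounded_test k mG)) (mbounded_cst 1).
by rewrite junif_cst// subr0 mul1r; apply => t _; exact: test1.
Qed.

Lemma gap_ge0 n om : (0 <= gap n om)%E.
Proof. by apply: ereal_sup_ge; exists `|junif 0 1 (fun t => test 0 (F n.+1 om t)) -
  junif 0 1 (fun t => test 0 (F n (th om) t))|%:E => //; exists 0%N. Qed.

Lemma gap_le2 n om : (gap n om <= 2%:E)%E.
Proof.
apply: ub_ereal_sup => _ [k _ <-]; rewrite lee_fin (le_trans (ler_normB _ _))//.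
have := junif_test_le k (measurable_F1 n.+1 om); have := junif_test_le k (measurable_F1 n (th om)).
lra.
Qed.

Lemma measurable_gap n : measurable_fun setT (gap n).
Proof.
rewrite (_ : gap n = fun om => esups (fun k => `|junif 0 1 (fun t => test k (F n.+1 om t)) -
    junif 0 1 (fun t => test k (F n (th om) t))|%:E) 0); last first.
  apply/funext => om; rewrite /gap /esups /sdrop; congr ereal_sup.
  by apply/seteqP; split => _ [i _ <-]; exists i.
apply: (measurable_fun_esups (f := fun k om => `|junif 0 1 (fun t => test k (F n.+1 om t)) -
    junif 0 1 (fun t => test k (F n (th om) t))|%:E)).
move=> k; apply/measurable_EFinP; apply: measurableT_comp => //.
have mt : measurable_fun setT (@test R k) by apply: continuous_measurable_fun; exact: (cper_test R k).1.
apply: measurable_funB.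
  apply: (@measurable_junif R 0 1 _ _ (fun om t => test k (F n.+1 om t))).
  exact: (measurableT_comp mt (measurable_F n.+1)).
apply: (@measurable_junif R 0 1 _ _ (fun om t => test k (F n (th om) t))).
apply: (measurableT_comp mt).
apply: (measurableT_comp (measurable_F n) (g := fun z : Omega eps * R => (th z.1, z.2))).
apply: measurable_fun_pair => //.
exact: (measurableT_comp (@measurable_theta R eps) measurable_fst).
Qed.

(** Seen from [n + 1] steps back, the gap compares [past n.+1] with [past n]. *)
Definition step n om : \bar R := gap n (iter n.+1 thi om).
Definition tail n om : \bar R := (\sum_(n <= i <oo) step i om)%E.
Definition rho n phi om : R := junif 0 1 (fun t => phi (circle_pi (past n om t))).

Lemma step_fine n om : step n om = (fine (step n om))%:E.
Proof. by rewrite fineK// ge0_fin_numE ?gap_ge0// (le_lt_trans (gap_le2 _ _))// ltry. Qed.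

Lemma step_ge0 n om : 0 <= fine (step n om).
Proof. by apply: fine_ge0; exact: gap_ge0. Qed.

Lemma measurable_past1 n om : measurable_fun setT (past n om).
Proof. exact: measurable_F1. Qed.

Lemma rho_step n phi om : measurable_fun setT phi -> (forall x, `|phi x| <= 1) ->
  `|rho n.+1 phi om - rho n phi om| <= fine (step n om).
Proof.
move=> mp p1.
have H := @tv_junif R 0 1 1 (fine (step n om)) (past n.+1 om) (past n om) ler01
  (measurable_past1 n.+1 om) (measurable_past1 n om) _ phi mp p1.
move: H; rewrite mul1r; apply => k; rewrite mul1r -lee_fin -step_fine.
by apply: ereal_sup_ubound; exists k => //; rewrite /past iterS thetaK.
Qed.

Lemma rho_diff n m phi om : measurable_fun setT phi -> (forall x, `|phi x| <= 1) ->
  `|rho (n + m) phi om - rho n phi om| <= \sum_(n <= i < n + m) fine (step i om).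
Proof.
move=> mp p1; elim: m => [|m ih]; first by rewrite addn0 subrr normr0 big_geq.
rewrite addnS big_nat_recr ?leq_addr//= (le_trans (ler_distD (rho (n + m) phi om) _ _))//.
by rewrite addrC lerD// rho_step.
Qed.

Lemma tail_ge n m om : (\sum_(n <= i < n + m) fine (step i om))%:E = (\sum_(n <= i < n + m) step i om)%E.
Proof. by rewrite -sumEFin; apply: eq_bigr => i _; rewrite -step_fine. Qed.

Lemma tail_sum_le n m om : ((\sum_(n <= i < n + m) fine (step i om))%:E <= tail n om)%E.
Proof.
have st i : (0 <= step i om)%E by exact: gap_ge0.
rewrite tail_ge /tail (nneseries_split n m)//.
by apply: leeDl; apply: nneseries_ge0 => i _ _; exact: st.
Qed.

Lemma rho_tail n m phi om : measurable_fun setT phi -> (forall x, `|phi x| <= 1) ->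
  (`|rho (n + m) phi om - rho n phi om|%:E <= tail n om)%E.
Proof.
move=> mp p1; apply: le_trans (tail_sum_le n m om); rewrite lee_fin; exact: rho_diff.
Qed.

Lemma tail_split n om : (tail 0 om = (\sum_(0 <= i < n) fine (step i om))%:E + tail n om)%E.
Proof.
have st i : (0 <= step i om)%E by exact: gap_ge0.
rewrite /tail (nneseries_split 0%N n)//; first by rewrite -sumEFin add0n; congr (_ + _)%E; apply: eq_bigr => i _; rewrite -step_fine.
Qed.

Lemma tail_fin n om : (tail 0 om < +oo)%E -> tail n om \is a fin_num.
Proof.
have t0 : (0 <= tail n om)%E by apply: nneseries_ge0 => i _ _; exact: gap_ge0.
by rewrite (tail_split n) ge0_fin_numE// => H; apply: le_lt_trans H; rewrite leeDr// lee_fin sumr_ge0// => i _; exact: step_ge0.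
Qed.

Lemma tail_cvg om : (tail 0 om < +oo)%E -> fine (tail n om) @[n --> \oo] --> 0.
Proof.
move=> H; have := nneseries_tail_cvg (f := fun i => step i om) H (fun i _ => gap_ge0 _ _).
by move/fine_cvgP => [].
Qed.

Lemma rho_is_cvg phi om : (tail 0 om < +oo)%E -> measurable_fun setT phi ->
  (forall x, `|phi x| <= 1) -> cvgn (fun n => rho n phi om).
Proof.
move=> H mp p1.
have E : (fun n => rho n phi om) =
    (fun n => rho 0 phi om + series (fun i => rho i.+1 phi om - rho i phi om) n).
  apply/funext => n; rewrite /series/=; elim: n => [|n ih]; first by rewrite big_geq// addr0.
  by rewrite big_nat_recr//= addrA -ih; ring.
rewrite E; apply: is_cvgD; first exact: is_cvg_cst.
apply: normed_cvg; apply: (@series_le_cvg _ _ (fun i => fine (step i om))) => //.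
- by move=> n; exact: normr_ge0.
- by move=> n; exact: step_ge0.
- by move=> n; exact: rho_step.
apply: nondecreasing_is_cvgn.
  by apply: nondecreasing_series => i _ _; exact: step_ge0.
exists (fine (tail 0 om)) => _ [n _ <-].
have := tail_sum_le 0 n om; rewrite add0n -(fineK (tail_fin 0 H)) lee_fin; exact.
Qed.

Definition Lim phi om : R := limn (fun n => rho n phi om).

Lemma Lim_dist n phi om : measurable_fun setT phi -> (forall x, `|phi x| <= 1) ->
  (tail 0 om < +oo)%E -> `|Lim phi om - rho n phi om| <= fine (tail n om).
Proof.
move=> mp p1 H; have cv := rho_is_cvg H mp p1.
have : `|rho m phi om - rho n phi om| @[m --> \oo] --> `|Lim phi om - rho n phi om|.
  by apply: cvg_norm; apply: cvgB => //; exact: cvg_cst.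
move/cvgP/limr_le => K.
have c2 : `|rho m phi om - rho n phi om| @[m --> \oo] --> `|Lim phi om - rho n phi om|.
  by apply: cvg_norm; apply: cvgB => //; exact: cvg_cst.
rewrite -(cvg_lim _ c2)//; apply: K; exists n => // m /= nm.
by rewrite -lee_fin fineK ?tail_fin// -(subnKC nm); exact: rho_tail.
Qed.

Lemma indic_le1 B x : `|\1_B x : R| <= 1.
Proof. by rewrite indicE; case: (_ \in _); rewrite ?normr1// normr0 ler01. Qed.

Lemma mindic B : measurable B -> measurable_fun setT (\1_B : circle R -> R).
Proof. exact: measurable_indic. Qed.

Definition law n om : {measure set (circle R) -> \bar R} :=
  image_law 0 1 (measurable_pi (measurable_past1 n om)).

Lemma rhoE n phi M om : measurable_fun setT phi -> (forall x, 0 <= phi x <= M) ->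
  (\int[law n om]_x (phi x)%:E = (rho n phi om)%:E)%E.
Proof.
move=> mp p0; rewrite image_law_integral//; last 2 first.
- exact/measurable_EFinP.
- by move=> x; rewrite lee_fin; have /andP[] := p0 x.
rewrite junif_EFin//; apply: (@mbounded_circle _ _ M) => //; last exact: measurable_past1.
by move=> x; have := p0 x; rewrite ler_norml; lra.
Qed.

Lemma rho_indic n B om : measurable B -> (rho n \1_B om)%:E = law n om B.
Proof.
move=> mB; have i01 x : 0 <= (\1_B x : R) <= 1 by rewrite indicE; case: (_ \in _) => /=; lra.
by rewrite -(rhoE n om (mindic mB) i01) integral_indic// setIT.
Qed.

Lemma rho_indicT n om : rho n \1_setT om = 1.
Proof.
rewrite /rho (_ : (fun t : R => _) = fun=> 1); first by rewrite junif_cst// subr0 mul1r.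
by apply/funext => t; rewrite indicE in_setT.
Qed.

Lemma rho_indic_ge0 n B om : 0 <= rho n \1_B om.
Proof. by apply: Rintegral_ge0 => t _. Qed.

Lemma Lim_indic_ge0 B om : (tail 0 om < +oo)%E -> measurable B -> 0 <= Lim \1_B om.
Proof.
move=> H mB; apply: limr_ge; first exact: (rho_is_cvg H (mindic mB) (indic_le1 B)).
by apply: nearW => n; exact: rho_indic_ge0.
Qed.

Lemma Lim_bigsetU (A : nat -> set (circle R)) om N : (tail 0 om < +oo)%E ->
  (forall i, measurable (A i)) -> trivIset setT A ->
  \sum_(0 <= i < N) Lim \1_(A i) om = Lim \1_(\big[setU/set0]_(i < N) A i) om.
Proof.
move=> H mA tA; apply/esym/cvg_lim => //.
have rE n : rho n \1_(\big[setU/set0]_(i < N) A i) om = \sum_(0 <= i < N) rho n \1_(A i) om.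
  apply: EFin_inj; rewrite rho_indic; last by apply: bigsetU_measurable => i _.
  rewrite measure_bigsetU// -sumEFin big_mkord; by apply: eq_bigr => i _; rewrite rho_indic.
under eq_fun do rewrite rE.
by apply: cvg_sum_nat => i; exact: (rho_is_cvg H (mindic (mA i)) (indic_le1 _)).
Qed.

(* Outside the full-measure set where the series of gaps converges, Lebesgue measure
   is used as a default; the absolute value makes the limit manifestly nonnegative. *)
Definition limit_law om B : \bar R :=
  if (tail 0 om < +oo)%E then `|Lim \1_B om|%:E else circle_lebesgue B.

Lemma limit_law0 om : limit_law om set0 = 0%E.
Proof.
rewrite /limit_law; case: ifP => // H; congr (_%:E).
rewrite /Lim (_ : (fun n => _) = fun=> 0); first by rewrite lim_cst// normr0.
by apply/funext => n; rewrite /rho; apply: EFin_inj; rewrite rho_indic// measure0.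
Qed.

Lemma limit_law_ge0 om B : (0 <= limit_law om B)%E.
Proof. by rewrite /limit_law; case: ifP. Qed.

Lemma limit_lawT om : limit_law om setT = 1%E.
Proof.
rewrite /limit_law; case: ifP => [H|_]; last first.
  rewrite /circle_lebesgue preimage_setT setTI lebesgue_measure_itv/= lte_fin ltr01.
  by rewrite -EFinB subr0.
rewrite /Lim (_ : (fun n => _) = fun=> 1); first by rewrite lim_cst// normr1.
by apply/funext => n; exact: rho_indicT.
Qed.

(** The convergence of [rho n] is uniform over sets, with error at most [tail n]; countable
    additivity of the approximating laws therefore passes to the limit. *)
Lemma limit_law_additive om : semi_sigma_additive (limit_law om).
Proof.
have [H|H] := boolP (tail 0 om < +oo)%E; last first.
  rewrite (_ : limit_law om = circle_lebesgue); last by apply/funext => B; rewrite /limit_law (negbTE H).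
  exact: measure_semi_sigma_additive.
move=> A mA tA mU.
have mUN N : measurable (\big[setU/set0]_(i < N) A i) by apply: bigsetU_measurable => i _.
have fE B : measurable B -> limit_law om B = (Lim \1_B om)%:E.
  by move=> mB; rewrite /limit_law H ger0_norm// Lim_indic_ge0.
have E : (fun N => \sum_(0 <= i < N) limit_law om (A i))%E =
    EFin \o (fun N => Lim \1_(\big[setU/set0]_(i < N) A i) om).
  apply/funext => N /=; rewrite -Lim_bigsetU// -sumEFin.
  by apply: eq_bigr => i _; rewrite fE.
rewrite E fE//; apply: cvg_EFin; first exact: nearW.
rewrite (_ : _ \o _ = (fun N => Lim \1_(\big[setU/set0]_(i < N) A i) om)) //.
apply/cvgrPdist_le => e e0.
have e3 : 0 < e / 3 by rewrite divr_gt0.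
have [m _ Hm] := (cvgrPdist_le _ _).1 (tail_cvg H) _ e3.
have {}Hm := Hm m (leqnn m); rewrite /= sub0r normrN in Hm.
have cv : rho m \1_(\big[setU/set0]_(i < N) A i) om @[N --> \oo] --> rho m \1_(\bigcup_i A i) om.
  have := @measure_semi_sigma_additive _ _ _ (law m om) A mA tA mU.
  rewrite -rho_indic// => cv.
  have E2 : (fun n => \sum_(0 <= i < n) law m om (A i))%E =
      (fun n => (rho m \1_(\big[setU/set0]_(i < n) A i) om)%:E).
    by apply/funext => N; rewrite rho_indic// measure_bigsetU// big_mkord.
  by move: cv; rewrite E2 => /fine_cvgP[].
have [N _ HN] := (cvgrPdist_le _ _).1 cv _ e3.
exists N => // n /= Nn; have {}HN := HN n Nn.
have d1 := Lim_dist m (mindic mU) (indic_le1 _) H.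
have d2 := Lim_dist m (mindic (mUN n)) (indic_le1 _) H.
have tm := ler_norm (fine (tail m om)).
move: HN d1 d2; rewrite !ler_norml; lra.
Qed.

Lemma measurable_tail n : measurable_fun setT (tail n).
Proof.
apply: (emeasurable_fun_cvg (fun m om => \sum_(n <= i < m) step i om)%E).
  move=> m; apply: emeasurable_sum => i.
  exact: (measurableT_comp (measurable_gap i) (measurable_iter_theta_inv i.+1)).
by move=> om _; apply: is_cvg_nneseries => i _ _; exact: gap_ge0.
Qed.

Lemma measurable_rho n phi : measurable_fun setT phi -> measurable_fun setT (rho n phi).
Proof.
move=> mp; apply: (@measurable_junif R 0 1 _ _ (fun om t => phi (circle_pi (past n om t)))).
apply: (measurableT_comp mp); apply: (measurableT_comp (@measurable_circle_pi R)).
exact: measurable_past.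
Qed.

Lemma measurable_limit_law B : measurable B -> measurable_fun setT (limit_law ^~ B).
Proof.
move=> mB.
have mt : measurable_fun setT (fun om => (tail 0 om < +oo)%E).
  apply: measurable_fun_lte => //; exact: measurable_tail.
apply: (emeasurable_fun_cvg (fun m om =>
    if (tail 0 om < +oo)%E then `|rho m \1_B om|%:E else circle_lebesgue B)).
  move=> m; apply: measurable_fun_ifT => //.
  by apply/measurable_EFinP; apply: measurableT_comp => //; apply: measurable_rho; exact: mindic.
move=> om _; rewrite /limit_law; case: ifP => H; last exact: cvg_cst.
apply: cvg_EFin; first exact: nearW.
by apply: cvg_norm; exact: (rho_is_cvg H (mindic mB) (indic_le1 _)).
Qed.

(** [past n.+1] at [th om] is [past n] at [om] followed by the map of [om], so the two sequences
    differ by a shift of the index. *)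
Lemma Lim_theta B om : (tail 0 om < +oo)%E -> (tail 0 (th om) < +oo)%E -> measurable B ->
  Lim \1_B (th om) = Lim \1_(Defs.fmap xi a alpha (noise_at 0 om) @^-1` B) om.
Proof.
move=> H H' mB; rewrite /Lim.
have mB' : measurable (Defs.fmap xi a alpha (noise_at 0 om) @^-1` B).
  by rewrite -[X in measurable X]setTI; exact: measurable_fmap1.
have c1 := rho_is_cvg H (mindic mB') (indic_le1 _).
set l := limn _ in c1 *; set u := fun n => rho n \1_B (th om).
suff : (fun n => u n.+1) @ \oo --> l.
  by move=> c2; apply: cvg_lim => //; move: c2; rewrite (cvg_shiftS u (nbhs l)).
rewrite (_ : (fun n => u n.+1) = fun n => rho n \1_(Defs.fmap xi a alpha (noise_at 0 om) @^-1` B) om) //.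
apply/funext => n; rewrite /u /rho; congr (junif 0 1 _); apply/funext => t.
by rewrite past_theta -fmap_pi !indicE.
Qed.

Lemma limit_lawE om B : (tail 0 om < +oo)%E -> limit_law om B = `|Lim \1_B om|%:E.
Proof. by move=> H; rewrite /limit_law H. Qed.

Lemma limit_law_theta B om : (tail 0 om < +oo)%E -> (tail 0 (th om) < +oo)%E -> measurable B ->
  limit_law (th om) B = limit_law om (Defs.fmap xi a alpha (noise_at 0 om) @^-1` B).
Proof.
move=> H H' mB; apply: (etrans (limit_lawE B H')); apply: etrans (esym (limit_lawE _ H)).
exact: (congr1 (fun x : R => `|x|%:E) (Lim_theta H H' mB)).
Qed.

Lemma fmap_null w B : measurable B -> circle_lebesgue B = 0%E ->
  circle_lebesgue (Defs.fmap xi a alpha w @^-1` B) = 0%E.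
Proof.
move=> mB B0; have mB' : measurable (Defs.fmap xi a alpha w @^-1` B).
  by rewrite -[X in measurable X]setTI; exact: measurable_fmap1.
have := circle_integral (mindic mB') (indic_le1 _); rewrite integral_indic// setIT.
move=> E; apply: (etrans E); congr (_%:E); rewrite -[RHS](null w mB B0).
by congr (junif 0 1 _); apply/funext => t; rewrite !indicE -fmap_pi.
Qed.

Lemma F_null n om B : measurable B -> circle_lebesgue B = 0%E ->
  junif 0 1 (fun t => \1_B (circle_pi (F n om t)) : R) = 0.
Proof.
elim: n B => [|n ih] B mB B0.
  have := circle_integral (mindic mB) (indic_le1 _); rewrite integral_indic// setIT.
  by move=> E; have := etrans (esym B0) E; case.
have mB' : measurable (Defs.fmap xi a alpha (noise_at n om) @^-1` B).
  by rewrite -[X in measurable X]setTI; exact: measurable_fmap1.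
rewrite -[RHS](ih _ mB' (fmap_null _ mB B0)); congr (junif 0 1 _); apply/funext => t.
by rewrite /= -fmap_pi !indicE.
Qed.

(** Every approximating law vanishes on Lebesgue-null sets, and convergence on each set preserves
    this. It holds for every [om], the default being Lebesgue measure itself. *)
Lemma limit_law_null om B : measurable B -> circle_lebesgue B = 0%E -> limit_law om B = 0%E.
Proof.
move=> mB B0; rewrite /limit_law; case: ifP => // H; congr (_%:E).
rewrite /Lim (_ : (fun n => _) = fun=> 0); first by rewrite lim_cst// normr0.
by apply/funext => n; exact: F_null.
Qed.

Lemma law1 n om : law n om setT = 1%E.
Proof. by rewrite -rho_indic// rho_indicT. Qed.

Lemma mbounded_past n om phi M : measurable_fun setT phi -> (forall x, `|phi x| <= M) ->
  mbounded (fun t => phi (circle_pi (past n om t))).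
Proof. by move=> mp pM; exact: (mbounded_circle mp pM (measurable_past1 n om)). Qed.

Variable K : R.-pker Omega eps ~> circle R.
Hypothesis KE : forall om B, K om B = limit_law om B.

Lemma K_set_dist n om B : (tail 0 om < +oo)%E -> measurable B ->
  `|fine (K om B) - fine (law n om B)| <= fine (tail n om).
Proof.
move=> H mB; have L0 := Lim_indic_ge0 H mB; rewrite KE limit_lawE// -rho_indic//= (ger0_norm L0).
exact: (Lim_dist n (mindic mB) (indic_le1 _) H).
Qed.

Lemma K_fun_fin om phi M : measurable_fun setT phi -> (forall x, `|phi x| <= M) ->
  (K om).-integrable setT (EFin \o phi).
Proof.
move=> mp pM; apply: measurable_bounded_integrable => //; first by rewrite prob_kernel ltry.
exists M; split; first exact: num_real.
by move=> y My x _; exact: le_trans (ltW My).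
Qed.

(** [setwise_close] concerns values in [[0, 1]], and the rescaling [(phi + 1) / 2] costs the factor
    2. Where the series of gaps diverges the right-hand side is infinite. *)
Lemma K_dist n om phi : measurable_fun setT phi -> (forall x, `|phi x| <= 1) ->
  (`|\int[K om]_x phi x - rho n phi om|%:E <= 2%:E * tail n om)%E.
Proof.
move=> mp p1; have t0 : (0 <= tail n om)%E by apply: nneseries_ge0 => i _ _; exact: gap_ge0.
have [H|H] := ltP (tail 0 om) +oo%E; last first.
  rewrite (_ : tail n om = +oo%E); first by rewrite gt0_muley ?lte_fin// leey.
  move: H; rewrite (tail_split n om) leye_eq => /eqP; case: (tail n om) t0 => //.
have mq : measurable_fun setT (fun x => (phi x + 1) / 2).
  by apply: measurable_funM => //; exact: measurable_funD.
have q01 x : 0 <= (phi x + 1) / 2 <= 1 by have := p1 x; rewrite ler_norml; lra.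
have q1 x : `|(phi x + 1) / 2| <= 1 by have := q01 x; rewrite ler_norml; lra.
have Q := setwise_close (prob_kernel om) (law1 n om) (fun B mB => @K_set_dist n om B H mB) mq q01.
rewrite (rhoE n om mq q01)/= in Q.
have E1 : (\int[K om]_x ((phi x + 1) / 2)) = (\int[K om]_x phi x + 1) / 2.
  rewrite RintegralZr//; last first.
    apply: (@K_fun_fin om _ 2); first exact: measurable_funD.
    by move=> x; rewrite (le_trans (ler_normD _ _))// normr1; have := p1 x; lra.
  rewrite RintegralD//; [|exact: (K_fun_fin om mp p1)|]; last first.
    by apply: (@K_fun_fin om (fun=> 1) 1) => // x; rewrite normr1.
  by rewrite Rintegral_cst// prob_kernel mul1r.
have E2 : rho n (fun x => (phi x + 1) / 2) om = (rho n phi om + 1) / 2.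
  have bp := mbounded_past n om mp p1.
  have := junifB 0 1 bp (mbounded_cst (-1)); rewrite junif_cst// subr0 mulr1 => E.
  have := junifZ 0 1 2^-1 (mboundedB bp (mbounded_cst (-1))); rewrite E opprK => {}E.
  rewrite /rho [RHS]mulrC -E; congr (junif 0 1 _); apply/funext => t; exact: mulrC.
rewrite -(fineK (tail_fin n H)) -EFinM lee_fin.
move: Q; rewrite -[fine _]/(\int[K om]_x ((phi x + 1) / 2)) E1 E2 !ler_norml; lra.
Qed.

Lemma K_null om B : measurable B -> circle_lebesgue B = 0%E -> K om B = 0%E.
Proof. by move=> mB B0; rewrite KE limit_law_null. Qed.

Variable P : probability (Omega eps) R.
Hypothesis HP : is_product_uniform P.
Variables Cg g : R.
Hypotheses (Cg0 : 0 < Cg) (g0 : 0 < g).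
Hypothesis Hgap : forall n, (\int[P]_om gap n om <= (Cg * expR (- g * n%:R))%:E)%E.

Lemma integral_image (h : Omega eps -> Omega eps) (f : Omega eps -> \bar R) :
  measurable_fun setT h -> (forall A, measurable A -> P (h @^-1` A) = P A) ->
  measurable_fun setT f -> (forall om, 0 <= f om)%E -> (\int[P]_om f (h om) = \int[P]_om f om)%E.
Proof.
move=> mh hP mf f0.
pose Q := measure_function_pushforward__canonical__measure_function_Measure P mh.
rewrite [RHS](eq_measure_integral Q); last by move=> A mA _; exact/esym/hP.
by rewrite ge0_integral_pushforward.
Qed.

Lemma iter_image (h : Omega eps -> Omega eps) n : measurable_fun setT h ->
  (forall A, measurable A -> P (h @^-1` A) = P A) ->
  forall A, measurable A -> P (iter n h @^-1` A) = P A.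
Proof.
move=> mh hP; elim: n => [|n ih] A mA //.
have mA' : measurable (h @^-1` A) by rewrite -[X in measurable X]setTI; exact: mh.
by rewrite -[RHS](hP _ mA) -[RHS](ih _ mA').
Qed.

Lemma integral_theta n (f : Omega eps -> \bar R) :
  measurable_fun setT f -> (forall om, 0 <= f om)%E -> (\int[P]_om f (iter n th om) = \int[P]_om f om)%E.
Proof.
apply: integral_image; first exact: measurable_iter_theta.
by apply: iter_image; [exact: measurable_theta|exact: theta_image].
Qed.

Lemma integral_theta_inv n (f : Omega eps -> \bar R) :
  measurable_fun setT f -> (forall om, 0 <= f om)%E -> (\int[P]_om f (iter n thi om) = \int[P]_om f om)%E.
Proof.
apply: integral_image; first exact: measurable_iter_theta_inv.
by apply: iter_image; [exact: measurable_theta_inv|exact: theta_inv_image].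
Qed.

Lemma geometric_sum_le (c q : R) : 0 <= c -> 0 < q < 1 ->
  (\sum_(0 <= i <oo) (c * q ^+ i)%:E <= (c / (1 - q))%:E)%E.
Proof.
move=> c0 /andP[q0 q1]; apply: lime_le.
  by apply: is_cvg_nneseries => i _ _; rewrite lee_fin mulr_ge0// exprn_ge0// ltW.
apply: nearW => n; rewrite sumEFin lee_fin -mulr_sumr ler_wpM2l//.
rewrite -[leRHS]mul1r ler_pdivlMr ?subr_gt0//.
elim: n => [|n ih]; first by rewrite big_geq// mul0r ler01.
have -> : (\sum_(0 <= i < n.+1) q ^+ i) * (1 - q) = 1 - q ^+ n.+1.
  elim: {ih} n => [|n ih]; first by rewrite big_nat1 expr0 expr1 mul1r.
  by rewrite big_nat_recr//= mulrDl ih [in RHS]exprS; ring.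
by rewrite gerBl exprn_ge0// ltW.
Qed.

(** [step i] is [gap i] composed with a power of the inverse shift, which preserves [P]; the means
    are thus bounded by a geometric series. *)
Lemma mean_tail n : (\int[P]_om tail n om <= (Cg / (1 - expR (- g)) * expR (- g * n%:R))%:E)%E.
Proof.
have mst i : measurable_fun setT (step i).
  exact: (measurableT_comp (measurable_gap i) (measurable_iter_theta_inv i.+1)).
rewrite (_ : (fun om => tail n om) = fun om => \sum_(0 <= i <oo) step (i + n) om)%E; last first.
  by apply/funext => om; rewrite (@nneseries_addn R (fun i => step i om) n)// => i; exact: gap_ge0.
rewrite (@integral_nneseries _ _ _ P setT measurableT (fun i => step (i + n)) (fun i => mst _)
  (fun i om _ => gap_ge0 _ _)).
have q01 : 0 < expR (- g) < 1 by rewrite expR_gt0/= -expR0 ltr_expR oppr_lt0.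
have c0 : 0 <= Cg * expR (- g * n%:R) by rewrite mulr_ge0 ?expR_ge0// ltW.
have := geometric_sum_le c0 q01.
have -> : Cg * expR (- g * n%:R) / (1 - expR (- g)) = Cg / (1 - expR (- g)) * expR (- g * n%:R) by ring.
apply: le_trans; apply: lee_nneseries => i; first by move=> _ _; apply: integral_ge0 => om _; exact: gap_ge0.
move=> _; rewrite /step integral_theta_inv; [|exact: measurable_gap|by move=> om; exact: gap_ge0].
apply: (le_trans (Hgap _)); rewrite lee_fin -mulrA ler_pM2l// -expRM_natl -expRD ler_expR natrD.
by rewrite -mulr_natl; lra.
Qed.

Lemma ae_tail_fin : {ae P, forall om, (tail 0 om < +oo)%E}.
Proof.
have t0 om : (0 <= tail 0 om)%E by apply: nneseries_ge0 => i _ _; exact: gap_ge0.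
have it : P.-integrable setT (tail 0).
  apply/integrableP; split; first exact: measurable_tail.
  under eq_integral do rewrite gee0_abs//.
  by rewrite (le_lt_trans (mean_tail 0))// ltry.
have := integrable_ae measurableT it; apply: filterS => om /(_ I).
by rewrite ge0_fin_numE.
Qed.

(** Invariance of [P] under the shift replaces the section at [om] by the one at [th om], and
    equivariance of the family does the rest. *)
Lemma invariant_joint (mu : probability (Omega eps * circle R)%type R) :
  (forall E, mu E = \int[P]_om K om (xsection E om))%E ->
  invariant_measure (skew_product xi a alpha) mu.
Proof.
move=> muE E mE; rewrite !muE.
have mSE : measurable (skew_product xi a alpha @^-1` E).
  by rewrite -[X in measurable X]setTI; exact: measurable_skew.
have mK (E' : set (Omega eps * circle R)) : measurable E' ->
    measurable_fun setT (fun om => K om (xsection E' om)) by exact: measurable_kernel_xsection.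
rewrite -(integral_theta 1 (f := fun om => K om (xsection E om))); [|exact: mK|by move=> om; exact: measure_ge0].
apply: ae_eq_integral => //; first exact: mK.
  exact: (measurableT_comp (mK _ mE) (@measurable_theta R eps)).
(* Equivariance needs convergence at [om] and at [th om]; the latter is almost sure because the
   preimage of a null set under the shift is null. *)
have ae2 : {ae P, forall om, (tail 0 (th om) < +oo)%E}.
  have [N [mN N0 sN]] := ae_tail_fin.
  exists (th @^-1` N); split.
  - by rewrite -[X in measurable X]setTI; exact: measurable_theta.
  - by rewrite theta_image.
  - by move=> om /= H; apply: sN.
move: ae_tail_fin ae2; apply: filterS2 => om H H' _ /=.
have mX : measurable (xsection E (th om)) by exact: measurable_xsection.
by rewrite !KE (limit_law_theta H H' mX); congr (limit_law om _).
Qed.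

End equivariant_family.

(** * Decay of correlations *)

Section cell_decomposition.
Variable R : realType.
Implicit Types (f g psi : R -> R) (b c e : R).

Lemma junif_chain b c e f : mbounded f -> b <= c -> c <= e ->
  junif b e f = junif b c f + junif c e f.
Proof.
move=> bf bc ce; rewrite /junif.
have i1 := junif_integrable b e bf.
have i2 : (@lebesgue_measure R).-integrable `]c, e] (EFin \o f).
  apply: integrableS (junif_integrable c e bf) => //.
  by apply: subset_itvr; rewrite bnd_simp.
have := @Rintegral_itvB R f (BLeft b) (BRight e) c i1 bc ce.
by rewrite Rintegral_itv_obnd_cbnd// => <-; rewrite addrC subrK.
Qed.

Lemma cell_le (m j : nat) : (j%:R / m%:R : R) <= j.+1%:R / m%:R.
Proof. by rewrite ler_wpM2r ?invr_ge0// ler_nat. Qed.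

Lemma junif_cells m f : (0 < m)%N -> mbounded f ->
  junif 0 1 f = \sum_(j < m) junif (j%:R / m%:R) (j.+1%:R / m%:R) f.
Proof.
move=> m0 bf.
have H k : junif 0 (k%:R / m%:R) f = \sum_(j < k) junif (j%:R / m%:R) (j.+1%:R / m%:R) f.
  elim: k => [|k ih]; first by rewrite big_ord0 mul0r /junif set_itv1 Rintegral_set1.
  by rewrite big_ord_recr/= -ih -junif_chain// ?divr_ge0// cell_le.
by rewrite -H divff// pnatr_eq0 -lt0n.
Qed.

Lemma junif_near b c e f g : b <= c -> mbounded f -> mbounded g ->
  (forall t, b <= t <= c -> `|f t - g t| <= e) -> `|junif b c f - junif b c g| <= e * (c - b).
Proof.
move=> bc bf bg H; rewrite -junifB// -junif_cst//.
have bd := mboundedB bf bg.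
apply: (le_trans (junif_abs _ _ bd)); apply: junif_le => //; first exact: mbounded_abs.
exact: mbounded_cst.
Qed.

(* On each of the [m] cells [psi] is replaced by its value at the left endpoint. *)
Lemma cell_decoupling m (N : R) (D : 'I_m -> R) (p psi : R -> R) : (0 < m)%N -> 0 <= N ->
  mbounded p -> (forall t, `|p t| <= 1) ->
  mbounded psi -> (forall t, `|psi t| <= N) -> (forall s t, `|psi s - psi t| <= N * `|s - t|) ->
  (forall j : 'I_m, `|m%:R * junif (j%:R / m%:R) (j.+1%:R / m%:R) p - junif 0 1 p| <= D j) ->
  `|junif 0 1 (fun t => p t * psi t) - junif 0 1 p * junif 0 1 psi| <=
    N * (m%:R^-1 * \sum_j D j + 2 / m%:R).
Proof.
move=> m0 N0 bp p1 bpsi psiN psiL HD.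
have mR : 0 < m%:R :> R by rewrite ltr0n.
have m_neq0 : m%:R != 0 :> R by rewrite gt_eqF.
rewrite (junif_cells m0 (mboundedM bp bpsi)) (junif_cells m0 bpsi).
set A := junif 0 1 p in HD *; pose c (j : 'I_m) := psi (j%:R / m%:R).
pose I (j : 'I_m) f := junif (j%:R / m%:R) (j.+1%:R / m%:R) f.
have len (j : 'I_m) : j.+1%:R / m%:R - j%:R / m%:R = m%:R^-1 :> R.
  by rewrite -mulrBl -natr1 addrC addKr mul1r.
have near (j : 'I_m) t : j%:R / m%:R <= t <= j.+1%:R / m%:R -> `|psi t - c j| <= N * m%:R^-1.
  move=> /andP[t1 t2]; apply: (le_trans (psiL _ _)); apply: ler_wpM2l => //.
  by rewrite ger0_norm ?subr_ge0//; have := len j; lra.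
have h1 (j : 'I_m) : `|I j (fun t => p t * psi t) - c j * I j p| <= N * m%:R^-1 * m%:R^-1.
  have := @junif_near (j%:R / m%:R) (j.+1%:R / m%:R) (N * m%:R^-1) _ _ (cell_le m j)
    (mboundedM bp bpsi) (mboundedM (mbounded_cst (c j)) bp).
  rewrite len junifZ//; apply => t /near H.
  by rewrite [p t * _]mulrC -mulrBl normrM -[leRHS]mulr1; apply: ler_pM.
have h2 (j : 'I_m) : `|I j psi - c j * m%:R^-1| <= N * m%:R^-1 * m%:R^-1.
  have := @junif_near (j%:R / m%:R) (j.+1%:R / m%:R) (N * m%:R^-1) _ _ (cell_le m j)
    bpsi (mbounded_cst (c j)).
  by rewrite junif_cst ?cell_le// len; apply => t /near.
have A1 : `|A| <= 1.
  apply: (le_trans (junif_abs _ _ bp)).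
  have := @junif_le R 0 1 _ _ (mbounded_abs bp) (mbounded_cst 1).
  by rewrite junif_cst// subr0 mul1r; apply => t _.
(* Term by term: the oscillation of [psi] on the cell, the mixing error from that cell, and the
   error of the Riemann sum for [psi]. *)
have -> : \sum_j I j (fun t => p t * psi t) - A * \sum_j I j psi =
    \sum_j ((I j (fun t => p t * psi t) - c j * I j p) + c j * m%:R^-1 * (m%:R * I j p - A)
      - A * (I j psi - c j * m%:R^-1)).
  by rewrite mulr_sumr -sumrB; apply: eq_bigr => j _; field.
apply: (le_trans (ler_norm_sum _ _ _)).
have -> : N * (m%:R^-1 * \sum_j D j + 2 / m%:R) =
    \sum_(j < m) (N * m%:R^-1 * m%:R^-1 + N * m%:R^-1 * D j + N * m%:R^-1 * m%:R^-1).
  rewrite !big_split/= !sumr_const card_ord -!mulr_sumr -[X in X + _ + X]mulr_natl.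
  by field.
apply: ler_sum => j _.
apply: (le_trans (ler_normB _ _)); apply: lerD.
  apply: (le_trans (ler_normD _ _)); apply: lerD => //.
  rewrite normrM; apply: ler_pM => //; last exact: HD.
  by rewrite normrM [X in _ * X <= _]ger0_norm ?invr_ge0// ler_wpM2r ?invr_ge0 ?ler0n//; exact: psiN.
by rewrite normrM -[leRHS]mul1r; apply: ler_pM.
Qed.
End cell_decomposition.

(** * The square-integrable constant *)

Section mixing_constant.
Variables (R : realType) (eps : {posnum R}) (xi : circle R -> R) (a alpha : R).
Local Notation Xi := (fun t : R => xi (circle_pi t)).
Hypothesis cX : cper Xi.
Local Notation F := (@Fn R eps Xi alpha a).
Local Notation th := (@theta R eps).
Local Notation thi := (@theta_inv R eps).
Local Notation tl := (tail xi a alpha).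
Implicit Types (om : Omega eps) (phi : circle R -> R).
Variable P : probability (Omega eps) R.
Hypothesis HP : is_product_uniform P.
Variables Cg g : R.
Hypotheses (Cg0 : 0 < Cg) (g0 : 0 < g).

Definition cell_law (m j : nat) : (R -> R) -> R :=
  stscale m%:R (junif (j%:R / m%:R) (j.+1%:R / m%:R)).
Definition cell_dist n m j om : \bar R := dist Xi alpha a (@test R) n (cell_law m j) (junif 0 1) om.
Hypothesis HI : forall n m j, (0 < m)%N ->
  (\int[P]_om cell_dist n m j om <= (Cg * expR (- g * n%:R) * m%:R)%:E)%E.
Hypothesis Htail : forall n, (\int[P]_om tl n om <= (Cg * expR (- g * n%:R))%:E)%E.

Lemma state_cell m j : state eps (cell_law m j).
Proof. by apply: state_scale => //; apply: state_junif; exact: cell_le. Qed.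

Lemma mass_cell m j : (0 < m)%N -> mass (cell_law m j) = 1.
Proof.
move=> m0; rewrite /mass /cell_law /stscale -/(mass (junif _ _)) mass_junif_itv ?cell_le// -natr1.
by field; rewrite pnatr_eq0 -lt0n.
Qed.

Lemma cell_dist_ge0 n m j om : (0 <= cell_dist n m j om)%E.
Proof. exact: dist_ge0. Qed.

Lemma measurable_cell_dist n m j : measurable_fun setT (cell_dist n m j).
Proof.
apply: (measurable_dist alpha a cX (@cper_test R)); first exact: state_cell.
exact: (state_junif eps ler01).
Qed.

Lemma cell_dist_le2 n m j om : (0 < m)%N -> (cell_dist n m j om <= 2%:E)%E.
Proof.
move=> m0; apply: ub_ereal_sup => _ [k _ <-]; rewrite lee_fin.
have cf : cper (fun t => test k (F n om t)) by apply: cper_Fn => //; exact: cper_test.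
have f1 t : `|test k (F n om t)| <= 1 by exact: test1.
have h1 := st_norm1 (state_cell m j) cf f1.
have h2 := st_norm1 (state_junif eps ler01) cf f1.
rewrite mass_cell// in h1; rewrite mass_junif in h2.
by rewrite (le_trans (ler_normB _ _))//; lra.
Qed.

(** With [m] cells the mean error is of order [m e^(-g n)] from mixing and [1 / m] from
    discretisation; [m] of order [e^(g n / 2)] balances them. *)
Definition ncells n : nat := (Num.truncn (expR (g / 2 * n%:R))).+1.

Lemma ncells_bounds n : expR (g / 2 * n%:R) <= ((ncells n)%:R : R) <= 2 * expR (g / 2 * n%:R).
Proof.
have e1 : 1 <= expR (g / 2 * n%:R) by rewrite -expR0 ler_expR mulr_ge0// ltW// divr_gt0.
have /truncn_itv/andP[h1 h2] : 0 <= expR (g / 2 * n%:R) by exact: expR_ge0.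
by rewrite (ltW h2)/= /ncells -natr1; lra.
Qed.

Definition cell_error n om : \bar R :=
  (((ncells n)%:R^-1)%:E * \sum_(j < ncells n) cell_dist n (ncells n) j om + (2 / (ncells n)%:R)%:E)%E.

Lemma sum_ivl_ge0 n m om : (0 <= \sum_(j < m) cell_dist n m j om)%E.
Proof. by apply: sume_ge0 => j _; exact: cell_dist_ge0. Qed.

Lemma cell_error_ge0 n om : (0 <= cell_error n om)%E.
Proof. by apply: adde_ge0; [apply: mule_ge0; [rewrite lee_fin|exact: sum_ivl_ge0]|rewrite lee_fin]. Qed.

Lemma measurable_sum_cell_dist n m : measurable_fun setT (fun om => \sum_(j < m) cell_dist n m j om)%E.
Proof. by apply: emeasurable_sum => j; exact: measurable_cell_dist. Qed.

Lemma measurable_cell_error n : measurable_fun setT (cell_error n).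
Proof. by apply: emeasurable_funD => //; apply: measurable_funeM; exact: measurable_sum_cell_dist. Qed.

Lemma mean_cell_error n : (\int[P]_om cell_error n om <= ((2 * Cg + 2) * expR (- (g / 2) * n%:R))%:E)%E.
Proof.
have m0 : 0 < (ncells n)%:R :> R by rewrite ltr0n.
have /andP[b1 b2] := ncells_bounds n.
have i0 : 0 <= (ncells n)%:R^-1 :> R by rewrite invr_ge0 ltW.
have ms := measurable_sum_cell_dist n (ncells n).
have q0 om : setT om -> (0 <= ((ncells n)%:R^-1)%:E * \sum_(j < ncells n) cell_dist n (ncells n) j om)%E.
  by move=> _; apply: mule_ge0; [rewrite lee_fin|exact: sum_ivl_ge0].
have mq : measurable_fun setT (fun om => ((ncells n)%:R^-1)%:E * \sum_(j < ncells n) cell_dist n (ncells n) j om)%E.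
  exact: measurable_funeM.
have r0 om : setT om -> (0 <= (2 / (ncells n)%:R)%:E :> \bar R)%E by rewrite lee_fin.
rewrite /cell_error (ge0_integralD P measurableT q0 mq r0 (measurable_cst _)).
rewrite ge0_integralZl//; last by move=> om _; exact: sum_ivl_ge0.
rewrite ge0_integral_sum//; [|by move=> j; exact: measurable_cell_dist|by move=> j om _; exact: cell_dist_ge0].
have intc (r : R) : (\int[P]_om r%:E = r%:E)%E.
  rewrite -[RHS]mule1 -(probability_setT P); exact: integral_cst.
rewrite intc.
apply: (@le_trans _ _ ((ncells n)%:R^-1%:E * \sum_(j < ncells n) (Cg * expR (- g * n%:R) * (ncells n)%:R)%:E +
    (2 / (ncells n)%:R)%:E)%E).
  by apply: leeD => //; apply: lee_wpmul2l; [rewrite lee_fin|apply: lee_sum => j _; exact: HI].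
have -> : (\sum_(j < ncells n) (Cg * expR (- g * n%:R) * (ncells n)%:R)%:E =
    ((ncells n)%:R * (Cg * expR (- g * n%:R) * (ncells n)%:R))%:E)%E.
  by rewrite sumEFin sumr_const card_ord mulr_natl.
rewrite -EFinM -EFinD lee_fin mulKf ?gt_eqF//.
have E0 := expR_gt0 (g / 2 * n%:R).
have iE : (ncells n)%:R^-1 <= expR (- (g / 2) * n%:R).
  by rewrite mulNr expRN lef_pV2// posrE.
have EE : expR (- g * n%:R) * expR (g / 2 * n%:R) = expR (- (g / 2) * n%:R).
  by rewrite -expRD; congr expR; field.
have eg : 0 <= Cg * expR (- g * n%:R) by rewrite mulr_ge0 ?expR_ge0// ltW.
have := ler_wpM2l eg b2.
have -> : Cg * expR (- g * n%:R) * (2 * expR (g / 2 * n%:R)) = 2 * Cg * expR (- (g / 2) * n%:R).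
  by rewrite -EE; ring.
lra.
Qed.

(** The first half serves the formula that ends at [theta^n omega], the second the one that starts
    at [theta^-n omega]; a single variable controls both. *)
Definition total_error n om : \bar R :=
  (cell_error n om + 2%:E * tl n (iter n th om) + (cell_error n (iter n thi om) + 2%:E * tl n om))%E.

Lemma tl_ge0 n om : (0 <= tl n om)%E.
Proof. by apply: nneseries_ge0 => i _ _; exact: gap_ge0. Qed.

Lemma tl2_ge0 n om : (0 <= 2%:E * tl n om)%E.
Proof. by rewrite mule_ge0 ?lee_fin//; exact: tl_ge0. Qed.

Lemma total_error_ge0 n om : (0 <= total_error n om)%E.
Proof.
by apply: adde_ge0; apply: adde_ge0; [exact: cell_error_ge0|exact: tl2_ge0|exact: cell_error_ge0|exact: tl2_ge0].
Qed.

Lemma measurable_tl n : measurable_fun setT (fun om => 2%:E * tl n om)%E.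
Proof. by apply: measurable_funeM; exact: measurable_tail. Qed.

Lemma measurable_total_error n : measurable_fun setT (total_error n).
Proof.
apply: emeasurable_funD; apply: emeasurable_funD.
- exact: measurable_cell_error.
- exact: (measurableT_comp (measurable_tl n) (@measurable_iter_theta R eps n)).
- exact: (measurableT_comp (measurable_cell_error n) (@measurable_iter_theta_inv R eps n)).
- exact: measurable_tl.
Qed.

Definition error_const : R := 4 * Cg + 4 + 4 * Cg.

Lemma mean_total_error n : (\int[P]_om total_error n om <= (error_const * expR (- (g / 2) * n%:R))%:E)%E.
Proof.
have mY := measurable_cell_error n; have mt := measurable_tl n.
have mYi : measurable_fun setT (fun om => cell_error n (iter n thi om)).
  exact: (measurableT_comp mY (@measurable_iter_theta_inv R eps n)).
have mti : measurable_fun setT (fun om => 2%:E * tl n (iter n th om))%E.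
  exact: (measurableT_comp mt (@measurable_iter_theta R eps n)).
have It : (\int[P]_om (2%:E * tl n om) <= (2 * (Cg * expR (- (g / 2) * n%:R)))%:E)%E.
  rewrite ge0_integralZl//; [|exact: measurable_tail|by move=> om _; exact: tl_ge0].
  rewrite EFinM; apply: lee_wpmul2l; first by rewrite lee_fin.
  apply: (le_trans (Htail n)); rewrite lee_fin ler_pM2l// ler_expR ler_wpM2r// lerN2.
  by have G0 := g0; lra.
have y0 om : setT om -> (0 <= cell_error n om)%E by move=> _; exact: cell_error_ge0.
have yi0 om : setT om -> (0 <= cell_error n (iter n thi om))%E by move=> _; exact: cell_error_ge0.
have t0 om : setT om -> (0 <= 2%:E * tl n om)%E by move=> _; exact: tl2_ge0.
have ti0 om : setT om -> (0 <= 2%:E * tl n (iter n th om))%E by move=> _; exact: tl2_ge0.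
have f0 om : setT om -> (0 <= cell_error n om + 2%:E * tl n (iter n th om))%E.
  by move=> _; apply: adde_ge0; [exact: cell_error_ge0|exact: tl2_ge0].
have h0 om : setT om -> (0 <= cell_error n (iter n thi om) + 2%:E * tl n om)%E.
  by move=> _; apply: adde_ge0; [exact: cell_error_ge0|exact: tl2_ge0].
have mf := emeasurable_funD mY mti; have mh := emeasurable_funD mYi mt.
have eqle (x y z : \bar R) : x = y -> (y <= z)%E -> (x <= z)%E by move=> ->.
have IYi : (\int[P]_om cell_error n (iter n thi om) <= ((2 * Cg + 2) * expR (- (g / 2) * n%:R))%:E)%E.
  exact: eqle (integral_theta_inv HP n mY (cell_error_ge0 n)) (mean_cell_error n).
have Iti : (\int[P]_om (2%:E * tl n (iter n th om)) <= (2 * (Cg * expR (- (g / 2) * n%:R)))%:E)%E.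
  exact: eqle (integral_theta HP n mt (tl2_ge0 n)) It.
have I1 := eqle _ _ _ (ge0_integralD P measurableT y0 mY ti0 mti) (leeD (mean_cell_error n) Iti).
have I2 := eqle _ _ _ (ge0_integralD P measurableT yi0 mYi t0 mt) (leeD IYi It).
apply: eqle (ge0_integralD P measurableT f0 mf h0 mh) _.
apply: le_trans (leeD I1 I2) _.
by rewrite -!EFinD lee_fin /error_const; lra.
Qed.

(** Normalised correlation errors never exceed 2, so the cap loses nothing; it turns a bound on the
    mean into one on the second moment, by [Z^2 <= 2 Z]. *)
Definition capped_error n om : R := fine (mine 2%:E (total_error n om)).

Lemma capped_errorE n om : (capped_error n om)%:E = mine 2%:E (total_error n om).
Proof.
rewrite /capped_error fineK// ge0_fin_numE.
  by rewrite (@le_lt_trans _ _ 2%:E)// ?ltry// ge_min lexx.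
by rewrite le_min total_error_ge0 andbT lee_fin.
Qed.

Lemma capped_error_bounds n om : 0 <= capped_error n om <= 2.
Proof. by rewrite -!lee_fin capped_errorE le_min total_error_ge0 lee_fin ler0n/= ge_min lexx. Qed.

Lemma measurable_capped_error n : measurable_fun setT (capped_error n).
Proof.
apply: (measurableT_comp (f := fine)) => //.
by apply: measurable_mine; [exact: measurable_cst|exact: measurable_total_error].
Qed.

(** The weight uses half of the mean decay [e^(-g n / 2)]; the other half makes the series
    summable. *)
Definition weighted_error n om : R := expR (g / 4 * n%:R) * capped_error n om ^+ 2.

Lemma weighted_error_ge0 n om : 0 <= weighted_error n om.
Proof. by rewrite mulr_ge0 ?expR_ge0 ?sqr_ge0. Qed.

Lemma measurable_weighted_error n : measurable_fun setT (weighted_error n).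
Proof. by apply: measurable_funM => //; apply: measurable_funX; exact: measurable_capped_error. Qed.

Lemma mean_weighted_error n : (\int[P]_om (weighted_error n om)%:E <= (2 * error_const * expR (- (g / 4)) ^+ n)%:E)%E.
Proof.
apply: (@le_trans _ _ (\int[P]_om ((expR (g / 4 * n%:R) * 2)%:E * total_error n om))%E).
  apply: ge0_le_integral => //.
  - by move=> om _; rewrite lee_fin; exact: weighted_error_ge0.
  - by apply/measurable_EFinP; exact: measurable_weighted_error.
  - by apply: measurable_funeM; exact: measurable_total_error.
  - move=> om _; rewrite /weighted_error EFinM (EFinM (expR _) 2) -muleA; apply: lee_wpmul2l; first by rewrite lee_fin expR_ge0.
    have /andP[z0 z2] := capped_error_bounds n om.
    apply: (@le_trans _ _ (2%:E * (capped_error n om)%:E)%E); first by rewrite -EFinM lee_fin expr2 ler_wpM2r.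
    by apply: lee_wpmul2l; [rewrite lee_fin|rewrite capped_errorE ge_min lexx orbT].
rewrite ge0_integralZl//; last 2 first.
- exact: measurable_total_error.
- by move=> om _; exact: total_error_ge0.
have e0 : (0 <= (expR (g / 4 * n%:R) * 2)%:E :> \bar R)%E by rewrite lee_fin mulr_ge0 ?expR_ge0.
apply: (le_trans (lee_wpmul2l e0 (mean_total_error n))).
rewrite -EFinM lee_fin -expRM_natl.
have -> : expR (n%:R * - (g / 4)) = expR (g / 4 * n%:R) * expR (- (g / 2) * n%:R).
  by rewrite -expRD; congr expR; field.
by rewrite le_eqVlt; apply/orP; left; apply/eqP; ring.
Qed.

Definition weight om : \bar R := (\sum_(0 <= n <oo) (weighted_error n om)%:E)%E.

Lemma weighted_error_ge0E n om : (0 <= (weighted_error n om)%:E)%E.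
Proof. by rewrite lee_fin weighted_error_ge0. Qed.

Lemma weight_ge0 om : (0 <= weight om)%E.
Proof. by apply: nneseries_ge0 => n _ _; exact: weighted_error_ge0E. Qed.

Lemma measurable_weight : measurable_fun setT weight.
Proof.
apply: (ge0_emeasurable_sum (D := setT) (h := fun n om => (weighted_error n om)%:E) (P := xpredT)).
  by move=> n om _ _; exact: weighted_error_ge0E.
by move=> n _; apply/measurable_EFinP; exact: measurable_weighted_error.
Qed.

Lemma mean_weight : (\int[P]_om weight om < +oo)%E.
Proof.
rewrite /weight (@integral_nneseries _ _ _ P setT measurableT (fun n om => (weighted_error n om)%:E)
  (fun n => measurableT_comp (@EFin_measurable R setT) (measurable_weighted_error n)) (fun n om _ => weighted_error_ge0E n om)).
have q01 : 0 < expR (- (g / 4)) < 1.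
  by rewrite expR_gt0/= -expR0 ltr_expR oppr_lt0 divr_gt0.
have c0 : 0 <= 2 * error_const by rewrite /error_const; have h := Cg0; lra.
apply: le_lt_trans (ltry _); apply: le_trans (geometric_sum_le c0 q01).
apply: lee_nneseries => n; last by move=> _; exact: mean_weighted_error.
by move=> _ _; apply: integral_ge0 => om _; exact: weighted_error_ge0E.
Qed.

Lemma ae_weight_fin : {ae P, forall om, (weight om < +oo)%E}.
Proof.
have it : P.-integrable setT weight.
  apply/integrableP; split; first exact: measurable_weight.
  by under eq_integral do rewrite (gee0_abs (weight_ge0 _)); exact: mean_weight.
have := integrable_ae measurableT it; apply: filterS => om /(_ I).
by rewrite (ge0_fin_numE (weight_ge0 om)).
Qed.

(** The square root of a sum of terms [e^(g n / 4) Z_n^2] gives [Z_n <= C e^(-g n / 8)], the final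
    rate. Where the series diverges, a null event, [fine] returns 0. *)
Definition mixing om : R := Num.sqrt (fine (weight om)).

Lemma capped_error_mixing n om : (weight om < +oo)%E -> capped_error n om <= mixing om * expR (- (g / 8) * n%:R).
Proof.
move=> H; have wfin : weight om \is a fin_num by rewrite (ge0_fin_numE (weight_ge0 om)).
have le1 : weighted_error n om <= fine (weight om).
  rewrite -lee_fin fineK//.
  have := @nneseries_lim_ge R (fun i => (weighted_error i om)%:E) xpredT 0 n.+1 (fun i _ _ => weighted_error_ge0E i om).
  apply: le_trans; rewrite big_nat_recr//= leeDr//.
  by apply: sume_ge0 => i _; exact: weighted_error_ge0E.
have /andP[z0 _] := capped_error_bounds n om.
rewrite -(@ler_pXn2r _ 2)// ?nnegrE// ?mulr_ge0 ?expR_ge0 ?sqrtr_ge0//.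
rewrite exprMn sqr_sqrtr; last by apply: fine_ge0; exact: weight_ge0.
have -> : expR (- (g / 8) * n%:R) ^+ 2 = expR (- (g / 4 * n%:R)).
  by rewrite -expRM_natl; congr expR; field.
have -> : capped_error n om ^+ 2 = weighted_error n om * expR (- (g / 4 * n%:R)).
  by rewrite /weighted_error mulrAC -expRD subrr expR0 mul1r.
by rewrite ler_wpM2r ?expR_ge0.
Qed.

Lemma measurable_mixing : measurable_fun setT mixing.
Proof.
apply: (measurableT_comp (f := @Num.sqrt R)).
  by apply: continuous_measurable_fun; exact: sqrt_continuous.
by apply: (measurableT_comp (f := fine)) => //; exact: measurable_weight.
Qed.

Lemma mixing_Lfun : mixing \in Lfun P 2%:E.
Proof.
rewrite inE; apply/andP; split; rewrite inE/=; first exact: measurable_mixing.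
rewrite /finite_norm unlock; apply: poweR_lty.
rewrite (_ : (fun om => _) = fun om => (mixing om ^+ 2)%:E)%E; last first.
  by apply/funext => om /=; rewrite powR_mulrn// real_normK// num_real.
apply: le_lt_trans mean_weight; apply: ge0_le_integral => //.
- by move=> om _; rewrite lee_fin sqr_ge0.
- by apply/measurable_EFinP; apply: measurable_funX; exact: measurable_mixing.
- exact: measurable_weight.
move=> om _; rewrite /mixing sqr_sqrtr; last by apply: fine_ge0; exact: weight_ge0.
have := weight_ge0 om; case: (weight om) => [r||]//= _; exact: leey.
Qed.

Lemma Y_bound n om phi (psi : R -> R) N : measurable_fun setT phi -> (forall x, `|phi x| <= 1) ->
  measurable_fun setT psi -> (forall t, `|psi t| <= N) -> (forall s t, `|psi s - psi t| <= N * `|s - t|) ->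
  (`|junif 0 1 (fun t => phi (circle_pi (F n om t)) * psi t) -
     junif 0 1 (fun t => phi (circle_pi (F n om t))) * junif 0 1 psi|%:E <= N%:E * cell_error n om)%E.
Proof.
move=> mp p1 mpsi psiN psiL.
have N0 : 0 <= N := le_trans (normr_ge0 _) (psiN 0).
have m0 : (0 < ncells n)%N by [].
have mF := @measurable_F1 R eps xi a alpha cX n om.
have ifin (j : 'I_(ncells n)) : cell_dist n (ncells n) j om = (fine (cell_dist n (ncells n) j om))%:E.
  by rewrite fineK// ge0_fin_numE ?cell_dist_ge0// (le_lt_trans (cell_dist_le2 _ _ _ m0))// ltry.
have bp : mbounded (fun t => phi (circle_pi (F n om t))) by exact: mbounded_circle.
have bpsi : mbounded psi by split; last by exists N.
have D (j : 'I_(ncells n)) : `|(ncells n)%:R * junif (j%:R / (ncells n)%:R) (j.+1%:R / (ncells n)%:R)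
    (fun t => phi (circle_pi (F n om t))) - junif 0 1 (fun t => phi (circle_pi (F n om t)))| <=
    fine (cell_dist n (ncells n) j om).
  apply: (@tv_junif R _ _ _ _ (F n om) (F n om)) => // k.
  by rewrite -lee_fin -ifin; apply: ereal_sup_ubound; exists k.
have := cell_decoupling m0 N0 bp (fun t => p1 _) bpsi psiN psiL D.
have SE : (\sum_(j < ncells n) cell_dist n (ncells n) j om = (\sum_(j < ncells n) fine (cell_dist n (ncells n) j om))%:E)%E.
  by rewrite -sumEFin; apply: eq_bigr => j _; exact: ifin.
rewrite -lee_fin => H; apply: le_trans H _.
by rewrite /cell_error SE EFinM EFinD EFinM.
Qed.
End mixing_constant.

(** * Norms and lifts of functions on the circle *)

Section circle_norms.
Variable R : realType.
Implicit Types (s t : R) (phi psi : circle R -> R) (x y : circle R).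

Lemma circle_dist_ge0 x y : 0 <= circle_dist x y.
Proof.
apply: lb_le_inf; last by move=> _ [t _ <-].
by exists `|repr (x - y)|; exists (repr (x - y)) => //=; exact: circle_repr.
Qed.

Lemma circle_dist_le s t : circle_dist (circle_pi s) (circle_pi t) <= `|s - t|.
Proof.
apply: ge_inf; first by exists 0 => _ [u _ <-].
by exists (s - t) => //=; exact: circle_piB.
Qed.

Lemma circle_dist_le1 x y : circle_dist x y <= 1.
Proof.
have [s s01 <-] := circle_repr01 x; have [t t01 <-] := circle_repr01 y.
by apply: le_trans (circle_dist_le s t) _; rewrite ler_norml; lra.
Qed.

Lemma circle_lebesgueT : circle_lebesgue [set: circle R] = 1%E.
Proof.
by rewrite /circle_lebesgue preimage_setT setTI lebesgue_measure_itv/= lte_fin ltr01 -EFinB subr0.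
Qed.

Lemma circle_lebesgueT_gt0 :
  (0 < (circle_lebesgue : {measure set (circle R) -> \bar R}) [set: circle R])%E.
Proof. by apply: (@lt_le_trans _ _ 1%E) => //; rewrite -circle_lebesgueT; exact: lexx. Qed.

Lemma norm_inftyE phi : norm_infty phi = ess_sup circle_lebesgue (abse \o (EFin \o phi)).
Proof. by rewrite /norm_infty unlock ifT// circle_lebesgueT_gt0. Qed.

Lemma norm_infty_bounded phi M : (forall x, `|phi x| <= M) -> (0 <= norm_infty phi <= M%:E)%E.
Proof.
move=> pM; rewrite norm_inftyE; apply/andP; split.
  apply: ess_sup_gee; first exact: circle_lebesgueT_gt0.
  by apply: nearW => x; exact: abse_ge0.
by apply/ess_supP; apply: nearW => x; rewrite /= lee_fin.
Qed.

Lemma norm_infty_ae phi M : (forall x, `|phi x| <= M) ->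
  {ae circle_lebesgue, forall x, `|phi x| <= fine (norm_infty phi)}.
Proof.
move=> pM; have /andP[n0 nM] := norm_infty_bounded pM.
have := ess_sup_ge circle_lebesgue (abse \o (EFin \o phi)).
apply: filterS => x; rewrite -norm_inftyE /= -lee_fin fineK// ge0_fin_numE//.
by rewrite (le_lt_trans nM)// ltry.
Qed.

Lemma circle_ae_ex (Q : circle R -> Prop) : {ae circle_lebesgue, forall x, Q x} -> exists x, Q x.
Proof.
move=> [N [mN N0 sN]]; apply: contrapT => H.
have : circle_lebesgue [set: circle R] = 0%E.
  rewrite -N0; congr circle_lebesgue; apply/seteqP; split => // x _; apply: sN => /= Qx.
  by apply: H; exists x.
by rewrite circle_lebesgueT => /eqP; rewrite onee_eq0.
Qed.

Lemma circle_lipschitz_bounded psi : circle_lipschitz psi -> exists M, forall x, `|psi x| <= M.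
Proof.
move=> [K HK]; exists (`|psi 0| + `|K|) => x.
have -> : psi x = psi 0 + (psi x - psi 0) by rewrite addrC subrK.
rewrite (le_trans (ler_normD _ _))// lerD2l (le_trans (HK _ _))//.
rewrite (le_trans (ler_norm _))// normrM -[leRHS]mulr1 ler_wpM2l//.
by rewrite ger0_norm ?circle_dist_ge0// circle_dist_le1.
Qed.

(** The norm contains an essential supremum, yet it bounds [psi] everywhere: some point satisfies
    [|psi x| <= norm_infty psi], and passing from it to any other point costs at most the Lipschitz
    constant, distances being at most 1. *)
Lemma norm_Lip_bound psi : circle_lipschitz psi -> exists N : R,
  [/\ norm_Lip psi = N%:E, forall x, `|psi x| <= N &
      forall s t, `|psi (circle_pi s) - psi (circle_pi t)| <= N * `|s - t|].
Proof.
move=> Lpsi; have [M psiM] := circle_lipschitz_bounded Lpsi; have [K HK] := Lpsi.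
have /andP[S0 SM] := norm_infty_bounded psiM.
pose Q : set (\bar R) := [set (`|psi z.1 - psi z.2| / circle_dist z.1 z.2)%:E |
              z in [set z : circle R * circle R | z.1 <> z.2]].
(* Two distinct points, so that the supremum of difference quotients is not taken over the empty
   set, where it would be [-oo]. *)
have half : circle_pi (2^-1) <> circle_pi 0 :> circle R.
  move/circle_pi_eq; rewrite subr0 => /intrP[n].
  move/(congr1 (fun r => r * 2)); rewrite mulVf// => E.
  have : (1 : int) = n * 2 by apply: (@intr_inj R); rewrite rmorphM/= -E.
  lia.
have Q0 : (0 <= ereal_sup Q)%E.
  apply: ereal_sup_ge; exists (`|psi (circle_pi 2^-1) - psi (circle_pi 0)| /
    circle_dist (circle_pi 2^-1) (circle_pi (0 : R)))%:E.
    by exists (circle_pi 2^-1, circle_pi 0).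
  by rewrite lee_fin divr_ge0// circle_dist_ge0.
have QK : (ereal_sup Q <= `|K|%:E)%E.
  apply: ub_ereal_sup => _ [z _ <-]; rewrite lee_fin.
  have := circle_dist_ge0 z.1 z.2; rewrite le_eqVlt => /orP[/eqP<-|d0]; first by rewrite invr0 mulr0.
  rewrite ler_pdivrMr// (le_trans (HK _ _))// ler_wpM2r//; first exact: ltW.
  exact: ler_norm.
have Qfin : ereal_sup Q \is a fin_num by rewrite ge0_fin_numE// (le_lt_trans QK)// ltry.
have Sfin : norm_infty psi \is a fin_num by rewrite ge0_fin_numE// (le_lt_trans SM)// ltry.
pose L := fine (ereal_sup Q); have L0 : 0 <= L by exact: fine_ge0.
pose S := fine (norm_infty psi); have S0' : 0 <= S by exact: fine_ge0.
have lip x y : `|psi x - psi y| <= L * circle_dist x y.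
  have := circle_dist_ge0 x y; rewrite le_eqVlt => /orP[/eqP d0|d0].
    by rewrite -d0 mulr0; have := HK x y; rewrite -d0 mulr0.
  rewrite -ler_pdivrMr// -lee_fin fineK//; apply: ereal_sup_ubound.
  exists (x, y) => //= xy; move: d0; rewrite xy => /lt_geF/negP; apply.
  have [t _ <-] := circle_repr01 y.
  by apply: le_trans (circle_dist_le t t) _; rewrite subrr normr0.
exists (S + L); split.
- by rewrite /norm_Lip EFinD !fineK.
- have [x Hx] := circle_ae_ex (norm_infty_ae psiM) => y.
  have -> : psi y = psi x + (psi y - psi x) by rewrite addrC subrK.
  rewrite (le_trans (ler_normD _ _))// lerD// (le_trans (lip _ _))//.
  by rewrite -[leRHS]mulr1 ler_wpM2l// circle_dist_le1.
- move=> s t; rewrite (le_trans (lip _ _))//; apply: ler_pM => //; first exact: circle_dist_ge0.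
    by rewrite lerDr.
  exact: circle_dist_le.
Qed.

Lemma lipschitz_continuous (f : R -> R) N : (forall s t, `|f s - f t| <= N * `|s - t|) -> continuous f.
Proof.
move=> H t; apply/cvgrPdist_le => e e0.
have N1 : 0 < `|N| + 1 by rewrite ltr_wpDl.
near=> s; rewrite (le_trans (H _ _))//.
have : `|t - s| <= e / (`|N| + 1).
  by near: s; apply: (@cvgr_dist_le _ _ _ _ _ id) => //; rewrite divr_gt0.
rewrite ler_pdivlMr// => h; apply: le_trans h; rewrite mulrC ler_wpM2l//.
by rewrite (le_trans (ler_norm _))// lerDl.
Unshelve. all: by end_near. Qed.

Lemma measurable_from_lift psi : continuous (fun t : R => psi (circle_pi t)) -> measurable_fun setT psi.
Proof.
move=> cp; rewrite (_ : psi = (fun t => psi (circle_pi t)) \o @sec R).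
  by apply: measurableT_comp; [exact: continuous_measurable_fun|exact: measurable_sec].
by apply/funext => x /=; rewrite sec_pi.
Qed.

Lemma lift_primitive (g : circle R -> R) : circle_derivable g ->
  primitive_of (fun t => g (circle_pi t)) (fun t => circle_derive g (circle_pi t)).
Proof.
move=> dg t; pose h s := g (circle_pi t + circle_pi s).
have dh : is_derive (0 : R) 1 h (circle_derive g (circle_pi t)).
  apply: DeriveDef; first exact: dg.
  by rewrite /circle_derive derive1E.
rewrite (_ : (fun s => g (circle_pi s)) = h \o (fun s => s - t)); last first.
  by apply/funext => s; rewrite /h/= -circle_piD addrC subrK.
rewrite -[circle_derive _ _]mulr1; apply: is_derive1_comp; first by rewrite subrr.
by apply: is_derive_eq; rewrite subr0.
Qed.

Lemma continuous_circle_pi : continuous (@circle_pi R).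
Proof. by apply/continuousP => U oU; exact: oU. Qed.

End circle_norms.

(** * The two correlation bounds *)

Section correlation.
Variables (R : realType) (eps : {posnum R}) (xi : circle R -> R) (a alpha : R).
Local Notation Xi := (fun t : R => xi (circle_pi t)).
Hypothesis cX : cper Xi.
Hypothesis null : forall w (N : set (circle R)), measurable N -> circle_lebesgue N = 0%E ->
  junif 0 1 (fun t => \1_N (circle_pi (Fw Xi alpha a w t)) : R) = 0.
Local Notation F := (@Fn R eps Xi alpha a).
Local Notation th := (@theta R eps).
Local Notation thi := (@theta_inv R eps).
Implicit Types (om : Omega eps) (phi psi : circle R -> R).
Variable K : R.-pker Omega eps ~> circle R.
Hypothesis KE : forall om B, K om B = limit_law xi a alpha om B.
Variable g : R.

Lemma measurable_fiter n om : measurable_fun setT (fiter xi a alpha n om).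
Proof.
elim: n => [|n ih]; first exact: measurable_id.
exact: (measurableT_comp (measurable_fmap1 _ _ cX (noise_at n om)) ih).
Qed.

Lemma fiter_null n om B : measurable B -> circle_lebesgue B = 0%E ->
  circle_lebesgue (fiter xi a alpha n om @^-1` B) = 0%E.
Proof.
elim: n B => [|n ih] B mB B0 //.
have mB' : measurable (Defs.fmap xi a alpha (noise_at n om) @^-1` B).
  by rewrite -[X in measurable X]setTI; exact: measurable_fmap1.
exact: ih mB' (fmap_null cX null _ mB B0).
Qed.

(** [phi] obeys its essential bound outside a null set, whose preimage under [h] is [mu]-null;
    clipping therefore leaves the integral unchanged. *)
Lemma integral_clip (mu : {measure set (circle R) -> \bar R}) (h : circle R -> circle R)
    phi psi (A : R) : measurable_fun setT h -> measurable_fun setT phi -> measurable_fun setT psi ->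
  (forall B, measurable B -> circle_lebesgue B = 0%E -> mu (h @^-1` B) = 0%E) ->
  {ae circle_lebesgue, forall x, `|phi x| <= A} ->
  (\int[mu]_x (phi (h x) * psi x)%:E = \int[mu]_x (clip A (phi (h x)) * psi x)%:E)%E.
Proof.
move=> mh mp mpsi nul [B [mB B0 sB]].
have mc : measurable_fun setT (clip A).
  by rewrite /clip; apply: measurable_maxr => //; exact: measurable_minr.
apply: ae_eq_integral => //.
- by apply/measurable_EFinP; apply: measurable_funM => //; exact: (measurableT_comp mp mh).
- apply/measurable_EFinP; apply: measurable_funM => //.
  by apply: (measurableT_comp mc); exact: (measurableT_comp mp mh).
exists (h @^-1` B); split; [by rewrite -[X in measurable X]setTI; exact: mh|exact: nul|].
move=> x /= H; apply: sB => /= pA; apply: H => _; by rewrite clip_id.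
Qed.

(** Both formulas at once: [z] is the noise at arrival, and the orbit starts at [theta^-n z]. The
    forward formula takes [z = theta^n omega], the backward one [z = omega]; the condition on
    [total_error] selects the matching half. *)
Lemma correlation n z om phi psi : measurable_fun setT phi -> bounded_fun phi -> circle_lipschitz psi ->
  (weight xi a alpha g om < +oo)%E ->
  (cell_error xi a alpha g n (iter n thi z) + 2%:E * tail xi a alpha n z <= total_error xi a alpha g n om)%E ->
  (`| \int[circle_lebesgue]_x (phi (fiter xi a alpha n (iter n thi z) x) * psi x)%:E
     - (\int[K z]_x (phi x)%:E) * (\int[circle_lebesgue]_x (psi x)%:E) |
   <= (mixing xi a alpha g om * expR (- (g / 8) * n%:R))%:E * norm_infty phi * norm_Lip psi)%E.
Proof.
move=> mp bp Lpsi wfin HX.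
have [M pM] : exists M, forall x, `|phi x| <= M.
  have [M [_ HM]] := bp; exists (M + 1) => x.
  by apply: HM => //; rewrite ltrDl.
have [N [nE psiN psiL]] := norm_Lip_bound Lpsi.
have N0 : 0 <= N := le_trans (normr_ge0 _) (psiN 0).
have mpsi : measurable_fun setT psi by apply: measurable_from_lift; exact: lipschitz_continuous psiL.
have /andP[A0 AM] := norm_infty_bounded pM.
have AE : norm_infty phi = (fine (norm_infty phi))%:E.
  by rewrite fineK// ge0_fin_numE// (le_lt_trans AM)// ltry.
have aeA := norm_infty_ae pM.
set A := fine (norm_infty phi) in AE aeA; have {}A0 : 0 <= A by exact: fine_ge0.
set om' := iter n thi z in HX *.
(* Normalised to be at most 1 in absolute value; if [A = 0] the clipped function vanishes, and so
   does [phi1]. *)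
pose phi1 x := A^-1 * clip A (phi x).
have clipE x : clip A (phi x) = A * phi1 x.
  rewrite /phi1; have := A0; rewrite le_eqVlt => /orP[/eqP A00|Ap]; last by rewrite mulVKf// gt_eqF.
  have h := clip_le (phi x) A0; rewrite -A00 in h *.
  by rewrite mul0r; apply/eqP; rewrite -normr_le0.
have p1 x : `|phi1 x| <= 1.
  rewrite /phi1 normrM ger0_norm ?invr_ge0//; have := clip_le (phi x) A0.
  have := A0; rewrite le_eqVlt => /orP[/eqP<-|Ap]; first by rewrite invr0 mul0r.
  by rewrite ler_pdivrMl// mulr1.
have mp1 : measurable_fun setT phi1.
  apply: measurable_funM => //; apply: (measurableT_comp (f := clip A)) => //.
  by rewrite /clip; apply: measurable_maxr => //; exact: measurable_minr.
have mh := measurable_fiter n om'.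
have mF := @measurable_F1 R eps xi a alpha cX n om'.
have mlift : measurable_fun setT (fun t : R => psi (circle_pi t)) by exact: (measurableT_comp mpsi (@measurable_circle_pi R)).
have bpsi : mbounded (fun t : R => psi (circle_pi t)) by split; last by exists N.
have bp1 : mbounded (fun t => phi1 (circle_pi (F n om' t))) by exact: mbounded_circle mp1 p1 mF.
pose J := junif 0 1 (fun t => phi1 (circle_pi (F n om' t)) * psi (circle_pi t)).
pose r := junif 0 1 (fun t => phi1 (circle_pi (F n om' t))).
pose q := junif 0 1 (fun t => psi (circle_pi t)).
pose k := (\int[K z]_x phi1 x)%R.
have E1 : (\int[circle_lebesgue]_x (phi (fiter xi a alpha n om' x) * psi x)%:E = (A * J)%:E)%E.
  rewrite (integral_clip mh mp mpsi (fiter_null n om') aeA).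
  have mm : measurable_fun setT (fun x => clip A (phi (fiter xi a alpha n om' x)) * psi x).
    rewrite (_ : (fun x => _) = fun x => A * phi1 (fiter xi a alpha n om' x) * psi x).
      apply: measurable_funM => //; apply: measurable_funM => //; exact: (measurableT_comp mp1 mh).
    by apply/funext => x; rewrite clipE.
  rewrite (circle_integral (M := A * N) mm); last first.
    by move=> x; rewrite normrM; apply: ler_pM => //; exact: clip_le.
  congr (_%:E); rewrite /J -junifZ; last exact: mboundedM.
  by congr (junif 0 1 _); apply/funext => t; rewrite fiter_pi clipE -mulrA.
have E2 : (\int[circle_lebesgue]_x (psi x)%:E = q%:E)%E by exact: circle_integral psiN.
have kint : (K z).-integrable setT (EFin \o phi1) by exact: K_fun_fin mp1 p1.
have mc1 : measurable_fun setT (fun _ : circle R => 1 : R) by exact: measurable_cst.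
have E3 : (\int[K z]_x (phi x)%:E = (A * k)%:E)%E.
  have H := @integral_clip (K z) id phi (fun=> 1) A (@measurable_id _ _ setT) mp mc1
    (K_null cX null KE z) aeA.
  have l : (\int[K z]_x (phi x)%:E = \int[K z]_x (phi x * 1)%:E)%E.
    by apply: eq_integral => x _; rewrite mulr1.
  have r' : (\int[K z]_x (clip A (phi x) * 1)%:E = \int[K z]_x (A%:E * (phi1 x)%:E))%E.
    by apply: eq_integral => x _; rewrite mulr1 clipE EFinM.
  apply: (etrans l); apply: (etrans H); apply: (etrans r').
  rewrite integralZl// /k EFinM; congr (_ * _)%E.
  by rewrite /Rintegral fineK//; exact: (integrable_fin_num measurableT kint).
rewrite E1 E2 E3 -EFinM -EFinB abse_EFin AE nE -!EFinM lee_fin.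
have q1 : `|q| <= N.
  apply: (le_trans (junif_abs _ _ bpsi)).
  have := @junif_le R 0 1 _ _ (mbounded_abs bpsi) (mbounded_cst N).
  by rewrite junif_cst// subr0 mulr1; apply => t _.
have J1 : `|J| <= N.
  apply: (le_trans (junif_abs _ _ (mboundedM bp1 bpsi))).
  have := @junif_le R 0 1 _ _ (mbounded_abs (mboundedM bp1 bpsi)) (mbounded_cst N).
  rewrite junif_cst// subr0 mulr1; apply => t _.
  by rewrite normrM -[leRHS]mul1r; apply: ler_pM.
have k1 : `|k| <= 1.
  apply: (le_trans (le_normr_Rintegral measurableT kint)).
  have n1 (x : circle R) : `|1 : R| <= 1 by rewrite normr1.
  have nn1 x : `| `|phi1 x| | <= 1 by rewrite normr_id.
  have i1 := K_fun_fin K z mc1 n1.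
  have i2 := K_fun_fin K z (measurableT_comp (@normr_measurable R setT) mp1) nn1.
  have := le_Rintegral measurableT i2 i1 (fun x _ => p1 x).
  by rewrite Rintegral_cst// prob_kernel mulr1.
have b2 : `|J - k * q| <= N * 2.
  apply: (le_trans (ler_normB _ _)); have := ler_pM (normr_ge0 k) (normr_ge0 q) k1 q1.
  by rewrite -normrM mul1r; lra.
(* [r] is the mean of [phi1] under the image of Lebesgue measure: [J] is close to [r * q] by
   decoupling on cells, and [r] to [k] by [K_dist]. *)
have bX : (`|J - k * q|%:E <= N%:E * total_error xi a alpha g n om)%E.
  apply: le_trans (lee_wpmul2l _ HX); last by rewrite lee_fin.
  rewrite ge0_muleDr ?cell_error_ge0 ?tl2_ge0//.
  have YB := @Y_bound R eps xi a alpha cX g n om' phi1 (fun t => psi (circle_pi t)) N mp1 p1 mlift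
    (fun t => psiN _) psiL.
  apply: le_trans (leeD YB (lee_wpmul2l _ (K_dist cX KE n z mp1 p1))); last by rewrite lee_fin.
  rewrite -EFinM -EFinD lee_fin.
  have -> : J - k * q = (J - r * q) - (k - r) * q by ring.
  apply: (le_trans (ler_normB _ _)); rewrite lerD2l normrM mulrC.
  by apply: ler_wpM2r.
have bZ : `|J - k * q| <= N * capped_error xi a alpha g n om.
  rewrite -lee_fin EFinM capped_errorE; case: (leP 2%:E (total_error xi a alpha g n om)) => h //.
have -> : A * J - A * k * q = A * (J - k * q) by ring.
rewrite normrM ger0_norm//.
apply: le_trans (ler_wpM2l A0 (le_trans bZ (ler_wpM2l N0 (capped_error_mixing n wfin)))) _.
by rewrite le_eqVlt; apply/orP; left; apply/eqP; ring.
Qed.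

End correlation.

Lemma exp_weaken (R : realType) (C C' g g' : R) n : 0 < C -> C <= C' -> g' <= g ->
  C * expR (- g * n%:R) <= C' * expR (- g' * n%:R).
Proof.
move=> C0 CC gg; apply: ler_pM => //; rewrite ?expR_ge0 ?(ltW C0)//.
by rewrite ler_expR ler_wpM2r// lerN2.
Qed.

(** The shift of [cons_noise w om] matches [om] on nonnegative indices only, the inserted value
    landing at index -1; those indices are all that [Fn] reads. *)
Lemma Fn_noise_ext (R : realType) (eps : {posnum R}) (Xi : R -> R) (alpha a : R) n (om om' : Omega eps) :
  (forall i : nat, noise_at i om = noise_at i om') ->
  forall t, Fn Xi alpha a n om t = Fn Xi alpha a n om' t.
Proof. by move=> H; elim: n => //= n ih t; rewrite ih H. Qed.

Theorem corollary2 (R : realType) (xi : circle R -> R) (a c : R)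
  (xi_C2 : circle_C2 xi) (xi_nd : nondegenerated xi)
  (a01 : 0 <= a < 1) (c01 : 0 < c < 1) :
  exists alpha0 : R, forall alpha : R, 0 < alpha -> alpha0 <= alpha ->
  forall eps : {posnum R}, alpha `^ (c - 1) < eps%:num ->
  forall P : probability (Omega eps) R, is_product_uniform P ->
  exists (mu_ : R.-pker Omega eps ~> circle R)
         (mu : probability (Omega eps * circle R)%type R),
  [/\ disintegrates P mu_ mu,
      invariant_measure (skew_product xi a alpha) mu,
      {ae P, forall omega, mu_ omega `<< circle_lebesgue} &
      exists (C : Omega eps -> R) (gamma : R),
      [/\ C \in Lfun P 2%:E, 0 < gamma &
        {ae P, forall omega, forall (n : nat) (phi psi : circle R -> R),
          measurable_fun setT phi -> bounded_fun phi -> circle_lipschitz psi ->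
          (`| \int[circle_lebesgue]_x
                 (phi (fiter xi a alpha n omega x) * psi x)%:E
              - (\int[mu_ (iter n (@theta R eps) omega)]_x (phi x)%:E)
                * (\int[circle_lebesgue]_x (psi x)%:E) |
           <= (C omega * expR (- gamma * n%:R))%:E
                * norm_infty phi * norm_Lip psi)%E
          /\
          (`| \int[circle_lebesgue]_x
                 (phi (fiter xi a alpha n (iter n (@theta_inv R eps) omega) x)
                  * psi x)%:E
              - (\int[mu_ omega]_x (phi x)%:E)
                * (\int[circle_lebesgue]_x (psi x)%:E) |
           <= (C omega * expR (- gamma * n%:R))%:E
                * norm_infty phi * norm_Lip psi)%E}]].
Proof.
have [D1 D2 D2c] := xi_C2.
pose Xi t := xi (circle_pi t); pose d1 t := circle_derive xi (circle_pi t).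
pose d2 t := circle_derive (circle_derive xi) (circle_pi t).
have pX : primitive_of Xi d1 := lift_primitive D1.
have p1 : primitive_of d1 d2 := lift_primitive D2.
have cX : cper Xi by split; [exact: primitive_continuous pX|move=> t; rewrite /Xi circle_pi1].
have c1 : cper d1 by split; [exact: primitive_continuous p1|move=> t; rewrite /d1 circle_pi1].
have c2 : cper d2.
  split; last by move=> t; rewrite /d2 circle_pi1.
  by move=> t; apply: continuous_comp; [exact: continuous_circle_pi|exact: D2c].
have nz t : d1 t = 0 -> d2 t <> 0 by move=> d0; apply: xi_nd.2.
have [k [M [k0 M0 ck]]] := cells_exist c1 c2 nz.
have [B1 [B10 HB1]] := cper_bounded c1; have [B2 [B20 HB2]] := cper_bounded c2.
pose B := B1 + B2; have B0 : 0 < B by exact: addr_gt0.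
have H1 t : `|d1 t| <= B by rewrite (le_trans (HB1 t))// lerDl ltW.
have H2 t : `|d2 t| <= B by rewrite (le_trans (HB2 t))// lerDr ltW.
have [alpha0 Hpar] := parameters B0 k0 M0 c01.
exists alpha0 => alpha _ aleq eps epsb P HP.
have [del [C1 [u0 [[al0 del0 del1 HC1 HL] [u00 u0E aB Lc6] alk Hl Hh]]]] := Hpar alpha eps aleq epsb.
have cnl f mf f0 := @cons_noise_law R eps P HP f mf f0.
have cnm f mf f0 := @cons_noise_meas R eps P f mf f0.
have c0 w om := @cons_noise0 R eps w om; have cS w om n := @cons_noiseS R eps w om n.
have [Ci [gi [Ci0 gi0 HIi]]] := decay_interval a cX c1 c2 pX p1 B0 H1 H2 al0 del0 k0 M0 ck
  (@cper_test R) (@test1 R) c0 cS cnl cnm del1 HC1 HL u00 u0E aB Lc6 alk Hl Hh.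
have [Cp [gp [Cp0 gp0 HPp]]] := decay_push a cX c1 c2 pX p1 B0 H1 H2 al0 del0 k0 M0 ck
  (@cper_test R) (@test1 R) c0 cS cnl cnm del1 HC1 HL u00 u0E aB Lc6 alk Hl Hh.
have null w N mN N0 := @push_null R eps Xi d1 d2 B alpha a cX c1 c2 pX p1 B0 H2 al0 del k M
  del0 del1 k0 M0 ck w N mN N0.
have Hgap n : (\int[P]_om gap xi a alpha n om <= (Cp * expR (- gp * n%:R))%:E)%E.
  apply: HPp; [exact: measurable_gap|by move=> om; exact: gap_ge0|move=> w om wb].
  rewrite /gap /dist /push; apply: (congr1 (fun f : nat -> \bar R => ereal_sup (range f))); apply/funext => i.
  congr (`|junif 0 1 _ - junif 0 1 _|%:E); apply/funext => t.
    by rewrite (Fn_cons Xi alpha a c0 cS).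
  congr (test i _); apply: Fn_noise_ext => m; rewrite -[RHS](cS w).
  by congr (sval (cons_noise w om _)); rewrite -addn1 PoszD.
have q01 : 0 < 1 - expR (- gp) by rewrite subr_gt0 -expR0 ltr_expR oppr_lt0.
(* A common rate and constant: the cells decay at rate [gi], the tails at rate [gp] with the
   constant of a geometric series. *)
pose g := Num.min gi gp; pose Cg := Ci + Cp / (1 - expR (- gp)).
have g0 : 0 < g by rewrite lt_min gi0.
have Ct0 : 0 < Cp / (1 - expR (- gp)) by exact: divr_gt0.
have Cg0 : 0 < Cg by exact: addr_gt0.
have HI n m j : (0 < m)%N -> (\int[P]_om cell_dist xi a alpha n m j om <= (Cg * expR (- g * n%:R) * m%:R)%:E)%E.
  move=> m0; apply: le_trans (HIi n m j m0) _; rewrite lee_fin ler_wpM2r//.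
  by apply: exp_weaken => //; [rewrite lerDl ltW|rewrite ge_min lexx].
have Htail n : (\int[P]_om tail xi a alpha n om <= (Cg * expR (- g * n%:R))%:E)%E.
  apply: le_trans (mean_tail cX HP Cp0 gp0 Hgap n) _; rewrite lee_fin.
  by apply: exp_weaken => //; [rewrite lerDr ltW|rewrite ge_min lexx orbT].
have [K KE] : exists K : R.-pker Omega eps ~> circle R, forall om B', K om B' = limit_law xi a alpha om B'.
  apply: family_pker; [exact: limit_law0|exact: limit_law_ge0|exact: limit_law_additive| |exact: limit_lawT].
  by move=> B' mB'; exact: measurable_limit_law.
have [mu [muE dis]] := joint_law P K.
exists K, mu; split => //.
- exact: (invariant_joint cX KE HP Cp0 gp0 Hgap muE).
- apply: nearW => om; apply/null_content_dominatesP => B' mB' B'0; exact: (K_null cX null KE).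
exists (mixing xi a alpha g), (g / 8); split.
- exact: (mixing_Lfun cX HP Cg0 g0 HI Htail).
- exact: divr_gt0.
have := ae_weight_fin cX HP Cg0 g0 HI Htail; apply: filterS => om wf n phi psi mphi bphi Lpsi; split.
- have e : iter n (@theta_inv R eps) (iter n (@theta R eps) om) = om.
    by elim: n => // n ih; rewrite iterSr /= theta_invK.
  have := @correlation R eps xi a alpha cX null K KE g n (iter n (@theta R eps) om) om phi psi
    mphi bphi Lpsi wf; rewrite e; apply.
  by rewrite /total_error; apply: leeDl; apply: adde_ge0; [exact: cell_error_ge0|exact: tl2_ge0].
- apply: (@correlation R eps xi a alpha cX null K KE g n om om phi psi mphi bphi Lpsi wf).
  by rewrite /total_error; apply: leeDr; apply: adde_ge0; [exact: cell_error_ge0|exact: tl2_ge0].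
Qed.
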